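(* Let $K$ be an algebraically closed field (of any characteristic), let $n\ge 1$, and let $X\subset \mathbb G_m^n$ be an irreducible, admissible algebraic subset of dimension $d$. Let $\delta$ be the dimension of the stabilizer $\mathrm{Stab}(X)$. Then there is a constant $c=c(X)>0$ such that $$\#X_T\le c\, T^{\,d+1-\frac{1}{d-\delta+1}}\quad\text{for all } T\ge 1.$$
   Context: $\mathbb G_m^n=\mathbb G_m^n(K)=(K\setminus\{0\})^n$ with coordinate-wise multiplication; subvarieties are identified with their sets of $K$-points. An algebraic subset of $\mathbb G_m^n$ is the common zero set in $\mathbb G_m^n$ of finitely many Laurent polynomials in $K[X_1^{\pm1},\dots,X_n^{\pm1}]$. A torsion point is an element of finite order $\mathrm{ord}(\cdot)$ of the group $\mathbb G_m^n$; $(\mathbb G_m^n)_{\mathrm{tors}}$ is the set of torsion points. For $X\subset\mathbb G_m^n$ and $T\ge1$, $X_T=\{\boldsymbol\zeta\in X\cap(\mathbb G_m^n)_{\mathrm{tors}}:\mathrm{ord}(\boldsymbol\zeta)\le T\}$. A linear torus is an irreducible algebraic subgroup of $\mathbb G_m^n$; a torsion coset is a set $\boldsymbol\zeta G$ with $\boldsymbol\zeta$ a torsion point and $G$ a linear torus. An algebraic subset $X$ of dimension $d$ is admissible if it is finite, or if $d\ge1$ and $X$ contains no torsion coset of dimension $d$. The stabilizer $\mathrm{Stab}(X)$ is the set of $\mathbf g\in\mathbb G_m^n$ with $\mathbf gX\subset X$; it is an algebraic subgroup of $\mathbb G_m^n$. *)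

(* Defs.v *)
From HB Require Import structures.
From mathcomp Require Import all_boot all_order all_algebra finmap.
From mathcomp Require Import all_classical all_reals all_analysis.
Import Order.TTheory GRing.Theory Num.Theory.

Set Implicit Arguments.
Unset Strict Implicit.
Unset Printing Implicit Defensive.

Local Open Scope classical_set_scope.
Local Open Scope ring_scope.

Record mulgroup (K : fieldType) : Type :=
  MulGroup { mulgroup_val : K; _ : mulgroup_val != 0 }.

Section MulGroup.
Variable K : fieldType.

HB.instance Definition _ := [isSub for @mulgroup_val K].
HB.instance Definition _ := [Choice of mulgroup K by <:].

Definition mulgroup_one : mulgroup K := Sub 1 (oner_neq0 K).

Fact mulgroup_inv_subproof (x : mulgroup K) : (val x)^-1 != 0.
Proof. by rewrite invr_eq0 (valP x). Qed.
Definition mulgroup_inv (x : mulgroup K) : mulgroup K :=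
  Sub (val x)^-1 (mulgroup_inv_subproof x).

Fact mulgroup_mul_subproof (x y : mulgroup K) : val x * val y != 0.
Proof. by rewrite mulf_neq0 // ?(valP x) ?(valP y). Qed.
Definition mulgroup_mul (x y : mulgroup K) : mulgroup K :=
  Sub (val x * val y) (mulgroup_mul_subproof x y).

Fact mulgroup_mulA : associative mulgroup_mul.
Proof. by move=> x y z; apply: val_inj; rewrite /= mulrA. Qed.
Fact mulgroup_mul1 : left_id mulgroup_one mulgroup_mul.
Proof. by move=> x; apply: val_inj; rewrite /= mul1r. Qed.
Fact mulgroup_mulr1 : right_id mulgroup_one mulgroup_mul.
Proof. by move=> x; apply: val_inj; rewrite /= mulr1. Qed.
Fact mulgroup_mulV : left_inverse mulgroup_one mulgroup_inv mulgroup_mul.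
Proof. by move=> x; apply: val_inj; rewrite /= mulVf // (valP x). Qed.
Fact mulgroup_mulrV : right_inverse mulgroup_one mulgroup_inv mulgroup_mul.
Proof. by move=> x; apply: val_inj; rewrite /= mulfV // (valP x). Qed.

HB.instance Definition _ := isGroup.Build (mulgroup K)
  mulgroup_mulA mulgroup_mul1 mulgroup_mulr1 mulgroup_mulV mulgroup_mulrV.

End MulGroup.

(* Its groupType structure is the coordinate-wise one on finite functions. *)
Notation Gm K n := {ffun 'I_n -> mulgroup K}.

Section Torus.
Variables (K : fieldType) (n : nat).
Implicit Types (X Y Z G : set (Gm K n)) (x g z : Gm K n) (d m : nat).

(* f a is the coefficient of the monomial X^a. *)
Definition laurent := {fsfun 'rV[int]_n -> K with 0}.

Definition leval (f : laurent) x : K :=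
  \sum_(a <- finsupp f)
    f a * \prod_(i < n) val (x i) ^ (a 0 i).

Definition algebraic X :=
  exists s : seq laurent, X = [set x | forall f, f \in s -> leval f x = 0].

Definition irreducible X :=
  [/\ algebraic X, X !=set0 &
      forall Y Z, algebraic Y -> algebraic Z ->
        X `<=` Y `|` Z -> X `<=` Y \/ X `<=` Z].

Definition irr_chain X d :=
  exists Z : nat -> set (Gm K n),
    (forall i, (i <= d)%N -> irreducible (Z i) /\ Z i `<=` X) /\
    (forall i, (i < d)%N -> Z i `<` Z i.+1).

(* Krull dimension for the Zariski topology; the empty set has none. *)
Definition has_dim X d :=
  irr_chain X d /\ forall m, irr_chain X m -> (m <= d)%N.

Definition torsion z := exists m, (0 < m)%N && (z ^+ m == 1)%g.

Definition ord z (tz : torsion z) : nat := ex_minn tz.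

Definition alg_subgroup G :=
  [/\ algebraic G, G 1%g,
      forall x y, G x -> G y -> G (x * y)%g &
      forall x, G x -> G (x^-1)%g].

Definition linear_torus G := alg_subgroup G /\ irreducible G.

Definition translate g X : set (Gm K n) := [set (g * x)%g | x in X].

Definition torsion_coset Y :=
  exists z G, [/\ torsion z, linear_torus G & Y = translate z G].

Definition admissible X :=
  finite_set X \/
  exists d, [/\ has_dim X d, (1 <= d)%N &
    forall Y, torsion_coset Y -> has_dim Y d -> ~ Y `<=` X].

Definition Stab X : set (Gm K n) := [set g | translate g X `<=` X].

Definition torsion_le (R : realType) X (T : R) : set (Gm K n) :=
  [set z | X z /\ exists tz : torsion z, (ord tz)%:R <= T].

End Torus.

(* Main.v *)
Require Import Defs.
From mathcomp Require Import all_boot all_order all_algebra finmap.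
From mathcomp Require Import all_classical all_reals all_analysis.
From mathcomp Require Import ring lra zify.
From mathcomp Require Import perm cyclic separable cyclotomic.
From mathcomp Require closed_field.
Import Order.TTheory GRing.Theory Num.Theory.
Local Open Scope classical_set_scope.
Local Open Scope ring_scope.
Set Implicit Arguments.
Unset Strict Implicit.
Unset Printing Implicit Defensive.

(** The bound comes from a box argument. Let [F] be a Laurent polynomial in [r]
    variables. A torsion point [z] of order [N] of the [r]-dimensional torus is
    [x ^ a] for a primitive [N]-th root of unity [x], and by Dirichlet some
    multiple [k * a] is congruent modulo [N] to a nonzero vector [b] of size about
    [N ^ (1 - 1 / r)] ([short_multiple]). So [z] lies on a coset of the
    one-parameter subgroup [t ^ b], translated by a torsion point of order
    [g = gcd (k, N)] ([short_coset]). There are about [T ^ (r - 1)] directions [b]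
    for the points of order at most [T], and on a coset [F] has at most about
    [|b|] zeros unless it vanishes identically; together this gives
    [T ^ (r - 1 / r)] points ([card_pure_zeros]), where the torsion translates only
    contribute the convergent series of inverse squares of [g].

    On an irreducible [X] of dimension [d] one uses a relation [F] between [r]
    characters. Take [r] least possible, modulo the characters that are constant on
    [X], and [F] with fewest terms ([minimal_relation]). If [F] vanishes on a whole
    coset, then some proper part of [F] vanishes at the point; by minimality this
    part does not vanish on all of [X], and a proper closed subset of [X] has only
    about [T ^ d] torsion points ([torsion_upto_proper]). Since [r - 1] of the [r]
    characters are algebraically independent on [X], the torsion points of order
    [N] over a given value are at most about [N ^ (d - r + 1)], and altogether
    there are at most about [T ^ (d + 1 - 1 / r)] ([torsion_upto_relation]).

    It remains to see that [r] is at most [d - delta + 1]. When [X] is not a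
    torsion coset, there are more than [d] characters that are independent modulo
    the constant ones, at least [delta] of them independent on the stabilizer and
    the others of finite order on it. More than [d] characters are dependent on [X], and
    translation by the stabilizer splits their relation into relations between the
    others alone ([small_dependent_family], [cdep_stabilizer]). When [X] is a
    torsion coset, admissibility leaves only finite [X].

    Dimension enters through algebraic independence of functions. A chain of
    irreducible subsets yields as many independent functions as it has steps
    ([chain_indep]). Conversely independent functions yield a chain
    ([indep_chain]): the image of [X] under them contains a nonempty open set, by
    quantifier elimination, so one may fix the value of a function and keep the
    others independent; the Noetherian property then provides an irreducible
    piece. Neither argument depends on the characteristic. *)

(** * Monomials and Laurent functions *)
Section Monomials.
Variables (K : fieldType) (n : nat).
Implicit Types (x y : Gm K n) (a b : 'rV[int]_n).

Definition mono a x : K := \prod_(i < n) val (x i) ^ a 0 i.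

Lemma mono_neq0 a x : mono a x != 0.
Proof. by apply/prodf_neq0 => i _; rewrite expfz_neq0 // (valP (x i)). Qed.

Lemma monoD a b x : mono (a + b) x = mono a x * mono b x.
Proof.
rewrite -big_split; apply: eq_bigr => i _.
by rewrite mxE expfzDr // (valP (x i)).
Qed.

Lemma mono0 x : mono 0 x = 1.
Proof. by apply: big1 => i _; rewrite mxE expr0z. Qed.

Lemma monoZ (k : int) a x : mono (k *: a) x = mono a x ^ k.
Proof.
rewrite /mono; elim/big_rec2: _ => [|i u v _ ->]; first by rewrite exp1rz.
by rewrite mxE expfzMl exprz_exp [k * _]mulrC.
Qed.

Lemma monoM a x y : mono a (x * y)%g = mono a x * mono a y.
Proof.
rewrite -big_split; apply: eq_bigr => i _ /=.
by rewrite ffunE expfzMl.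
Qed.

Lemma mono1 a : mono a 1%g = 1.
Proof. by apply: big1 => i _; rewrite ffunE /= exp1rz. Qed.

Lemma monoX a x m : mono a (x ^+ m)%g = mono a x ^+ m.
Proof.
elim: m => [|m IHm]; first by rewrite expg0 mono1 expr0.
by rewrite expgS monoM IHm exprS.
Qed.

Definition coordf (i : 'I_n) x : K := val (x i).

Lemma coordE i x : coordf i x = mono (delta_mx 0 i) x.
Proof.
rewrite /mono (bigD1 i) //= big1 ?mulr1 => [|j ji].
  by rewrite mxE !eqxx expr1z.
by rewrite mxE (negPf ji) andbF expr0z.
Qed.

(** Laurent polynomials are handled as functions that are finite sums of
    monomials: the listed exponents may repeat, so sums and products are
    concatenations and pairings of lists. *)
Definition lsum (s : seq (K * 'rV[int]_n)) x : K :=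
  \sum_(p <- s) p.1 * mono p.2 x.

Definition lfun (h : Gm K n -> K) := exists s, forall x, h x = lsum s x.

Lemma lfun_ext f g : (forall x, f x = g x) -> lfun g -> lfun f.
Proof. by move=> fg [s gE]; exists s => x; rewrite fg gE. Qed.

Lemma lfun_mono a : lfun (mono a).
Proof. by exists [:: (1, a)] => x; rewrite /lsum big_seq1 mul1r. Qed.

Lemma lfun_cst c : lfun (fun=> c).
Proof. by exists [:: (c, 0)] => x; rewrite /lsum big_seq1 mono0 mulr1. Qed.

Lemma lfun_coord i : lfun (coordf i).
Proof. by apply: lfun_ext (lfun_mono _) => x; apply: coordE. Qed.

Lemma lfunD f g : lfun f -> lfun g -> lfun (fun x => f x + g x).
Proof.
move=> [s fE] [t gE]; exists (s ++ t) => x.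
by rewrite fE gE /lsum big_cat.
Qed.

Lemma lfunM f g : lfun f -> lfun g -> lfun (fun x => f x * g x).
Proof.
move=> [s fE] [t gE]; exists [seq (p.1 * q.1, p.2 + q.2) | p <- s, q <- t] => x.
rewrite fE gE /lsum big_allpairs_dep mulr_suml; apply: eq_bigr => p _.
by rewrite mulr_sumr; apply: eq_bigr => q _ /=; rewrite monoD mulrACA.
Qed.

Lemma lfunN f : lfun f -> lfun (fun x => - f x).
Proof.
move=> /(lfunM (lfun_cst (-1))).
by apply: lfun_ext => x; rewrite mulN1r.
Qed.

Lemma lfunB f g : lfun f -> lfun g -> lfun (fun x => f x - g x).
Proof. by move=> lf /lfunN; apply: lfunD. Qed.

Lemma lfun_sum (I : Type) (r : seq I) (F : I -> Gm K n -> K) :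
  (forall i, lfun (F i)) -> lfun (fun x => \sum_(i <- r) F i x).
Proof.
move=> lF; elim: r => [|i r IHr].
  by apply: lfun_ext (lfun_cst 0) => x; rewrite big_nil.
by apply: lfun_ext (lfunD (lF i) IHr) => x; rewrite big_cons.
Qed.

Lemma lfun_leval (f : laurent K n) : lfun (leval f).
Proof. by exists [seq (f a, a) | a <- finsupp f] => x; rewrite /lsum big_map. Qed.

(** Repeated exponents are collected into the coefficients of one finitely
    supported function. *)
Lemma lfun_laurent h : lfun h -> exists f : laurent K n, leval f = h.
Proof.
move=> [s hE].
pose E := [fset p.2 | p in s]%fset.
pose c a := \sum_(p <- s | p.2 == a) p.1.
pose f : laurent K n := [fsfun a in E => c a | 0].
exists f; apply/funext => x; rewrite hE /leval /lsum.
have fE a : f a = c a.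
  rewrite fsfunE; case: ifPn => // aE; rewrite /c big_seq_cond big1 // => p.
  move=> /andP[ps /eqP pa]; case/negP: aE; rewrite -pa.
  by apply/imfsetP; exists p.
transitivity (\sum_(a <- E) f a * mono a x).
  apply: big_fset_incl.
    by apply/fsubsetP => a; rewrite mem_finsupp fsfunE; case: ifP; rewrite ?eqxx.
  by move=> a _; rewrite memNfinsupp => /eqP ->; rewrite mul0r.
under eq_bigr do rewrite fE /c mulr_suml.
rewrite (exchange_big_dep xpredT) //= big_seq [RHS]big_seq; apply: eq_bigr => p ps.
have pE : p.2 \in E by apply/imfsetP; exists p.
rewrite big_mkcond (bigD1_seq p.2 pE (fset_uniq _)) eqxx big1 => [|a /negPf].
  exact: addr0.
by rewrite eq_sym => ->.
Qed.

End Monomials.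

(** * Polynomial functions of lists of values *)

Section PolynomialFunctions.
Variable K : closedFieldType.
Implicit Types (e u v : seq K) (p q : seq K -> K).

(** Generating polynomial functions inductively makes every closure property
    below a structural induction; over an infinite field nothing is lost
    against formal polynomials. *)
Inductive polyfun : (seq K -> K) -> Prop :=
| polyfun_cst c : polyfun (fun=> c)
| polyfun_var i : polyfun (fun e => e`_i)
| polyfunD p q : polyfun p -> polyfun q -> polyfun (fun e => p e + q e)
| polyfunM p q : polyfun p -> polyfun q -> polyfun (fun e => p e * q e).

Lemma polyfun_ext p q : (forall e, p e = q e) -> polyfun q -> polyfun p.
Proof. by move=> /funext ->. Qed.

Lemma polyfunN p : polyfun p -> polyfun (fun e => - p e).
Proof.
move=> /(polyfunM (polyfun_cst (-1))); apply: polyfun_ext => e.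
by rewrite mulN1r.
Qed.

Lemma polyfunX p m : polyfun p -> polyfun (fun e => p e ^+ m).
Proof.
move=> pp; elim: m => [|m IHm].
  by apply: polyfun_ext (polyfun_cst 1) => e; rewrite expr0.
by apply: polyfun_ext (polyfunM pp IHm) => e; rewrite exprS.
Qed.

Lemma polyfun_sum (I : Type) (r : seq I) (F : I -> seq K -> K) :
  (forall i, polyfun (F i)) -> polyfun (fun e => \sum_(i <- r) F i e).
Proof.
move=> lF; elim: r => [|i r IHr].
  by apply: polyfun_ext (polyfun_cst 0) => x; rewrite big_nil.
by apply: polyfun_ext (polyfunD (lF i) IHr) => x; rewrite big_cons.
Qed.

Lemma polyfun_prod (I : Type) (r : seq I) (F : I -> seq K -> K) :
  (forall i, polyfun (F i)) -> polyfun (fun e => \prod_(i <- r) F i e).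
Proof.
move=> lF; elim: r => [|i r IHr].
  by apply: polyfun_ext (polyfun_cst 1) => x; rewrite big_nil.
by apply: polyfun_ext (polyfunM (lF i) IHr) => x; rewrite big_cons.
Qed.

Lemma closed_poly_eq (P Q : {poly K}) : (forall z, P.[z] = Q.[z]) -> P = Q.
Proof.
move=> PQ; apply/eqP; rewrite -subr_eq0; apply/negPn/negP => /closed_nonrootP[z].
by rewrite rootE hornerD hornerN PQ subrr eqxx.
Qed.

Lemma polyfun_cons p z : polyfun p -> polyfun (fun e => p (z :: e)).
Proof.
elim=> [c|[|i]|p1 q1 _ IHp _ IHq|p1 q1 _ IHp _ IHq] /=.
- exact: polyfun_cst.
- exact: polyfun_cst.
- exact: polyfun_var.
- exact: polyfunD.
- exact: polyfunM.
Qed.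

Lemma polyfun_degree p : polyfun p ->
  exists D, forall e, exists2 P : {poly K},
    (size P <= D)%N & forall z, P.[z] = p (z :: e).
Proof.
elim=> [c|[|i]|p1 q1 _ [D1 H1] _ [D2 H2]|p1 q1 _ [D1 H1] _ [D2 H2]] /=.
- by exists 1 => e; exists c%:P; rewrite ?size_polyC_leq1 // => z; rewrite hornerC.
- by exists 2 => e; exists 'X; rewrite ?size_polyX // => z; rewrite hornerX.
- by exists 1 => e; exists (e`_i)%:P; rewrite ?size_polyC_leq1 // => z; rewrite hornerC.
- exists (maxn D1 D2) => e; have [P1 s1 E1] := H1 e; have [P2 s2 E2] := H2 e.
  exists (P1 + P2) => [|z]; last by rewrite hornerD E1 E2.
  apply: leq_trans (size_polyD _ _) _.
  by rewrite geq_max !leq_max s1 s2 orbT.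
- exists (D1 + D2)%N => e; have [P1 s1 E1] := H1 e; have [P2 s2 E2] := H2 e.
  exists (P1 * P2) => [|z]; last by rewrite hornerM E1 E2.
  apply: leq_trans (size_polyMleq _ _) _.
  by apply: leq_trans (leq_pred _) _; apply: leq_add.
Qed.

Lemma polyfun_behead p z : polyfun p -> polyfun (fun e => p (z :: behead e)).
Proof.
elim=> [c|[|i]|p1 q1 _ IHp _ IHq|p1 q1 _ IHp _ IHq] /=.
- exact: polyfun_cst.
- exact: polyfun_cst.
- by apply: polyfun_ext (polyfun_var i.+1) => e; rewrite nth_behead.
- exact: polyfunD.
- exact: polyfunM.
Qed.

(** Division by the first variable: the quotient of a product is found by
    the Leibniz-like formula for a difference of products. *)
Lemma polyfun_div p : polyfun p ->
  exists2 q, polyfun q & forall z e, p (z :: e) = p (0 :: e) + z * q (z :: e).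
Proof.
elim=> [c|[|i]|p1 q1 pp [p1' pp' E1] pq [q1' pq' E2]|p1 q1 pp [p1' pp' E1] pq [q1' pq' E2]].
- by exists (fun=> 0); [exact: polyfun_cst | move=> z e; rewrite mulr0 addr0].
- by exists (fun=> 1); [exact: polyfun_cst | move=> z e; rewrite mulr1 add0r].
- by exists (fun=> 0); [exact: polyfun_cst | move=> z e; rewrite mulr0 addr0].
- exists (fun e => p1' e + q1' e); first exact: polyfunD.
  by move=> z e; rewrite E1 E2; ring.
- exists (fun e => p1' e * q1 e + p1 (0 :: behead e) * q1' e).
    apply: polyfunD; apply: polyfunM => //.
    exact: polyfun_behead.
  by move=> z e /=; rewrite [p1 (z :: e)]E1 [in LHS]E2 [q1 (z :: e)]E2; ring.
Qed.

Definition line m u v z : seq K := mkseq (fun i => u`_i + z * (v`_i - u`_i)) m.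

Lemma line0 m u v : size u = m -> line m u v 0 = u.
Proof.
move=> su; apply: (@eq_from_nth _ 0); rewrite size_mkseq // => i im.
by rewrite nth_mkseq // mul0r addr0.
Qed.

Lemma line1 m u v : size v = m -> line m u v 1 = v.
Proof.
move=> su; apply: (@eq_from_nth _ 0); rewrite size_mkseq // => i im.
by rewrite nth_mkseq // mul1r subrKC.
Qed.

Lemma polyfun_line m u v p : polyfun p ->
  exists P : {poly K}, forall z, P.[z] = p (line m u v z).
Proof.
elim=> [c|i|p1 q1 _ [P1 E1] _ [P2 E2]|p1 q1 _ [P1 E1] _ [P2 E2]].
- by exists c%:P => z; rewrite hornerC.
- have [im|mi] := ltnP i m.
    exists ((u`_i)%:P + 'X * (v`_i - u`_i)%:P) => z.
    by rewrite hornerD hornerM hornerX !hornerC nth_mkseq.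
  by exists 0 => z; rewrite horner0 nth_default // size_mkseq.
- by exists (P1 + P2) => z; rewrite hornerD E1 E2.
- by exists (P1 * P2) => z; rewrite hornerM E1 E2.
Qed.

(** Affine space is irreducible: two nonvanishing points are joined by a
    line, along which both functions are nonzero polynomials of one
    variable. *)
Lemma polyfun_domain p q u v m : polyfun p -> polyfun q ->
  size u = m -> size v = m -> p u != 0 -> q v != 0 ->
  exists2 w, size w = m & (p w != 0) && (q w != 0).
Proof.
move=> pp pq su sv pu qv.
have [P PE] := polyfun_line m u v pp; have [Q QE] := polyfun_line m u v pq.
have P0 : P != 0.
  by apply: contraNneq pu => P0; rewrite -(line0 v su) -PE P0 horner0.
have Q0 : Q != 0.
  by apply: contraNneq qv => Q0; rewrite -(line1 u sv) -QE Q0 horner0.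
have /closed_nonrootP[z] : P * Q != 0 by rewrite mulf_neq0.
rewrite rootM negb_or !rootE PE QE => nz.
by exists (line m u v z); rewrite ?size_mkseq.
Qed.

End PolynomialFunctions.

(** * Algebraic sets and algebraic independence *)

Section Independence.
Variables (K : closedFieldType) (n : nat).
Implicit Types (X Y Z : set (Gm K n)) (f g : Gm K n -> K).
Implicit Types (F : seq (Gm K n -> K)).

Definition evals F (x : Gm K n) : seq K := [seq f x | f <- F].

Lemma size_evals F x : size (evals F x) = size F.
Proof. exact: size_map. Qed.

Lemma lfun_polyfun p F : polyfun p -> (forall f, List.In f F -> lfun f) ->
  lfun (fun x => p (evals F x)).
Proof.
move=> pp lF; elim: pp => [c|i|q r _ IHq _ IHr|q r _ IHq _ IHr].
- exact: lfun_cst.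
- elim: F lF i => [|f F IHF] lF i.
    by apply: lfun_ext (lfun_cst n 0) => x; rewrite nth_nil.
  case: i => [|i] /=; first by apply: lF; left.
  by apply: IHF => g gF; apply: lF; right.
- exact: lfunD.
- exact: lfunM.
Qed.

Lemma algebraic_zero (s : seq (Gm K n -> K)) : (forall f, List.In f s -> lfun f) ->
  algebraic [set x | forall f, List.In f s -> f x = 0].
Proof.
elim: s => [|f s IHs] ls.
  by exists [::]; apply/seteqP; split=> x //=.
have [t tE] := IHs (fun g gs => ls g (or_intror gs)).
have [h hE] := lfun_laurent (ls f (or_introl erefl)).
exists (h :: t); apply/seteqP; split=> x /=.
  move=> H g; rewrite inE => /predU1P[->|gt]; first by rewrite hE; apply: H; left.
  have : [set x | forall f, List.In f s -> f x = 0] x by move=> k ks; apply: H; right.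
  by rewrite tE => /(_ g gt).
move=> H g [<-|gs]; first by rewrite -hE; apply: H; rewrite mem_head.
have : [set x | forall k : laurent K n, k \in t -> leval k x = 0] x.
  by move=> k ks; apply: H; rewrite inE ks orbT.
by rewrite -tE; apply.
Qed.

Lemma algebraic_zero1 f : lfun f -> algebraic [set x | f x = 0].
Proof.
move=> lf; have [] := @algebraic_zero [:: f]; first by move=> g [<-|].
move=> s sE; exists s; rewrite -sE; apply/seteqP; split=> x /=.
  by move=> fx g [<-|].
by apply; left.
Qed.

Lemma algebraicI X Y : algebraic X -> algebraic Y -> algebraic (X `&` Y).
Proof.
move=> [s ->] [t ->]; exists (s ++ t); apply/seteqP; split=> x /=.
  by move=> [Hs Ht] f; rewrite mem_cat => /orP[/Hs|/Ht].
by move=> H; split=> f fs; apply: H; rewrite mem_cat fs ?orbT.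
Qed.

Lemma algebraic_separate X x : algebraic X -> ~ X x ->
  exists2 f, lfun f & (forall y, X y -> f y = 0) /\ f x != 0.
Proof.
move=> [s ->] /=; rewrite -existsNP => -[f] /not_implyP[fs /eqP fx].
by exists (leval f); [exact: lfun_leval | split=> // y; apply].
Qed.

(** The vanishing ideal of [Z] is prime. Unlike irreducibility this refers
    to no closed subsets, so it can be established for sets that are not yet
    known to be closed. *)
Definition prime_set Z := forall f g, lfun f -> lfun g ->
  (forall x, Z x -> f x * g x = 0) ->
  (forall x, Z x -> f x = 0) \/ (forall x, Z x -> g x = 0).

Lemma irreducible_prime Z : irreducible Z -> prime_set Z.
Proof.
move=> [_ _ irrZ] f g lf lg fg.
apply: (irrZ _ _ (algebraic_zero1 lf) (algebraic_zero1 lg)) => x /fg /eqP.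
by rewrite mulf_eq0 => /orP[/eqP|/eqP] ?; [left|right].
Qed.

(** Nonzero relations are recognized by their values: a polynomial function
    that kills the family on [Z] must vanish at every list of the right
    length. *)
Definition indep F Z := forall p, polyfun p ->
  (forall x, Z x -> p (evals F x) = 0) -> forall e, size e = size F -> p e = 0.

Lemma indepS F Z Z' : Z `<=` Z' -> indep F Z -> indep F Z'.
Proof. by move=> ZZ' iF p pp pZ; apply: iF => // x /ZZ'; apply: pZ. Qed.

Lemma indep_nil Z : Z !=set0 -> indep [::] Z.
Proof. by move=> [x Zx] p _ pZ e /size0nil ->; have := pZ x Zx. Qed.

Lemma dependP F Z : ~ indep F Z -> exists2 p, polyfun p &
  (forall x, Z x -> p (evals F x) = 0) /\ exists2 e, size e = size F & p e != 0.
Proof.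
move=> /existsNP[p] /not_implyP[pp] /not_implyP[pZ] /existsNP[e].
by move=> /not_implyP[se /eqP pe]; exists p => //; split=> //; exists e.
Qed.

(** In a relation between [g] and [F] on [Z'], primality lets one divide by
    powers of [g] until the terms free of [g] form a nonzero relation on the
    zero set of [g]. *)
Lemma indep_cons F g Z Z' : (forall f, List.In f F -> lfun f) -> lfun g ->
  Z `<=` Z' -> prime_set Z' -> (forall x, Z x -> g x = 0) ->
  (exists2 x, Z' x & g x != 0) -> indep F Z -> indep (g :: F) Z'.
Proof.
move=> lF lg ZZ' pZ' gZ [x0 Z'x0 gx0] iF p pp pZ'0.
suff main : forall z e, size e = size F -> p (z :: e) = 0.
  by case=> [|z e] //= [] /main.
have [D HD] := polyfun_degree pp.
have {HD} : forall e, size e = size F -> exists2 P : {poly K},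
    (size P <= D)%N & forall z, P.[z] = p (z :: e) by move=> e _; apply: HD.
elim: D p pp pZ'0 => [|D IHD] p pp pZ'0 HD z e se.
  have [P] := HD e se; rewrite leqn0 size_poly_eq0 => /eqP -> /(_ z) <-.
  by rewrite horner0.
have p0 e' : size e' = size F -> p (0 :: e') = 0.
  apply: (iF (fun e => p (0 :: e))) e'; first exact: polyfun_cons.
  by move=> x Zx; have := pZ'0 x (ZZ' x Zx); rewrite /= gZ.
have [q pq qE] := polyfun_div pp.
rewrite qE p0 // add0r (IHD q) ?mulr0 //.
  have [] // := pZ' g (fun x => q (evals (g :: F) x)) lg.
  - by apply: lfun_polyfun => // f [<-|/lF].
  - move=> x Z'x; have := pZ'0 x Z'x; rewrite /= qE p0 ?add0r //.
    exact: size_evals.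
  - by move=> g0; rewrite g0 ?eqxx in gx0.
move=> e' se'; have [P sP PE] := HD e' se'.
have [D' /(_ e')[Q _ QE]] := polyfun_degree pq.
exists Q => //.
have PQ : P = Q * 'X.
  apply: closed_poly_eq => y.
  by rewrite PE qE p0 // add0r hornerM hornerX QE mulrC.
have [->|Q0] := eqVneq Q 0; first by rewrite size_poly0.
by move: sP; rewrite PQ size_mulX.
Qed.

(** Each step of the chain contributes, by [indep_cons], a function that
    vanishes on the smaller set and not on the larger one. *)
Lemma chain_indep Z m : irr_chain Z m ->
  exists F, [/\ (forall f, List.In f F -> lfun f), size F = m & indep F Z].
Proof.
move=> [C [irrC ltC]].
suff H k : (k <= m)%N ->
    exists F, [/\ (forall f, List.In f F -> lfun f), size F = k & indep F (C k)].
  have [F [lF sF iF]] := H m (leqnn m); exists F; split=> //.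
  by apply: indepS iF; have [] := irrC m (leqnn m).
elim: k => [_|k IHk km].
  exists [::]; split=> //; apply: indep_nil.
  by have [[]] := irrC 0 (leq0n m).
have [F [lF sF iF]] := IHk (ltnW km).
have [[algk _ _] _] := irrC k (ltnW km).
have [irrk1 _] := irrC k.+1 km.
have [sub /existsNP[x /not_implyP[Cx nCx]]] := ltC k km.
have [g lg [gZ gx]] := algebraic_separate algk nCx.
exists (g :: F); split; first by move=> f [<-|/lF].
  by rewrite /= sF.
apply: (indep_cons lF lg sub (irreducible_prime irrk1) gZ _ iF).
by exists x.
Qed.

End Independence.

(** * The Zariski topology is Noetherian *)

Section Noetherian.

Definition ideal_set (A : comNzRingType) (I : set A) :=
  [/\ I 0, (forall a b, I a -> I b -> I (a + b)) & forall c a, I a -> I (c * a)].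

(** Finite generation in order-theoretic form, which avoids writing
    combinations of generators. *)
Definition noetherian (A : comNzRingType) := forall I : set A, ideal_set I ->
  exists2 s : seq A, (forall a, a \in s -> I a) &
    forall J, ideal_set J -> (forall a, a \in s -> J a) -> I `<=` J.

Lemma ideal_setB (A : comNzRingType) (I : set A) a b :
  ideal_set I -> I a -> I b -> I (a - b).
Proof. by move=> [_ ID IM] Ia Ib; apply: ID => //; rewrite -mulN1r; apply: IM. Qed.

Lemma noetherian_field (F : fieldType) : noetherian F.
Proof.
move=> I [I0 ID IM]; have [[a Ia a0]|nI] := pselect (exists2 a, I a & a != 0).
  exists [:: a] => [b|J [_ _ JM] sJ b _]; first by rewrite inE => /eqP ->.
  have -> : b = b / a * a by rewrite divfK.
  by apply/JM/sJ; rewrite mem_head.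
exists [::] => // J [J0 _ _] _ b Ib; have [-> //|b0] := eqVneq b 0.
by case: nI; exists b.
Qed.

(** The ideals of leading coefficients in Hilbert's proof of his basis
    theorem; allowing smaller degrees, hence a zero coefficient, makes them
    ideals. *)
Definition lead_ideal (A : comNzRingType) (I : set {poly A}) j : set A :=
  [set c | exists p, [/\ I p, (size p <= j.+1)%N & p`_j = c]].

Lemma lead_ideal_set (A : comNzRingType) (I : set {poly A}) j :
  ideal_set I -> ideal_set (lead_ideal I j).
Proof.
move=> [I0 ID IM]; split.
- by exists 0; rewrite size_poly0 coef0.
- move=> a b [p [Ip sp <-]] [q [Iq sq <-]]; exists (p + q).
  split; [exact: ID| |exact: coefD].
  by apply: leq_trans (size_polyD _ _) _; rewrite geq_max sp.
- move=> c a [p [Ip sp <-]]; exists (c%:P * p).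
  split; [exact: IM| |exact: coefCM].
  by rewrite mul_polyC; apply: leq_trans (size_scale_leq _ _) sp.
Qed.

Lemma lead_ideal_le (A : comNzRingType) (I : set {poly A}) i j :
  ideal_set I -> (i <= j)%N -> lead_ideal I i `<=` lead_ideal I j.
Proof.
move=> [I0 ID IM] ij c [p [Ip sp <-]]; exists ('X^(j - i) * p).
split; first exact: IM.
  have [->|p0] := eqVneq p 0; first by rewrite mulr0 size_poly0.
  by rewrite mulrC size_mulXn //; move: sp ij; lia.
by rewrite coefXnM ltnNge leq_subr subKn.
Qed.

(** Hilbert's basis theorem. The leading coefficient ideals increase with
    the degree and stabilize at some [m]; finitely many polynomials of [I]
    realize generators of those of degree at most [m], and an ideal
    containing them captures each element of [I] by descent on the degree. *)
Lemma noetherian_poly (A : comNzRingType) : noetherian A -> noetherian {poly A}.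
Proof.
move=> noethA I idI; have [I0 ID IM] := idI.
pose L := [set c | exists j, lead_ideal I j c].
have idL : ideal_set L.
  split=> [|a b [i Li] [j Lj]|c a [j Lj]].
  - by exists 0; case: (lead_ideal_set 0 idI).
  - exists (maxn i j); have [_ LD _] := lead_ideal_set (maxn i j) idI.
    by apply: LD; [apply: lead_ideal_le Li|apply: lead_ideal_le Lj];
      rewrite ?leq_maxl ?leq_maxr.
  - by exists j; have [_ _ LM] := lead_ideal_set j idI; apply: LM.
have [s sL Ls] := noethA L idL.
have [m sm] : exists m, forall c, c \in s -> lead_ideal I m c.
  elim: s sL {Ls} => [|c s IHs] sL; first by exists 0.
  have [m Hm] := IHs (fun a as_ => sL a (@mem_behead _ (c :: s) a as_)).
  have [j Hj] := sL c (mem_head _ _).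
  exists (maxn m j) => a; rewrite inE => /predU1P[->|/Hm].
    exact: (lead_ideal_le idI (leq_maxr m j)).
  exact: (lead_ideal_le idI (leq_maxl m j)).
have Lm j : lead_ideal I j `<=` lead_ideal I (minn j m).
  move=> c Lc; have [jm|/ltnW mj] := leqP j m; first by [].
  by apply: (Ls _ (lead_ideal_set m idI) sm); exists j.
have lift j : exists2 G : seq {poly A}, (forall p, p \in G -> I p) &
    forall J, ideal_set J -> (forall p, p \in G -> J p) ->
      lead_ideal I j `<=` lead_ideal (I `&` J) j.
  have [t tL Lt] := noethA _ (lead_ideal_set j idI).
  have [G GI Gt] : exists2 G : seq {poly A}, (forall p, p \in G -> I p) &
      forall c, c \in t -> exists p, [/\ p \in G, (size p <= j.+1)%N & p`_j = c].
    elim: t tL {Lt} => [|c t IHt] tL; first by exists [::].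
    have [G GI Gt] := IHt (fun a as_ => tL a (@mem_behead _ (c :: t) a as_)).
    have [p [Ip sp pc]] := tL c (mem_head _ _).
    exists (p :: G) => [q|b]; first by rewrite inE => /predU1P[->|/GI].
    rewrite inE => /predU1P[->|/Gt[q [qG sq qb]]]; first by exists p; rewrite mem_head.
    by exists q; rewrite inE qG orbT.
  exists G => // J idJ GJ; have [J0 JD JM] := idJ.
  apply: Lt => [|c /Gt[p [pG sp pc]]].
    apply: lead_ideal_set; split=> [|a b [Ia Ja] [Ib Jb]|c a [Ia Ja]] //.
      by split; [apply: ID|apply: JD].
    by split; [apply: IM|apply: JM].
  by exists p; split=> //; split; [apply: GI|apply: GJ].
have [G GI GL] : exists2 G : seq {poly A}, (forall p, p \in G -> I p) &
    forall J, ideal_set J -> (forall p, p \in G -> J p) ->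
    forall j, (j <= m)%N -> lead_ideal I j `<=` lead_ideal (I `&` J) j.
  elim: (m) => [|k [G GI GL]].
    have [G GI GL] := lift 0; exists G => // J idJ GJ j.
    by rewrite leqn0 => /eqP ->; apply: GL.
  have [G' GI' GL'] := lift k.+1; exists (G' ++ G) => [p|J idJ GJ j].
    by rewrite mem_cat => /orP[/GI'|/GI].
  rewrite leq_eqVlt => /predU1P[->|]; [apply: GL' => //|apply: GL => //].
    by move=> p pG; apply: GJ; rewrite mem_cat pG.
  by move=> p pG; apply: GJ; rewrite mem_cat pG orbT.
exists G => // J idJ GJ; have [J0 JD JM] := idJ.
suff H k (p : {poly A}) : (size p <= k)%N -> I p -> J p by move=> p; apply: (H (size p)).
elim: k p => [|k IHk] p sp Ip.
  by move: sp; rewrite leqn0 size_poly_eq0 => /eqP ->.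
have : lead_ideal I k p`_k by exists p.
move=> /Lm /(GL J idJ GJ _ (geq_minr _ _)).
have idIJ : ideal_set (I `&` J).
  split=> [|a b [Ia Ja] [Ib Jb]|c a [Ia Ja]] //.
    by split; [apply: ID|apply: JD].
  by split; [apply: IM|apply: JM].
move=> /(lead_ideal_le idIJ (geq_minl _ _)) [q [[Iq Jq] sq qk]].
rewrite -(subrK q p); apply: JD => //; apply: IHk; last exact: ideal_setB.
apply/leq_sizeP => i; rewrite leq_eqVlt coefB => /predU1P[<-|ki].
  by rewrite qk subrr.
by rewrite !nth_default ?subrr // (leq_trans _ ki).
Qed.

End Noetherian.

Section DescendingChains.
Variables (K : closedFieldType) (n : nat).
Implicit Types (X Y Z : set (Gm K n)) (f g : Gm K n -> K).

(** Rings of polynomials in [k] variables are built as a tower, so that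
    Hilbert's theorem applies at each storey. *)
Fixpoint poly_tower k : comNzRingType :=
  if k is k'.+1 then {poly (poly_tower k')} else K.

Lemma noetherian_tower k : noetherian (poly_tower k).
Proof.
by elim: k => [|k IHk]; [apply: noetherian_field|apply: noetherian_poly].
Qed.

Fixpoint tower_eval (e : seq K) k : {rmorphism poly_tower k -> K} :=
  match k return {rmorphism poly_tower k -> K} with
  | 0 => (idfun : {rmorphism K -> K})
  | k'.+1 => (horner_morph (fun a => mulrC e`_k' (tower_eval e k' a))
                : {rmorphism {poly (poly_tower k')} -> K})
  end.

Lemma tower_eval_cst c k : exists P : poly_tower k, forall e, tower_eval e k P = c.
Proof.
elim: k => [|k [P PE]]; first by exists c.
by exists P%:P => e; rewrite /= horner_morphC PE.
Qed.

Lemma tower_eval_var i k : (i < k)%N ->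
  exists P : poly_tower k, forall e, tower_eval e k P = e`_i.
Proof.
elim: k => // k IHk; rewrite ltnS leq_eqVlt => /predU1P[->|/IHk[P PE]].
  by exists 'X => e; rewrite /= horner_morphX.
by exists P%:P => e; rewrite /= horner_morphC PE.
Qed.

Lemma tower_eval_polyfun (p : seq K -> K) k : polyfun p ->
  exists P : poly_tower k, forall e, size e = k -> tower_eval e k P = p e.
Proof.
elim=> [c|i|p1 q1 _ [P1 E1] _ [P2 E2]|p1 q1 _ [P1 E1] _ [P2 E2]].
- by have [P PE] := tower_eval_cst c k; exists P.
- have [/tower_eval_var[P PE]|ki] := ltnP i k; first by exists P.
  by exists 0 => e se; rewrite rmorph0 nth_default ?se.
- by exists (P1 + P2) => e se; rewrite rmorphD E1 ?E2.
- by exists (P1 * P2) => e se; rewrite rmorphM E1 ?E2.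
Qed.

Definition coords : seq (Gm K n -> K) := [seq @coordf K n i | i <- enum 'I_n].

Lemma size_coords : size coords = n.
Proof. by rewrite size_map size_enum_ord. Qed.

Lemma nth_coords (i : 'I_n) x : (evals coords x)`_i = coordf i x.
Proof.
by rewrite /evals /coords -map_comp (nth_map i) ?size_enum_ord // nth_ord_enum.
Qed.

Lemma coords_surj v : size v = n -> \prod_(i < n) v`_i != 0 ->
  exists x : Gm K n, evals coords x = v.
Proof.
move=> sv Pv; have v0 (i : 'I_n) : v`_i != 0.
  by move: Pv; rewrite (bigD1 i) //= mulf_eq0 negb_or => /andP[].
exists [ffun i : 'I_n => MulGroup (v0 i)]; apply: (@eq_from_nth _ 0).
  by rewrite size_evals size_coords.
move=> i; rewrite size_evals size_coords => ltin.
by rewrite -[i]/(nat_of_ord (Ordinal ltin)) nth_coords /coordf ffunE.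
Qed.

Lemma coords_inj x y : evals coords x = evals coords y -> x = y.
Proof.
move=> xy; apply/ffunP => i; apply: val_inj.
by have := nth_coords i x; rewrite xy nth_coords.
Qed.

Lemma exponent_bound m (s : seq (K * 'rV[int]_m)) :
  exists M : nat, forall p, p \in s -> forall i, (`|p.2 0%R i| <= M)%N.
Proof.
exists (\sum_(p <- s) \sum_i `|p.2 0%R i|)%N => p ps i.
by rewrite (big_rem p) //= (bigD1 i) //= -addnA leq_addr.
Qed.

Lemma mono_clear (a : 'rV[int]_n) (M : nat) (x : Gm K n) : (forall i, (`|a 0%R i| <= M)%N) ->
  (\prod_i coordf i x) ^+ M * mono a x = \prod_i coordf i x ^+ absz (a 0 i + M%:Z).
Proof.
move=> aM; rewrite -prodrXl -big_split; apply: eq_bigr => i _ /=.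
rewrite !exprnP -[mulgroup_val (x i)]/(coordf i x) -expfzDr; last exact: (valP (x i)).
congr (_ ^ _).
have := aM i; lia.
Qed.

(** A power of the product of the coordinates clears the negative exponents;
    it vanishes nowhere on the torus. *)
Lemma lfun_clear f : lfun f -> exists M, exists2 p, polyfun p &
  forall x, p (evals coords x) = (\prod_i coordf i x) ^+ M * f x.
Proof.
move=> [s fE]; have [M sM] := exponent_bound s.
exists M, (fun e => \sum_(q <- s) q.1 * \prod_(i < n) e`_i ^+ absz (q.2 0 i + M%:Z)).
  apply: polyfun_sum => q; apply: polyfunM; first exact: polyfun_cst.
  by apply: polyfun_prod => i; apply/polyfunX/polyfun_var.
move=> x; rewrite fE /lsum mulr_sumr big_seq [RHS]big_seq; apply: eq_bigr => q qs.
rewrite mulrCA mono_clear; last exact: sM.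
by congr (_ * _); apply: eq_bigr => i _; rewrite nth_coords.
Qed.

Lemma prod_coord_neq0 (x : Gm K n) : \prod_(i < n) coordf i x != 0.
Proof. by apply/prodf_neq0 => i _; apply: (valP (x i)). Qed.

(** Otherwise dependent choice gives a strictly decreasing sequence. Its
    vanishing ideals have a finitely generated union, which is reached at a
    finite stage, where the sequence cannot decrease any more. *)
Lemma algebraic_min (C : set (set (Gm K n))) : (forall X, C X -> algebraic X) ->
  C !=set0 -> exists2 X, C X & forall Y, C Y -> Y `<=` X -> X `<=` Y.
Proof.
move=> algC [X0 CX0]; apply: contrapT => noMin.
have step (U : {X | C X}) : exists V : {X | C X}, sval V `<` sval U.
  apply: contrapT => nV; apply: noMin; exists (sval U); first exact: (svalP U).
  move=> Y CY YU; apply: contrapT => nUY; apply: nV.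
  by exists (exist _ Y CY); split.
have [nxt nxtP] := choice step.
pose W k := sval (iter k nxt (exist _ X0 CX0)).
have Wlt k : W k.+1 `<` W k by apply: nxtP.
have Wle i j : (i <= j)%N -> W j `<=` W i.
  move=> /subnK <-; elim: (j - i)%N => // k IHk.
  by apply: subset_trans IHk; rewrite addSn; case: (Wlt (k + i)%N).
pose ev x := tower_eval (evals coords x) n.
pose I := [set P : poly_tower n | exists k, forall x, W k x -> ev x P = 0].
have idI : ideal_set I.
  split=> [|P Q [i Pi] [j Qj]|c P [k Pk]].
  - by exists 0 => x _; rewrite /ev rmorph0.
  - exists (maxn i j) => x Wx; rewrite /ev rmorphD /=.
    rewrite [X in X + _]Pi ?[X in _ + X]Qj ?addr0 //.
      by apply: Wle Wx; apply: leq_maxr.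
    by apply: Wle Wx; apply: leq_maxl.
  - by exists k => x Wx; rewrite /ev rmorphM /= [X in _ * X]Pk ?mulr0.
have [s sI Is] := noetherian_tower idI.
have [k sk] : exists k, forall P, P \in s -> forall x, W k x -> ev x P = 0.
  elim: s sI {Is} => [|P s IHs] sI; first by exists 0.
  have [k Hk] := IHs (fun a as_ => sI a (@mem_behead _ (P :: s) a as_)).
  have [j Hj] := sI P (mem_head _ _).
  exists (maxn k j) => Q; rewrite inE => /predU1P[->|/Hk HQ] x Wx.
    by apply: Hj; apply: Wle Wx; apply: leq_maxr.
  by apply: HQ; apply: Wle Wx; apply: leq_maxl.
have IW P : I P -> forall x, W k x -> ev x P = 0.
  apply: (Is [set P | forall x, W k x -> ev x P = 0]); last exact: sk.
  split=> [x _|A B A0 B0 x Wx|c A A0 x Wx].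
  - by rewrite /ev rmorph0.
  - by rewrite /ev rmorphD /= [X in X + _]A0 // [X in _ + X]B0 // addr0.
  - by rewrite /ev rmorphM /= [X in _ * X]A0 // mulr0.
have [_ [x [Wx nWx]]] : W k.+1 `<=` W k /\ exists x, W k x /\ ~ W k.+1 x.
  have [sub /existsNP[x /not_implyP[Wx nWx]]] := Wlt k.
  by split=> //; exists x.
have algW : algebraic (W k.+1) by apply/algC/svalP.
have [f lf [fW /eqP fx]] := algebraic_separate algW nWx.
have [M [p pp pE]] := lfun_clear lf.
have [P PE] := tower_eval_polyfun n pp.
case: fx; have evP y : ev y P = (\prod_i coordf i y) ^+ M * f y.
  by rewrite -pE; apply: PE; rewrite size_evals size_coords.
have /(_ x Wx) : forall x, W k x -> ev x P = 0.
  by apply: IW; exists k.+1 => y /fW fy; rewrite evP fy mulr0.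
move=> /eqP; rewrite evP mulf_eq0 expf_eq0 (negPf (prod_coord_neq0 x)) andbF.
by move=> /eqP.
Qed.

End DescendingChains.

(** * Images of algebraic sets *)

Section Definable.
Variable K : closedFieldType.
Implicit Types (e v : seq K) (p q : seq K -> K) (A B : seq K -> Prop).

Definition definable m A := exists f : GRing.formula K,
  forall e, size e = m -> GRing.holds e f <-> A e.

Lemma definable_ext m A B : (forall e, size e = m -> A e <-> B e) ->
  definable m A -> definable m B.
Proof.
by move=> AB [f fA]; exists f => e se; rewrite fA //; apply: AB.
Qed.

Lemma definable_eq0 m p : polyfun p -> definable m (fun e => p e = 0).
Proof.
move=> pp; suff [t tp] : exists t : GRing.term K, forall e, GRing.eval e t = p e.
  by exists (GRing.Equal t (GRing.Const 0)) => e _ /=; rewrite tp.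
elim: pp => [c|i|q r _ [t tE] _ [u uE]|q r _ [t tE] _ [u uE]].
- by exists (GRing.Const c).
- by exists (GRing.Var K i).
- by exists (GRing.Add t u) => e /=; rewrite tE uE.
- by exists (GRing.Mul t u) => e /=; rewrite tE uE.
Qed.

Lemma definableN m A : definable m A -> definable m (fun e => ~ A e).
Proof. by move=> [f fA]; exists (GRing.Not f) => e se /=; rewrite fA. Qed.

Lemma definableI m A B :
  definable m A -> definable m B -> definable m (fun e => A e /\ B e).
Proof.
by move=> [f fA] [g gB]; exists (GRing.And f g) => e se /=; rewrite fA ?gB.
Qed.

Lemma definable_all m (I : eqType) (s : seq I) (A : I -> seq K -> Prop) :
  (forall i, definable m (A i)) -> definable m (fun e => forall i, i \in s -> A i e).
Proof.
move=> dA; elim: s => [|i s IHs]; first by exists (GRing.Bool true).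
apply: definable_ext (definableI (dA i) IHs) => e se; split.
  by move=> [Ai As] j; rewrite inE => /predU1P[->|/As].
move=> H; split=> [|j js]; apply: H; first exact: mem_head.
by rewrite inE js orbT.
Qed.

Lemma definable_exists m k A : definable (m + k) A ->
  definable m (fun e => exists2 v, size v = k & A (e ++ v)).
Proof.
elim: k A => [|k IHk] A.
  rewrite addn0; apply: definable_ext => e se; split.
    by exists [::]; rewrite ?cats0.
  by move=> [v /size0nil ->]; rewrite cats0.
move=> [f fA]; have /IHk : definable (m + k) (fun e => exists z, A (rcons e z)).
  exists (GRing.Exists (m + k) f) => e se /=.
  have setE z : set_nth 0 e (m + k) z = rcons e z.
    by rewrite -se; elim: e {se} => //= a e <-.
  split=> -[z]; rewrite ?setE => Az; exists z; rewrite ?setE.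
    by rewrite -fA ?size_rcons ?se ?addnS.
  by rewrite fA ?size_rcons ?se ?addnS.
apply: definable_ext => e se; split.
  move=> [v sv [z Az]]; exists (rcons v z); first by rewrite size_rcons sv.
  by rewrite -rcons_cat.
move=> [v sv]; case/lastP: v sv => // v z; rewrite size_rcons => -[sv] Av.
by exists v => //; exists z; rewrite rcons_cat.
Qed.

(** A first-order condition is constant on a nonempty Zariski open set: this is
    plain for polynomial equations, survives Boolean combinations, and
    quantifier elimination leaves nothing else. *)
Lemma definable_generic m A : definable m A ->
  exists2 q, polyfun q /\ (exists2 e, size e = m & q e != 0) &
    (forall e, size e = m -> q e != 0 -> A e) \/
    (forall e, size e = m -> q e != 0 -> ~ A e).
Proof.
move=> [f0 fA].
pose wf := @closed_field.ClosedFieldQE.wf_ex_elim K.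
pose ok := closed_field.ClosedFieldQE.holds_ex_elim (@GRing.solve_monicpoly K).
pose f := GRing.quantifier_elim (@closed_field.ClosedFieldQE.ex_elim K)
            (GRing.to_rform f0).
have fP e : size e = m -> reflect (A e) (GRing.qf_eval e f).
  move=> se; apply: (iffP (GRing.quantifier_elim_rformP wf ok e
                             (GRing.to_rform_rformula f0))).
    by move=> /GRing.to_rformP /fA; apply.
  by move=> Ae; apply/GRing.to_rformP/fA.
have /andP[] := GRing.quantifier_elim_wf wf (GRing.to_rform_rformula f0).
rewrite -/f => qf_f r_f; suff [q [pq q0] [b qb]] : exists2 q,
    polyfun q /\ (exists2 e, size e = m & q e != 0) & exists b,
    forall e, size e = m -> q e != 0 -> GRing.qf_eval e f = b.
  exists q => //; case: b qb => qb; [left|right] => e se qe.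
    by apply/(fP e se); rewrite qb.
  by move=> /(fP e se); rewrite qb.
have [e1 se1] : exists e, size e = m by exists (nseq m 0); rewrite size_nseq.
have termP (t : GRing.term K) : GRing.rterm t -> polyfun (fun e => GRing.eval e t).
  elim: t => //= [i|x|k|t IHt u IHu|t IHt|t IHt k|t IHt u IHu|t IHt k].
  - by move=> _; apply: polyfun_var.
  - by move=> _; apply: polyfun_cst.
  - by move=> _; apply: polyfun_cst.
  - by move=> /andP[/IHt ? /IHu ?]; apply: polyfunD.
  - by move=> /IHt; apply: polyfunN.
  - move=> /IHt pt; apply: polyfun_ext (polyfunM pt (polyfun_cst k%:R)) => e.
    by rewrite mulr_natr.
  - by move=> /andP[/IHt ? /IHu ?]; apply: polyfunM.
  - by move=> /IHt; apply: polyfunX.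
have both (g h : GRing.formula K) (op : bool -> bool -> bool) :
  (exists2 q, polyfun q /\ (exists2 e, size e = m & q e != 0) & exists b,
    forall e, size e = m -> q e != 0 -> GRing.qf_eval e g = b) ->
  (exists2 q, polyfun q /\ (exists2 e, size e = m & q e != 0) & exists b,
    forall e, size e = m -> q e != 0 -> GRing.qf_eval e h = b) ->
  exists2 q, polyfun q /\ (exists2 e, size e = m & q e != 0) & exists b,
    forall e, size e = m -> q e != 0 ->
      op (GRing.qf_eval e g) (GRing.qf_eval e h) = b.
  move=> [q [pq [e se qe]] [b qb]] [r [pr [e' se' re']] [c rc]].
  exists (fun e => q e * r e).
    split; first exact: polyfunM.
    have [w sw /andP[qw rw]] := polyfun_domain pq pr se se' qe re'.
    by exists w; rewrite ?mulf_neq0.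
  exists (op b c) => e'' se''; rewrite mulf_eq0 negb_or => /andP[qe'' re''].
  by rewrite qb // rc.
elim: (f) qf_f r_f => //= [b|t u|g IHg h IHh|g IHg h IHh|g IHg h IHh|g IHg].
- move=> _ _; exists (fun=> 1); last by exists b.
  by split; [exact: polyfun_cst|exists e1; rewrite ?oner_neq0].
- move=> _ /andP[rt ru]; pose q e := GRing.eval e t - GRing.eval e u.
  have pq : polyfun q.
    by apply: polyfunD; [apply: termP|apply/polyfunN/termP].
  have [[e [se qe]]|nq] := pselect (exists e, size e = m /\ q e != 0).
    exists q; first by split=> //; exists e.
    by exists false => e' _; rewrite subr_eq0 => /negPf.
  exists (fun=> 1).
    by split; [exact: polyfun_cst|exists e1; rewrite ?oner_neq0].
  exists true => e se _; rewrite -subr_eq0; apply/negPn/negP => qe.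
  by apply: nq; exists e.
- by move=> /andP[qg qh] /andP[rg rh]; apply: both; [apply: IHg|apply: IHh].
- by move=> /andP[qg qh] /andP[rg rh]; apply: both; [apply: IHg|apply: IHh].
- by move=> /andP[qg qh] /andP[rg rh]; apply: (both _ _ implb); [apply: IHg|apply: IHh].
- move=> qg rg; have [q Hq [b qb]] := IHg qg rg.
  by exists q => //; exists (~~ b) => e se qe; rewrite qb.
Qed.

Lemma polyfun_drop m p : polyfun p -> polyfun (fun e => p (drop m e)).
Proof.
elim=> [c|i|q r _ IHq _ IHr|q r _ IHq _ IHr].
- exact: polyfun_cst.
- by apply: polyfun_ext (polyfun_var K (m + i)) => e; rewrite nth_drop.
- exact: polyfunD.
- exact: polyfunM.
Qed.

End Definable.

Section GenericImage.
Variables (K : closedFieldType) (n : nat).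
Implicit Types (X Y Z : set (Gm K n)) (f g : Gm K n -> K).

(** The points of the torus with given values are described by cleared
    equations in the coordinates, multiplied by the product of the
    coordinates so that they say nothing outside the torus. *)
Lemma definable_image X (F : seq (Gm K n -> K)) : algebraic X ->
  (forall f, List.In f F -> lfun f) ->
  definable (size F) (fun e => exists2 x, X x & evals F x = e).
Proof.
move=> [s ->] lF; set m := size F.
pose P v := \prod_(i < n) v`_i : K.
have pP : polyfun P by apply: polyfun_prod => i; apply: polyfun_var.
have PE x : P (evals (coords K n) x) = \prod_i coordf i x.
  by apply: eq_bigr => i _; rewrite nth_coords.
have clr f : lfun f -> exists M, exists2 p, polyfun p &
    forall x, p (evals (coords K n) x) = P (evals (coords K n) x) ^+ M * f x.
  by move=> /lfun_clear[M [p pp pE]]; exists M, p => // x; rewrite PE.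
have P0 x : P (evals (coords K n) x) != 0 by rewrite PE prod_coord_neq0.
have toP v : size v = n -> P v != 0 -> exists x : Gm K n, evals (coords K n) x = v.
  exact: coords_surj.
have sdef (f : laurent K n) : definable (m + n) (fun e => forall x,
    evals (coords K n) x = drop m e -> leval f x = 0).
  have [M [p pp pE]] := clr _ (lfun_leval f).
  have pq := polyfunM (polyfun_drop m pp) (polyfun_drop m pP).
  apply: definable_ext (definable_eq0 _ pq) => e se.
  split=> [pe x xE|H].
    move/eqP: pe; rewrite -xE pE !mulf_eq0 expf_eq0 (negPf (P0 x)) andbF orbF.
    by move=> /eqP.
  have [->|Pe] := eqVneq (P (drop m e)) 0; first by rewrite mulr0.
  have [|x xE] := toP (drop m e) _ Pe; first by rewrite size_drop se addKn.
  by rewrite -xE pE H // mulr0 mul0r.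
have Fdef (j : 'I_m) : definable (m + n) (fun e => forall x,
    evals (coords K n) x = drop m e -> (evals F x)`_j = e`_j).
  have lj : lfun (fun x => (evals F x)`_j).
    exact: (lfun_polyfun (polyfun_var K j) lF).
  have [M [p pp pE]] := clr _ lj.
  have pq : polyfun (fun e => (p (drop m e) - P (drop m e) ^+ M * e`_j) * P (drop m e)).
    apply: polyfunM; last exact: polyfun_drop.
    apply: polyfunD; first exact: polyfun_drop.
    apply: polyfunN; apply: polyfunM; last exact: polyfun_var.
    by apply/polyfunX/polyfun_drop.
  apply: definable_ext (definable_eq0 _ pq) => e se; split=> [pe x xE|H].
    move/eqP: pe; rewrite -xE pE -mulrBr !mulf_eq0 expf_eq0 (negPf (P0 x)).
    by rewrite andbF orbF subr_eq0 => /eqP.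
  have [->|Pe] := eqVneq (P (drop m e)) 0; first by rewrite mulr0.
  have [|x xE] := toP (drop m e) _ Pe; first by rewrite size_drop se addKn.
  by rewrite -xE pE H // subrr mul0r.
have := definable_exists (definableI (definableN (definable_eq0 _ (polyfun_drop m pP)))
  (definableI (definable_all s sdef) (definable_all (enum 'I_m) Fdef))).
apply: definable_ext => e se; split.
  move=> [v sv]; rewrite drop_size_cat // => -[/eqP Pv [sv0 Fv]].
  have [x xE] := toP v sv Pv; exists x => [f fs|]; first exact: (sv0 f fs x).
  apply: (@eq_from_nth _ 0); rewrite ?size_evals //.
  move=> i im; have /= := Fv (Ordinal im) (mem_enum _ _) x xE.
  by rewrite nth_cat se im.
move=> [x Xx xe]; exists (evals (coords K n) x); first by rewrite size_evals size_coords.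
rewrite drop_size_cat //; split; first exact/eqP.
split=> [f fs y /coords_inj ->|j _ y /coords_inj ->]; first exact: Xx.
by rewrite nth_cat se ltn_ord xe.
Qed.

End GenericImage.

Section IndependentChain.
Variables (K : closedFieldType) (n : nat).
Implicit Types (X Y Z : set (Gm K n)) (f g : Gm K n -> K).

Lemma indep_nonempty (F : seq (Gm K n -> K)) Z : indep F Z -> Z !=set0.
Proof.
move=> iF; apply: contrapT => Z0.
have /eqP : (1 : K) = 0.
  apply: (iF (fun=> 1) _ _ (nseq (size F) 0)); rewrite ?size_nseq //.
    exact: polyfun_cst.
  by move=> x Zx; case: Z0; exists x.
by rewrite oner_eq0.
Qed.

(** A generic value [c] of the first function cuts out a subset of [X] on
    which the other functions stay independent, because the image of [X]
    contains a nonempty open set; a minimal closed subset with that property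
    is irreducible. *)
Lemma indep_chain X (F : seq (Gm K n -> K)) : irreducible X ->
  (forall f, List.In f F -> lfun f) -> indep F X -> irr_chain X (size F).
Proof.
elim: F X => [|f F IHF] X irrX lF iF.
  by exists (fun=> X); split=> i; rewrite ?ltn0 //; split.
have lF' g : List.In g F -> lfun g by move=> gF; apply: lF; right.
have [algX _ _] := irrX.
have [q [pq [e0 se0 qe0]] [Hq|Hq]] := definable_generic (definable_image algX lF);
  last first.
  move: qe0; rewrite (iF q pq) ?eqxx // => x Xx.
  apply/eqP/negPn/negP => /Hq; apply; last by exists x.
  exact: size_evals.
case: e0 se0 qe0 => // c e0 [se0] qe0.
pose C := [set Y | [/\ algebraic Y, Y `<=` X, forall y, Y y -> f y = c & indep F Y]].
have [||Z [algZ ZX Zc iZ] Zmin] := @algebraic_min K n C.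
- by move=> Y [].
- exists (X `&` [set y | f y - c = 0]); split.
  + apply: algebraicI => //; apply: algebraic_zero1; apply: lfunB.
      by apply: lF; left.
    exact: lfun_cst.
  + exact: subIsetl.
  + by move=> y [_ /= /eqP]; rewrite subr_eq0 => /eqP.
  + move=> p pp pY e se; apply/eqP/negPn/negP => pe.
    have [w sw /andP[qw]] :=
      polyfun_domain (polyfun_cons c pq) pp se0 se qe0 pe.
    have [|x Xx /= [fx Fx]] := Hq (c :: w) _ qw; first by rewrite /= sw.
    by rewrite -Fx pY ?eqxx //; split=> //=; rewrite fx subrr.
have irrZ : irreducible Z.
  split=> //; first exact: indep_nonempty iZ.
  move=> A B algA algB ZAB; apply: contrapT => /not_orP[nA nB].
  have dep D : algebraic D -> ~ Z `<=` D -> ~ indep F (Z `&` D).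
    move=> algD nD iD; apply: nD; apply: subset_trans (Zmin (Z `&` D) _ _) _.
    - split=> //; first exact: algebraicI.
        exact: subset_trans ZX.
      by move=> y [/Zc].
    - exact: subIsetl.
    - exact: subIsetr.
  have [p pp [pA [e se pe]]] := dependP (dep A algA nA).
  have [r pr [rB [e' se' re']]] := dependP (dep B algB nB).
  have [w sw /andP[pw rw]] := polyfun_domain pp pr se se' pe re'.
  have : p w * r w = 0.
    apply: (iZ _ (polyfunM pp pr)) sw => x Zx.
    by case: (ZAB x Zx) => ?; [rewrite pA ?mul0r|rewrite rB ?mulr0].
  by move=> /eqP; rewrite mulf_eq0 (negPf pw) (negPf rw).
have [D [irrD ltD]] := IHF Z irrZ lF' iZ.
exists (fun i => if (i <= size F)%N then D i else X); split=> i.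
  case: ifP => [iF' _|_ _]; last by split.
  by have [irrDi DiZ] := irrD i iF'; split=> //; apply: subset_trans ZX.
rewrite /= ltnS => iF'; rewrite iF'; case: ltnP => [|Fi]; first exact: ltD.
have [_ DiZ] := irrD i iF'.
split=> [|XD]; first exact: subset_trans ZX.
have cst e : size e = (size F).+1 -> e`_0 - c = 0.
  apply: (iF (fun e => e`_0 - c)).
    by apply: polyfunD; [apply: polyfun_var|apply: polyfun_cst].
  by move=> x Xx /=; rewrite Zc ?subrr //; apply/DiZ/XD.
have /eqP := cst (nseq (size F).+1 0) (size_nseq _ _).
have /eqP := cst (nseq (size F).+1 1) (size_nseq _ _).
rewrite /= !subr_eq0 => /eqP <-; rewrite eq_sym oner_eq0 //.
Qed.

Lemma indep_dim X d (F : seq (Gm K n -> K)) : irreducible X -> has_dim X d ->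
  (forall f, List.In f F -> lfun f) -> indep F X -> (size F <= d)%N.
Proof. by move=> irrX [_ maxd] lF iF; apply/maxd/indep_chain. Qed.

End IndependentChain.

(** * Characters *)

Section Characters.
Variables (K : closedFieldType) (n : nat).
Implicit Types (x y h : Gm K n) (a b u : 'rV[int]_n).

(** Dedekind's argument: the relation multiplied by the value of one
    character at [h0], minus the relation translated by [h0], is a shorter
    relation. *)
Lemma mono_independent (S : set (Gm K n)) (I : eqType) (r : seq I)
    (a : I -> 'rV[int]_n) (c : I -> K) :
  S 1%g -> (forall x y, S x -> S y -> S (x * y)%g) -> uniq r ->
  (forall i j, i \in r -> j \in r -> i != j ->
     exists2 h, S h & mono (a i) h != mono (a j) h) ->
  (forall h, S h -> \sum_(i <- r) c i * mono (a i) h = 0) ->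
  forall i, i \in r -> c i = 0.
Proof.
move=> S1 SM; elim: r c => // i0 r IHr c /= /andP[i0r ur] sep rel.
have cr i : i \in r -> c i = 0.
  move=> ir; have ii0 : i != i0 by apply: contraNneq i0r => <-.
  have [||h0 Sh0 neq] := sep i i0 _ _ ii0; rewrite ?inE ?ir ?eqxx ?orbT //.
  have /eqP : c i * (mono (a i) h0 - mono (a i0) h0) = 0.
    apply: (IHr (fun i => c i * (mono (a i) h0 - mono (a i0) h0))) ir => //.
      by move=> j k jr kr; apply: sep; rewrite inE ?jr ?kr orbT.
    move=> h Sh; have := rel (h * h0)%g (SM h h0 Sh Sh0).
    have := rel h Sh; rewrite !big_cons => /eqP; rewrite addr_eq0 => /eqP E1.
    rewrite monoM mulrA E1 mulNr => E2; rewrite -[RHS]E2 mulr_suml -sumrN.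
    rewrite -big_split; apply: eq_bigr => j _ /=; rewrite monoM; ring.
  by rewrite mulf_eq0 subr_eq0 (negPf neq) orbF => /eqP.
move=> i; rewrite inE => /predU1P[->|/cr //].
have := rel 1%g S1; rewrite big_cons mono1 mulr1 big_seq big1 ?addr0 // => j jr.
by rewrite cr ?mul0r.
Qed.

(** The two characters are compared on a coordinate axis, at a point whose
    power by the difference of exponents is not [1]. *)
Lemma mono_distinct a b : a != b -> exists h : Gm K n, mono a h != mono b h.
Proof.
move=> ab; have [i abi] : exists i, a 0 i != b 0 i.
  apply/existsP; apply: contraNT ab => /existsPn H; apply/eqP/rowP => i.
  by apply/eqP/negPn/H.
have [z] : exists z, ~~ root ('X * ('X ^+ absz (a 0 i - b 0 i)%R - 1) : {poly K}) z.
  apply/closed_nonrootP; rewrite mulf_neq0 ?polyX_eq0 // monic_neq0 //.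
  by rewrite monicXnsubC // absz_gt0 subr_eq0.
rewrite rootM negb_or !rootE !hornerE => /andP[z0].
rewrite subr_eq0 => zd.
exists [ffun j => if j == i then MulGroup z0 else 1%g].
have E k : mono k [ffun j => if j == i then MulGroup z0 else 1%g] = z ^ k 0 i.
  rewrite /mono (bigD1 i) //= ffunE eqxx /= big1 ?mulr1 // => j /negPf ji.
  by rewrite ffunE ji /= exp1rz.
rewrite !E; apply: contraNneq zd => zab.
have : z ^ (a 0 i - b 0 i) = 1.
  by rewrite expfzDr // zab -expfzDr // subrr expr0z.
case: (a 0 i - b 0 i) => k; rewrite ?NegzE => zk; first by rewrite exprnP zk.
by rewrite abszN absz_nat; apply/eqP/invr_inj; rewrite invr1 exprnN.
Qed.

Lemma lsum_eq0 (I : eqType) (r : seq I) (a : I -> 'rV[int]_n) (c : I -> K) :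
  uniq r -> {in r &, injective a} ->
  (forall h : Gm K n, \sum_(i <- r) c i * mono (a i) h = 0) ->
  forall i, i \in r -> c i = 0.
Proof.
move=> ur inj rel; apply: (@mono_independent setT _ _ a) => // i j ir jr ij.
have [h neq] : exists h : Gm K n, mono (a i) h != mono (a j) h.
  by apply: mono_distinct; apply: contraNneq ij => /(inj _ _ ir jr) ->.
by exists h.
Qed.

(** All homomorphisms from one torus to another are of this form. *)
Definition mon r (W : 'M[int]_(r, n)) x : Gm K r :=
  [ffun i => MulGroup (mono_neq0 (row i W) x)].

Lemma coord_mon r (W : 'M[int]_(r, n)) i x : coordf i (mon W x) = mono (row i W) x.
Proof. by rewrite /coordf ffunE. Qed.

Lemma mono_sum (I : Type) (s : seq I) (a : I -> 'rV[int]_n) x :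
  mono (\sum_(i <- s) a i) x = \prod_(i <- s) mono (a i) x.
Proof.
elim: s => [|i s IHs]; first by rewrite !big_nil mono0.
by rewrite !big_cons monoD IHs.
Qed.

Lemma mono_mon r (W : 'M[int]_(r, n)) (k : 'rV[int]_r) x :
  mono k (mon W x) = mono (k *m W) x.
Proof.
rewrite mulmx_sum_row mono_sum; apply: eq_bigr => i _.
by rewrite monoZ -/(coordf i _) coord_mon.
Qed.

Lemma monM r (W : 'M[int]_(r, n)) x y : mon W (x * y)%g = (mon W x * mon W y)%g.
Proof. by apply/ffunP => i; apply: val_inj; rewrite !ffunE /= monoM. Qed.

Lemma mon1 r (W : 'M[int]_(r, n)) : mon W 1%g = 1%g.
Proof. by apply/ffunP => i; apply: val_inj; rewrite !ffunE /= mono1. Qed.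

Lemma monX r (W : 'M[int]_(r, n)) x m : mon W (x ^+ m)%g = (mon W x ^+ m)%g.
Proof.
elim: m => [|m IHm]; first by rewrite !expg0 mon1.
by rewrite !expgS monM IHm.
Qed.

End Characters.

Lemma mon_comp (K : closedFieldType) n r s (V : 'M[int]_(s, r)) (W : 'M[int]_(r, n))
  (x : Gm K n) : mon V (mon W x) = mon (V *m W) x.
Proof.
by apply/ffunP => i; apply: val_inj; rewrite !ffunE /= mono_mon row_mul.
Qed.

Lemma mon_id (K : closedFieldType) n (x : Gm K n) : mon 1%:M x = x.
Proof.
apply/ffunP => i; apply: val_inj; rewrite !ffunE /= row1.
by rewrite -coordE.
Qed.

Lemma lfun_mon (K : closedFieldType) n r (W : 'M[int]_(r, n)) (f : Gm K r -> K) :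
  lfun f -> lfun (fun x => f (mon W x)).
Proof.
move=> [s fE]; exists [seq (p.1, p.2 *m W) | p <- s] => x.
by rewrite fE /lsum big_map; apply: eq_bigr => p _; rewrite mono_mon.
Qed.

(** * Growth of spaces of Laurent functions *)

Section Growth.
Variables (K : closedFieldType) (n : nat).
Implicit Types (x y h : Gm K n) (a b u : 'rV[int]_n) (f g : Gm K n -> K).

Definition lfun_le (B : nat) f := exists2 s : seq (K * 'rV[int]_n),
  (forall p, p \in s -> forall i, (`|p.2 0%R i| <= B)%N) & forall x, f x = lsum s x.

Lemma lfun_le_exists f : lfun f -> exists B, lfun_le B f.
Proof.
by move=> [s fE]; have [B sB] := exponent_bound s; exists B, s.
Qed.

Lemma lfun_leW B B' f : (B <= B')%N -> lfun_le B f -> lfun_le B' f.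
Proof.
move=> BB' [s sB fE]; exists s => // p ps i.
exact: leq_trans (sB p ps i) BB'.
Qed.

Lemma lfun_le1 : lfun_le 0 (fun=> 1).
Proof.
exists [:: (1, 0)] => [p|x]; last by rewrite /lsum big_seq1 mono0 mulr1.
by rewrite inE => /eqP -> i; rewrite mxE.
Qed.

Lemma absz_leD (a b : int) (A B : nat) : (`|a| <= A -> `|b| <= B -> `|(a + b)%R| <= A + B)%N.
Proof. lia. Qed.

Lemma lfun_leM B B' f g : lfun_le B f -> lfun_le B' g ->
  lfun_le (B + B') (fun x => f x * g x).
Proof.
move=> [s sB fE] [t tB gE].
exists [seq (p.1 * q.1, p.2 + q.2) | p <- s, q <- t] => [p|x].
  move=> /allpairsP[[p1 p2] /= [p1s p2t ->]] i /=; rewrite mxE.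
  by apply: absz_leD; [apply: sB|apply: tB].
rewrite fE gE /lsum big_allpairs_dep mulr_suml; apply: eq_bigr => p _.
by rewrite mulr_sumr; apply: eq_bigr => q _ /=; rewrite monoD mulrACA.
Qed.

Lemma lfun_leX B f m : lfun_le B f -> lfun_le (m * B) (fun x => f x ^+ m).
Proof.
move=> lf; elim: m => [|m IHm]; first exact: lfun_le1.
have -> : (fun x => f x ^+ m.+1) = (fun x => f x * f x ^+ m).
  by apply/funext => x; rewrite exprS.
by rewrite mulSn; apply: lfun_leM.
Qed.

Lemma lfun_le_prod m B (f : 'I_m -> Gm K n -> K) : (forall i, lfun_le B (f i)) ->
  lfun_le (m * B) (fun x => \prod_i f i x).
Proof.
elim: m f => [|m IHm] f lf.
  rewrite (_ : (fun x => _) = fun=> 1); first exact: lfun_le1.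
  by apply/funext => x; rewrite big_ord0.
rewrite (_ : (fun x => _) = fun x => f ord0 x * \prod_i f (lift ord0 i) x).
  by rewrite mulSn; apply: lfun_leM => //; apply: IHm.
by apply/funext => x; rewrite big_ord_recl.
Qed.

Lemma leq_wexp2r (a b e : nat) : (a <= b -> a ^ e <= b ^ e)%N.
Proof. by case: e => // e ab; rewrite leq_exp2r. Qed.

(** The spaces of Laurent functions of bounded degree on [Y] grow with exponent
    at most [s] when, up to a power [M], every coordinate is on [Y] a monomial
    in [s] fixed characters; polynomials in independent functions make them
    grow with exponent the number of these functions. *)
Lemma indep_growth s M (Y : set (Gm K n)) (W : 'M[int]_(s, n)) (L : 'M[int]_(n, s))
    (F : seq (Gm K n -> K)) :
  (0 < M)%N ->
  (forall i, exists c, forall y, Y y -> mono (row i (M%:Z%:M - L *m W)) y = c) ->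
  (forall f, List.In f F -> lfun f) -> indep F Y -> (size F <= s)%N.
Proof.
move=> M0 cst lF iF; rewrite leqNgt; apply/negP => sF.
set m := size F in sF.
have [B0 FB] : exists B, forall f, List.In f F -> lfun_le B f.
  elim: F lF {iF m sF} => [|f F IHF] lF; first by exists 0.
  have [B1 F1] := IHF (fun g gF => lF g (or_intror gF)).
  have [B2 F2] := lfun_le_exists (lF f (or_introl erefl)).
  exists (maxn B1 B2) => g [<-|/F1 lg]; first exact: lfun_leW (leq_maxr _ _) F2.
  exact: lfun_leW (leq_maxl _ _) lg.
pose Lmax := (\sum_i \sum_j `|L i j|)%N.
pose C1 := (n * Lmax * (m * B0))%N.
(* The space of functions of degree [B] has dimension at most [D ^ s.+1], and
   there are [D.+1 ^ m] monomials of degree at most [D] in each of the [m]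
   functions. *)
pose D := (M ^ n * (2 * C1 + 1) ^ s)%N.
have D0 : (0 < D)%N by rewrite muln_gt0 !expn_gt0 M0 addn1.
pose B := (m * (D * B0))%N.
pose B' := (n * Lmax * B)%N.
pose J : finType := ({ffun 'I_n -> 'I_M} * {ffun 'I_s -> 'I_(2 * B' + 1)})%type.
pose expo (j : J) : 'rV[int]_n := (\row_i (j.1 i : nat)%:Z) +
  (\row_i ((j.2 i : nat)%:Z - B'%:Z)) *m W.
have cstu u : exists c, forall y, Y y -> mono (u *m (M%:Z%:M - L *m W)) y = c.
  have [c cE] := choice cst; exists (\prod_i c i ^ u 0 i) => y Yy.
  rewrite mulmx_sum_row mono_sum; apply: eq_bigr => i _.
  by rewrite monoZ cE.
have span1 u : (forall i, (`|u 0%R i| <= B)%N) ->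
    exists c : J -> K, forall y, Y y -> mono u y = \sum_j c j * mono (expo j) y.
  move=> uB; pose w : 'rV[int]_n := \row_i divz (u 0 i) M.
  have M0' : M%:Z != 0 by rewrite eqz_nat -lt0n.
  have rlt i : (`|modz (u 0%R i) M| < M)%N.
    have := modz_ge0 (u 0 i) M0'; have := ltz_mod (u 0 i) M0'; lia.
  pose k : 'rV[int]_s := w *m L.
  have kb i : (`|k 0%R i| <= B')%N.
    rewrite mxE; apply: leq_trans (_ : \sum_j `|(w 0 j * L j i)%R| <= _)%N.
      elim/big_rec2: _ => [|j p q _ pq]; first by rewrite absz0.
      exact: absz_leD.
    rewrite /B' -mulnA; apply: leq_trans (_ : \sum_(j < n) Lmax * B <= _)%N.
      apply: leq_sum => j _; rewrite abszM mulnC; apply: leq_mul.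
        by rewrite /Lmax (bigD1 j) //= (bigD1 i) //= -addnA leq_addr.
      apply: leq_trans (uB j); rewrite mxE; move: M0.
      rewrite -ltz_nat; move: (u 0 j) => v.
      have := divz_eq v M; have := modz_ge0 v M0'; have := ltz_mod v M0'.
      move: (divz v M) (modz v M) => q r ? ? -> ?; nia.
    by rewrite sum_nat_const card_ord.
  have kB i : (`|(k 0 i + B'%:Z)%R| < 2 * B' + 1)%N.
    by move: (kb i); move: (k 0 i) => z; lia.
  pose j0 : J := ([ffun i => Ordinal (rlt i)], [ffun i => Ordinal (kB i)]).
  have [c cE] := cstu w.
  exists (fun j => if j == j0 then c else 0) => y Yy.
  rewrite (bigD1 j0) //= eqxx big1 ?addr0 => [|j /negPf ->]; last by rewrite mul0r.
  rewrite -(cE y Yy) -monoD; congr (mono _ y).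
  have -> : expo j0 = (\row_i modz (u 0 i) M) + k *m W.
    rewrite /expo; congr (_ + _ *m W); apply/rowP => i; rewrite !mxE ffunE /=.
      by have := modz_ge0 (u 0 i) M0'; lia.
    transitivity (k 0 i); last by rewrite /k mxE.
    by move: (kb i); move: (k 0 i) => z; lia.
  rewrite mulmxBr /k mulmxA addrCA subrK addrC mul_mx_scalar.
  by apply/rowP => i; rewrite !mxE mulrC -divz_eq.
have span f : lfun_le B f ->
    exists c : J -> K, forall y, Y y -> f y = \sum_j c j * mono (expo j) y.
  move=> [t tB fE].
  suff [c cE] : exists c : J -> K, forall y, Y y -> lsum t y = \sum_j c j * mono (expo j) y.
    by exists c => y Yy; rewrite fE cE.
  elim: t tB {fE} => [|p t IHt] tB.
    exists (fun=> 0) => y _; rewrite /lsum big_nil big1 // => j _.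
    by rewrite mul0r.
  have [c cE] := IHt (fun q qt => tB q (@mem_behead _ (p :: t) q qt)).
  have [c' c'E] := span1 p.2 (tB p (mem_head _ _)).
  exists (fun j => p.1 * c' j + c j) => y Yy.
  rewrite /lsum big_cons -/(lsum t y) cE // c'E // mulr_sumr -big_split /=.
  by apply: eq_bigr => j _; rewrite mulrDl mulrA.
pose I : finType := {ffun 'I_m -> 'I_D.+1}.
pose fi (l : 'I_m) := nth (fun=> 0) F l.
have fiE x (l : 'I_m) : (evals F x)`_l = fi l x.
  by rewrite /evals (nth_map (fun=> 0)).
have fiB l : lfun_le B0 (fi l).
  apply: FB; rewrite /fi; move: (ltn_ord l); rewrite /m.
  elim: (F) (nat_of_ord l) => //= f F' IHF' [|k] kF; first by left.
  by right; apply: IHF'.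
have powers (i : I) : exists c : J -> K,
    forall y, Y y -> \prod_l fi l y ^+ i l = \sum_j c j * mono (expo j) y.
  apply: span; apply: lfun_le_prod => l.
  apply: lfun_leW (lfun_leX (i l) (fiB l)).
  by rewrite leq_mul2r -ltnS ltn_ord orbT.
have [A AE] := choice powers.
have cardJI : (#|J| < #|I|)%N.
  rewrite card_prod !card_ffun !card_ord.
  have B'E : B' = (C1 * D)%N by rewrite /B' /B /C1; ring.
  apply: leq_ltn_trans (_ : D ^ s.+1 < _)%N; last first.
    apply: (@leq_trans (D.+1 ^ s.+1)); first by rewrite ltn_exp2r.
    by rewrite leq_pexp2l.
  rewrite expnS {1}/D -mulnA -expnMn leq_mul2l leq_wexp2r ?orbT //.
  by rewrite B'E; move: D0; nia.
pose MA : 'M[K]_(#|I|, #|J|) := \matrix_(p, q) A (enum_val p) (enum_val q).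
pose v := nz_row (kermx MA).
have v0 : v != 0.
  rewrite nz_row_eq0 kermx_eq0 /row_free neq_ltn.
  by rewrite (leq_ltn_trans (rank_leq_col MA)).
have vMA : v *m MA = 0 by apply/sub_kermxP/nz_row_sub.
pose p (e : seq K) := \sum_q v 0 q * \prod_(l < m) e`_l ^+ (enum_val q : I) l.
have pp : polyfun p.
  apply: polyfun_sum => q; apply: polyfunM; first exact: polyfun_cst.
  by apply: polyfun_prod => l; apply/polyfunX/polyfun_var.
have p0 : forall e, size e = m -> p e = 0.
  apply: iF => // y Yy.
  have pE q : \prod_(l < m) (evals F y)`_l ^+ (enum_val q : I) l =
      \sum_t MA q t * mono (expo (enum_val t)) y.
    under eq_bigr do rewrite fiE.
    rewrite AE // (reindex (fun t : 'I_#|J| => enum_val t)) /=.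
      by apply: eq_bigr => t _; rewrite mxE.
    by apply: onW_bij; apply: enum_val_bij.
  rewrite /p; under eq_bigr do rewrite pE mulr_sumr.
  rewrite exchange_big big1 // => t _; under eq_bigr do rewrite mulrA.
  have /matrixP/(_ 0 t) := vMA; rewrite !mxE => vt.
  by rewrite -mulr_suml vt mul0r.
case/eqP: v0; apply/rowP => q; rewrite mxE.
apply: (@lsum_eq0 K m _ (enum 'I_#|I|)
  (fun q => \row_l ((enum_val q : I) l : nat)%:Z) (v 0)).
- exact: enum_uniq.
- move=> q1 q2 _ _ /rowP q12; apply: enum_val_inj; apply/ffunP => l.
  by apply/val_inj; have := q12 l; rewrite !mxE => -[].
- move=> h; rewrite -[RHS](p0 (evals (coords K m) h)); last first.
    by rewrite size_evals size_coords.
  rewrite big_enum /=; apply: eq_bigr => t _; congr (_ * _).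
  by apply: eq_bigr => l _; rewrite nth_coords mxE.
- exact: mem_enum.
Qed.

End Growth.

(** * Lattices of characters *)

Section Lattices.
Variable n : nat.
Implicit Types (u v : 'rV[int]_n) (A B : set 'rV[int]_n).

Definition lattice A :=
  [/\ A 0, (forall u v, A u -> A v -> A (u + v)) & forall k u, A u -> A (k *: u)].

Definition saturated A := forall k u, k != 0 -> A (k *: u) -> A u.

Lemma lattice_mulmx A r (k : 'rV[int]_r) (W : 'M[int]_(r, n)) : lattice A ->
  (forall i, A (row i W)) -> A (k *m W).
Proof.
move=> [A0 AD AZ] AW; rewrite mulmx_sum_row.
by elim/big_ind: _ => // i _; apply: AZ.
Qed.

Lemma latticeB A u v : lattice A -> A u -> A v -> A (u - v).
Proof.
by move=> [A0 AD AZ] Au Av; apply: AD => //; rewrite -scaleN1r; apply: AZ.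
Qed.

(** Euclid's algorithm on the coefficients of a combination of the rows of a
    basis that lies in [A], until a single basis vector is left. *)
Lemma euclid_basis A (R : 'M[int]_n) (c : 'rV[int]_n) a :
  lattice A -> saturated A -> R \in unitmx -> c != 0 ->
  (forall i : 'I_n, (i < a)%N -> c 0 i = 0) -> A (c *m R) ->
  exists2 R' : 'M[int]_n, R' \in unitmx /\
    (forall i : 'I_n, (i < a)%N -> row i R' = row i R) &
    exists2 j : 'I_n, (a <= j)%N & A (row j R').
Proof.
move=> latA satA; have [N] := ubnP (\sum_i `|c 0%R i|)%N.
elim: N R c => // N IHN R c; rewrite ltnS => cN uR c0 ca AcR.
have [i ci] : exists i, c 0 i != 0.
  apply/existsP; apply: contraNT c0 => /existsPn H; apply/eqP/rowP => i.
  by rewrite mxE; apply/eqP/negPn/H.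
have big i' : c 0 i' != 0 -> (a <= i')%N.
  by move=> ci'; rewrite leqNgt; apply: contra ci' => /ca ->.
have [[j [ji cj]]|one] := pselect (exists j, j != i /\ c 0 j != 0); last first.
  exists R => //; exists i; first exact: big.
  apply: (satA (c 0 i)) => //; move: AcR.
  rewrite mulmx_sum_row (bigD1 i) //= big1 ?addr0 // => j ji.
  have [->|cj] := eqVneq (c 0 j) 0; first by rewrite scale0r.
  by case: one; exists j.
wlog leji : i j ci cj ji / (`|c 0%R j| <= `|c 0%R i|)%N => [hw|].
  have [/hw|/ltnW/hw] := leqP (`|c 0%R j|)%N (`|c 0%R i|)%N; apply=> //.
  by rewrite eq_sym.
pose e := sgz (c 0 i) * sgz (c 0 j).
pose U : 'M[int]_n := 1%:M + e *: delta_mx j i.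
pose V : 'M[int]_n := 1%:M - e *: delta_mx j i.
have VU : V *m U = 1%:M.
  rewrite /V /U mulmxDr mulmx1 mulmxBl mul1mx -scalemxAl -scalemxAr.
  rewrite mul_delta_mx_0; last by rewrite eq_sym.
  by rewrite !scaler0 subr0 subrK.
have [uV uU] := mulmx1_unit VU.
have cVE k : (c *m V) 0 k = c 0 k - (k == i)%:R * e * c 0 j.
  rewrite /V mulmxBr mulmx1 !mxE; congr (_ - _).
  rewrite (bigD1 j) //= big1 ?addr0 => [|l lj]; rewrite !mxE.
    by rewrite eqxx andTb mulrC; ring.
  by rewrite (negPf lj) /= mulr0 mulr0.
have [|||||R' [uR' rowR'] [l al Al]] := IHN (U *m R) (c *m V).
- apply: leq_trans cN; rewrite (bigD1 i) //= [X in (_ < X)%N](bigD1 i) //=.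
  rewrite -addSn; apply: leq_add; last first.
    by apply: leq_sum => k /negPf ki; rewrite cVE ki !mul0r subr0.
  rewrite cVE eqxx mul1r /e; move: ci cj leji.
  move: (c 0 i) (c 0 j) => x y x0 y0 xy.
  have [] : sgz x = 1 /\ 0 < x \/ sgz x = -1 /\ x < 0.
    by move: x0; case: sgzP => //; [left|right].
  have : sgz y = 1 /\ 0 < y \/ sgz y = -1 /\ y < 0.
    by move: y0; case: sgzP => //; [left|right].
  by case=> [[-> ?] [-> ?]|[-> ?] [-> ?]]; lia.
  have : sgz y = 1 /\ 0 < y \/ sgz y = -1 /\ y < 0.
    by move: y0; case: sgzP => //; [left|right].
  by case=> [[-> ?] [-> ?]|[-> ?] [-> ?]]; lia.
- by rewrite unitmx_mul uU.
- apply: contraNneq cj => /rowP/(_ j); rewrite cVE mxE (negPf ji) !mul0r subr0.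
  by move=> ->.
- move=> k ka; rewrite cVE ca //.
  have /negPf -> : k != i by apply: contraTneq ka => ->; rewrite -leqNgt big.
  by rewrite !mul0r subr0.
- by rewrite mulmxA -(mulmxA c) VU mulmx1.
exists R'; last by exists l.
split=> // k ka; rewrite rowR' // /U mulmxDl mul1mx -scalemxAl.
apply/rowP => l'; rewrite !mxE big1 ?mulr0 ?addr0 // => l'' _; rewrite !mxE.
have /negPf -> : k != j by apply: contraTneq ka => ->; rewrite -leqNgt big.
by rewrite mul0r.
Qed.

(** Take a basis with as many leading vectors in [A] as possible: a further
    combination in [A] would give, by [euclid_basis], one more such vector. *)
Lemma adapted_basis A : lattice A -> saturated A ->
  exists2 R : 'M[int]_n, R \in unitmx & exists2 a,
    (a <= n)%N /\ (forall i : 'I_n, (i < a)%N -> A (row i R)) &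
    forall c : 'rV[int]_n, (forall i : 'I_n, (i < a)%N -> c 0 i = 0) ->
      A (c *m R) -> c = 0.
Proof.
move=> latA satA.
pose P a := `[< (a <= n)%N /\ exists2 R : 'M[int]_n, R \in unitmx &
  forall i : 'I_n, (i < a)%N -> A (row i R) >].
have P0 : exists a, P a.
  by exists 0; apply/asboolP; split=> //; exists 1%:M; rewrite ?unitmx1.
have Pn a : P a -> (a <= n)%N by move=> /asboolP[].
case: (ex_maxnP P0 Pn) => a /asboolP[an [R uR AR]] amax.
exists R => //; exists a => // c ca AcR; apply/eqP/negPn/negP => c0.
have [R' [uR' rowR'] [j aj Aj]] := euclid_basis latA satA uR c0 ca AcR.
have an' : (a < n)%N by apply: leq_ltn_trans aj (ltn_ord j).
pose i0 := Ordinal an'.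
have : P a.+1.
  apply/asboolP; split=> //; exists (xrow i0 j R').
    by rewrite xrowE unitmx_mul unitmx_perm.
  move=> i; rewrite ltnS leq_eqVlt => /predU1P[ia|ia].
    have -> : i = i0 by apply: val_inj.
    have -> : row i0 (xrow i0 j R') = row j R'.
      by apply/rowP => k; rewrite !mxE tpermL.
    exact: Aj.
  have -> : row i (xrow i0 j R') = row i R'.
    apply/rowP => k; rewrite !mxE tpermD //; apply: contraTneq ia => <-.
      by rewrite ltnn.
    by rewrite -leqNgt.
  by rewrite rowR' //; apply: AR.
by move=> /amax; rewrite ltnn.
Qed.

Definition free_mod A r (W : 'M[int]_(r, n)) :=
  forall k : 'rV[int]_r, A (k *m W) -> k = 0.

(** By the Smith normal form a matrix with more rows than columns has a row
    relation. *)
Lemma free_mod_le A r (W : 'M[int]_(r, n)) : A 0 -> free_mod A W -> (r <= n)%N.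
Proof.
move=> A0 fW; rewrite leqNgt; apply/negP => nr.
have [U uU [V uV [d _ WE]]] := int_Smith_normal_form W.
(* The diagonal matrix has a zero row, because [n < r]. *)
pose k : 'rV[int]_r := row (Ordinal nr) (invmx U).
have : k = 0.
  apply: fW; rewrite /k -row_mul WE -!mulmxA mulKmx // row_mul.
  rewrite (_ : row _ _ = 0) ?mul0mx //; apply/rowP => j; rewrite !mxE /=.
  by rewrite gtn_eqF // mulr0n.
move/(congr1 (mulmx^~ U)); rewrite mul0mx /k -row_mul mulVmx // row1.
by move/rowP/(_ (Ordinal nr)); rewrite !mxE !eqxx.
Qed.

(** A free family of maximal size spans up to multiples: adding a vector
    makes it dependent, and in the new relation the coefficient of that
    vector is not zero. *)
Lemma max_free A B : lattice A -> lattice B ->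
  exists r, exists2 W : 'M[int]_(r, n),
    (forall i, B (row i W)) /\ free_mod A W &
    forall u, B u -> exists2 m : nat, (0 < m)%N &
      exists k : 'rV[int]_r, A (m%:Z *: u - k *m W).
Proof.
move=> latA latB; have [A0 AD AZ] := latA.
pose P r := `[< exists2 W : 'M[int]_(r, n), (forall i, B (row i W)) & free_mod A W >].
have P0 : exists r, P r.
  exists 0; apply/asboolP; exists 0 => [[]//|k _]; exact: thinmx0.
have Pn r : P r -> (r <= n)%N by move=> /asboolP[W _]; apply: free_mod_le.
case: (ex_maxnP P0 Pn) => r /asboolP[W BW fW] rmax.
exists r, W => // u Bu.
have : ~ free_mod A (col_mx u W).
  move=> fuW; have /rmax : P (1 + r)%N.
    apply/asboolP; exists (col_mx u W) => // i.
    case: (split_ordP i) => j ->; first by rewrite rowKu row_id.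
    by rewrite rowKd.
  by rewrite ltnn.
move=> /existsNP[k /not_implyP[Ak k0]].
move: Ak k0; rewrite -[k]hsubmxK mul_row_col [lsubmx k]mx11_scalar mul_scalar_mx.
set c := lsubmx k 0 0; set l := rsubmx k => Ak k0.
have c0 : c != 0.
  apply/eqP => c0; apply: k0; move: Ak; rewrite c0 scale0r add0r => /fW ->.
  by apply/rowP => i; rewrite mxE; case: splitP => j _; rewrite !mxE ?mul0rn.
exists `|c|%N; first by rewrite absz_gt0.
exists (- (sgz c *: l)); rewrite mulNmx opprK -scalemxAl.
have -> : (`|c|%N%:Z : int) = sgz c * c by rewrite -abszEsg.
by rewrite -scalerA -scalerDr; apply: AZ.
Qed.

End Lattices.

Lemma indep_growth_span (K : closedFieldType) n s (Y : set (Gm K n))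
    (W : 'M[int]_(s, n)) (F : seq (Gm K n -> K)) :
  (forall u, exists2 m : nat, (0 < m)%N & exists (k : 'rV[int]_s) c,
     forall y, Y y -> mono (m%:Z *: u - k *m W) y = c) ->
  (forall f, List.In f F -> lfun f) -> indep F Y -> (size F <= s)%N.
Proof.
move=> span; have /choice[m mP] i : exists m : nat, (0 < m)%N /\
    exists (k : 'rV[int]_s) c,
    forall y, Y y -> mono (m%:Z *: delta_mx 0 i - k *m W) y = c.
  by have [m m0 H] := span (delta_mx 0 i); exists m.
have /choice[k kP] i := (mP i).2.
pose M := (\prod_i m i)%N.
have M0 : (0 < M)%N by apply: prodn_gt0 => i; case: (mP i).
apply: (@indep_growth _ _ s M _ W (\matrix_i ((M %/ m i)%N%:Z *: k i))) => // i.
have [c cE] := kP i; exists (c ^ (M %/ m i)%N%:Z) => y Yy.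
rewrite -(cE y Yy) -monoZ; congr (mono _ y).
rewrite rowE mulmxBr mul_mx_scalar mulmxA -rowE rowK scalerBr -scalemxAl scalerA.
congr (_ *: _ - _); rewrite -PoszM; congr (Posz _).
by rewrite divnK // /M (bigD1 i) //= dvdn_mulr.
Qed.

(** * Counting *)

Section CardinalBounds.

(** Bounding duplicate-free lists expresses finiteness and the bound at the
    same time, with no prior proof of finiteness. *)
Definition card_le (T : eqType) (A : set T) (B : nat) :=
  forall s : seq T, uniq s -> (forall x, x \in s -> A x) -> (size s <= B)%N.

Lemma card_leS (T : eqType) (A A' : set T) B :
  A `<=` A' -> card_le A' B -> card_le A B.
Proof. by move=> AA' cA s us sA; apply: cA => // x /sA /AA'. Qed.

Lemma card_leW (T : eqType) (A : set T) B B' :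
  (B <= B')%N -> card_le A B -> card_le A B'.
Proof. by move=> BB' cA s us sA; apply: leq_trans BB'; apply: cA. Qed.

Lemma card_le_fibres (T U : eqType) (f : T -> U) (A : set T) (C : set U) B1 B2 :
  card_le C B1 -> (forall x, A x -> C (f x)) ->
  (forall u, card_le [set x | A x /\ f x = u] B2) -> card_le A (B1 * B2).
Proof.
move=> c1 AC c2 s us sA.
have -> : size s = (\sum_(u <- undup [seq f x | x <- s]) count (fun x => f x == u) s)%N.
  rewrite -sum1_size; under [RHS]eq_bigr => u _ do
    rewrite -(sum1_count s (fun x => f x == u)) big_mkcond.
  rewrite [RHS]exchange_big big_seq [RHS]big_seq; apply: eq_bigr => x xs.
  have fx : f x \in undup [seq f x | x <- s] by rewrite mem_undup map_f.
  rewrite (bigD1_seq (f x) fx (undup_uniq _)) /= eqxx big1 ?addn0 // => u.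
  by rewrite eq_sym => /negPf ->.
apply: (@leq_trans (\sum_(u <- undup [seq f x | x <- s]) B2)%N).
  apply: leq_sum => u _; rewrite -size_filter; apply: (c2 u).
    exact: filter_uniq.
  by move=> x; rewrite mem_filter => /andP[/eqP fx /sA].
rewrite big_const_seq count_predT iter_addn_0 mulnC leq_mul2r c1 ?undup_uniq ?orbT //.
by move=> u; rewrite mem_undup => /mapP[x xs ->]; apply/AC/sA.
Qed.

Lemma card_le_inj (T U : eqType) (f : T -> U) (A : set T) (C : set U) B :
  card_le C B -> (forall x, A x -> C (f x)) ->
  (forall x y, A x -> A y -> f x = f y -> x = y) -> card_le A B.
Proof.
move=> cC AC inj s us sA; rewrite -(size_map f); apply: cC.
  by rewrite map_inj_in_uniq // => x y /sA Ax /sA Ay; apply: inj.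
by move=> _ /mapP[x /sA Ax ->]; apply: AC.
Qed.

Lemma card_le_seq (T : eqType) (s : seq T) : card_le [set x | x \in s] (size s).
Proof. by move=> t ut ts; apply: uniq_leq_size. Qed.

Lemma card_le0 (T : eqType) (A : set T) : (forall x, ~ A x) -> card_le A 0.
Proof. by move=> A0 [|x s] // _ /(_ x (mem_head _ _)) /A0. Qed.

Lemma card_leU (T : eqType) (A A' : set T) B B' :
  card_le A B -> card_le A' B' -> card_le (A `|` A') (B + B').
Proof.
move=> cA cA' s us sAA'.
rewrite -(count_predC (fun x => `[< A x >])) -!size_filter; apply: leq_add.
  by apply: cA; rewrite ?filter_uniq // => x; rewrite mem_filter => /andP[/asboolP].
apply: cA'; rewrite ?filter_uniq // => x; rewrite mem_filter /= => /andP[/asboolP nA].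
by move=> /sAA'[].
Qed.

Lemma card_le_bigU (T : eqType) (I : eqType) (r : seq I) (A : set T)
    (C : I -> set T) (B : I -> nat) :
  (forall i, i \in r -> card_le (C i) (B i)) ->
  (forall x, A x -> exists2 i, i \in r & C i x) ->
  card_le A (\sum_(i <- r) B i).
Proof.
elim: r A => [|i r IHr] A cC AC.
  by rewrite big_nil; apply: card_le0 => x /AC[].
rewrite big_cons; pose A' := [set x | exists2 j, j \in r & C j x].
apply: (@card_leS _ _ (C i `|` A')).
  move=> x /AC[j]; rewrite inE => /predU1P[->|jr] Cx; first by left.
  by right; exists j.
apply: card_leU; first by apply: cC; rewrite mem_head.
by apply: IHr => // j jr; apply: cC; rewrite inE jr orbT.
Qed.

(** A duplicate-free list of maximal length in [A] exhausts [A]. *)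
Lemma card_le_finite (T : choiceType) (A : set T) B :
  card_le A B -> finite_set A /\ (#|` fset_set A| <= B)%N.
Proof.
move=> cA.
pose P k := `[< exists2 s : seq T, uniq s /\ size s = k & forall x, x \in s -> A x >].
have P0 : exists k, P k by exists 0; apply/asboolP; exists [::].
have PB k : P k -> (k <= B)%N by move=> /asboolP[s [us <-] sA]; apply: cA.
case: (ex_maxnP P0 PB) => k /asboolP[s [us sk] sA] kmax.
have As x : A x -> x \in s.
  move=> Ax; apply: contrapT => /negP xs; have /kmax : P k.+1.
    apply/asboolP; exists (x :: s); first by rewrite /= xs us sk.
    by move=> y; rewrite inE => /predU1P[->|/sA].
  by rewrite ltnn.
have finA : finite_set A.
  by apply/finite_seqP; exists s; apply/seteqP; split=> x /=; [apply: As|apply: sA].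
split=> //; apply: cA; first exact: fset_uniq.
by move=> x; rewrite in_fset_set // inE.
Qed.

End CardinalBounds.

Section TorsionCount.
Variables (K : closedFieldType) (n : nat).
Implicit Types (x y : Gm K n) (Y X : set (Gm K n)).

Lemma card_le_roots (P : {poly K}) D : P != 0 -> (size P <= D.+1)%N ->
  card_le [set z : mulgroup K | P.[val z] = 0] D.
Proof.
move=> P0 sP s us sP0; rewrite -(size_map val).
rewrite -ltnS; apply: leq_trans sP; apply: max_poly_roots => //.
  by apply/allP => _ /mapP[z /sP0 Pz ->]; apply/rootP.
by rewrite map_inj_uniq //; apply: val_inj.
Qed.

Lemma val_expg (z : mulgroup K) N : val (z ^+ N)%g = val z ^+ N.
Proof.
elim: N => [|N IHN]; first by rewrite expg0 expr0.
by rewrite expgS exprS -IHN.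
Qed.

Lemma ffun_expg x N i : ((x ^+ N)%g : Gm K n) i = (x i ^+ N)%g.
Proof.
elim: N => [|N IHN]; first by rewrite !expg0 ffunE.
by rewrite !expgS ffunE IHN.
Qed.

Lemma card_le_unity N : (0 < N)%N -> card_le [set z : mulgroup K | (z ^+ N)%g = 1%g] N.
Proof.
move=> N0; apply: card_leS (card_le_roots (P := 'X^N - 1) _ _) => [z /= zN| |].
- by rewrite !hornerE -val_expg zN /= subrr.
- by rewrite monic_neq0 // monicXnsubC.
- by rewrite size_XnsubC.
Qed.

Lemma evals_eq (S L : seq 'I_n) x y : {subset S <= L} ->
  [seq x i | i <- L] = [seq y i | i <- L] ->
  evals [seq @coordf K n i | i <- S] x = evals [seq @coordf K n i | i <- S] y.
Proof.
move=> SL xy; rewrite /evals -!map_comp; apply/eq_in_map => i /SL iL /=.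
have /eq_in_map/(_ i iL) : [seq x i | i <- L] = [seq y i | i <- L] by [].
by rewrite /coordf => ->.
Qed.

Lemma subseq_dep_bound (L : seq 'I_n) (D : seq 'I_n -> nat) :
  exists B, forall S, subseq S L -> (D S <= B)%N.
Proof.
exists (\sum_(m : (size L).-tuple bool) D (mask m L))%N => S /subseqP[m sm ->].
have sm' : size m == size L by apply/eqP.
by rewrite (bigD1 (Tuple sm')) //= leq_addr.
Qed.

(** Coordinates are added one at a time. Over a point where one of the
    relations does not degenerate the new coordinate takes boundedly many
    values; where all of them degenerate it takes up to [N] values, but
    there any [d - 1] of the other coordinates are dependent, and the base
    has fewer points by a factor [N]. *)
Lemma torsion_count_coords (L : seq 'I_n) d Y :
  (forall S, subseq S L -> size S = d ->
     ~ indep [seq @coordf K n i | i <- S] Y) ->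
  exists c, forall N, (0 < N)%N -> exists2 B, (N * B <= c * N ^ d)%N &
    card_le [set v | exists y, [/\ Y y, (y ^+ N)%g = 1%g & v = [seq y i | i <- L]]] B.
Proof.
elim: L d Y => [|i L IHL] [|d] Y dep.
- have Y0 y : ~ Y y.
    by move=> Yy; apply: (dep [::]) => //; apply: indep_nil; exists y.
  exists 0 => N _; exists 0; rewrite ?muln0 //.
  by apply: card_le0 => v [y [/Y0]].
- exists 1 => N N0; exists 1.
    by rewrite muln1 mul1n expnS leq_pmulr // expn_gt0 N0.
  by move=> [|u [|v s]] //= /andP[uv _] H; have [y [_ _ uE]] := H u (mem_head _ _);
    have [y' [_ _ vE]] := H v (mem_behead (s := u :: v :: s) (mem_head _ _));
    rewrite uE vE mem_head in uv.
- have Y0 y : ~ Y y.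
    by move=> Yy; apply: (dep [::]); rewrite ?sub0seq //; apply: indep_nil; exists y.
  exists 0 => N _; exists 0; rewrite ?muln0 //.
  by apply: card_le0 => v [y [/Y0]].
have rel S : exists pz : (seq K -> K) * K, [/\ polyfun pz.1,
    (subseq S L -> size S = d -> (forall y, Y y ->
       pz.1 (evals [seq @coordf K n i | i <- i :: S] y) = 0)) &
    (subseq S L -> size S = d ->
       exists2 e, size e = size S & pz.1 (pz.2 :: e) != 0)].
  have [[SL sS]|nS] := pselect (subseq S L /\ size S = d); last first.
    by exists (fun=> 0, 0); split=> [|SL sS|SL sS]; first exact: polyfun_cst;
      case: nS.
  have [p pp [pY [[|z e] //= [se] pe]]] : exists2 p, polyfun p &
      (forall y, Y y -> p (evals [seq @coordf K n i | i <- i :: S] y) = 0) /\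
      exists2 e, size e = size [seq @coordf K n i | i <- i :: S] & p e != 0.
    by apply/dependP/dep; rewrite /= ?eqxx ?SL ?sS.
  by exists (p, z); split=> // _ _; exists e; rewrite // se size_map.
have [pz pzP] := choice rel.
have /choice[D DP] S : exists D, forall e, exists2 P : {poly K},
    (size P <= D)%N & forall z, P.[z] = (pz S).1 (z :: e).
  by apply: polyfun_degree; case: (pzP S).
have [D0 D0P] := subseq_dep_bound L D.
(* The points at which every chosen relation, with its first variable fixed at
   a value where the relation does not vanish identically, degenerates. *)
pose Y' := [set y | Y y /\ forall S, subseq S L -> size S = d ->
  (pz S).1 ((pz S).2 :: evals [seq @coordf K n i | i <- S] y) = 0].
have [|c1 c1P] := IHL d.+1 Y.
  by move=> S SL; apply: dep; apply: subseq_trans SL (subseq_cons _ _).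
have [|c2 c2P] := IHL d Y'.
  move=> S SL sS iS; have [pp _ /(_ SL sS)[e se]] := pzP S.
  rewrite (iS (fun e => (pz S).1 ((pz S).2 :: e))) ?eqxx ?size_map //.
    exact: polyfun_cons.
  by move=> y [_]; apply.
exists (c1 * D0 + c2)%N => N N0.
have [B1 B1N card1] := c1P N N0; have [B2 B2N card2] := c2P N N0.
exists (B1 * D0 + B2 * N)%N.
  rewrite mulnDr mulnDl; apply: leq_add.
    by rewrite mulnA (mulnAC c1) leq_mul2r B1N orbT.
  by rewrite mulnA expnS mulnCA mulnC leq_mul2l B2N orbT.
pose good := [set y | Y y /\ ~ Y' y].
apply: (@card_leS _ _ (
  [set v | exists y, [/\ good y, (y ^+ N)%g = 1%g & v = [seq y i | i <- i :: L]]] `|`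
  [set v | exists y, [/\ Y' y, (y ^+ N)%g = 1%g & v = [seq y i | i <- i :: L]]])).
  move=> v [y [Yy yN vE]]; have [Y'y|nY'y] := pselect (Y' y); [right|left];
  by exists y.
apply: card_leU.
  apply: (card_le_fibres (f := behead) card1).
    by move=> v [y [[Yy _] yN ->]]; exists y.
  move=> u; have [[y0 [y0g y0N y0u]]|none] := pselect (exists y,
      [/\ good y, (y ^+ N)%g = 1%g & u = [seq y i | i <- L]]); last first.
    apply: (card_leW (leq0n _)); apply: card_le0 => v [[y [gy yN ->]] /= uE].
    by apply: none; exists y.
  have [S [SL [sS nz]]] : exists S, subseq S L /\ (size S = d /\
      (pz S).1 ((pz S).2 :: evals [seq @coordf K n i | i <- S] y0) != 0).
    apply: contrapT => nS; case: y0g => Yy0; apply; split=> // S SL sS.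
    by apply/eqP/negPn/negP => nz; apply: nS; exists S.
  have [P sP PE] := DP S (evals [seq @coordf K n i | i <- S] y0).
  apply: (card_leW (D0P S SL)).
  have P0 : P != 0 by apply: contraNneq nz => P0; rewrite -PE P0 horner0.
  apply: (card_le_inj (f := fun v : seq (mulgroup K) => head 1%g v)
    (card_le_roots P0 (leqW sP))).
    move=> v [[y [[Yy _] yN ->]] /= uE].
    rewrite PE -(@evals_eq S L y y0); last by rewrite uE.
      by have [_ H _] := pzP S; apply: (H SL sS y Yy).
    exact: mem_subseq.
  by move=> v w [[y [_ _ ->]] /= <-] [[y' [_ _ ->]] /= ->] ->.
apply: (card_le_fibres (f := behead) card2).
  by move=> v [y [Yy yN ->]]; exists y.
move=> u; apply: (card_le_inj (f := fun v : seq (mulgroup K) => head 1%g v)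
    (card_le_unity N0)).
  by move=> v [[y [_ yN ->]] _] /=; rewrite -ffun_expg yN ffunE.
by move=> v w [[y [_ _ ->]] /= <-] [[y' [_ _ ->]] /= ->] ->.
Qed.

(** With the function [g] that defines the closed subset, any [d]
    coordinates independent on the subset would give [d + 1] independent
    functions on [X]; so [torsion_count_coords] applies and a factor [N] is
    gained over [X] itself. *)
Lemma torsion_count_proper X d g : irreducible X -> has_dim X d -> lfun g ->
  (exists2 x, X x & g x != 0) ->
  exists c, forall N, (0 < N)%N -> exists2 B, (N * B <= c * N ^ d)%N &
    card_le [set y | [/\ X y, g y = 0 & (y ^+ N)%g = 1%g]] B.
Proof.
move=> irrX dimX lg gX.
have [|c cP] := @torsion_count_coords (enum 'I_n) d [set y | X y /\ g y = 0].
  move=> S _ sS iS.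
  have lS f : List.In f [seq @coordf K n i | i <- S] -> lfun f.
    elim: (S) => //= i S' IHS' [<-|/IHS' //]; exact: lfun_coord.
  have := @indep_dim _ _ X d (g :: [seq @coordf K n i | i <- S]) irrX dimX.
  rewrite /= size_map sS ltnn => H.
  suff : false by []; apply: H => [f [<-|/lS]//|].
  apply: (indep_cons lS lg _ _ _ gX iS); first by move=> y [].
    exact: irreducible_prime.
  by move=> y [].
exists c => N N0; have [B BN cB] := cP N N0; exists B => //.
apply: (card_le_inj (f := fun y : Gm K n => [seq y i | i <- enum 'I_n]) cB).
  by move=> y [Xy gy yN]; exists y.
move=> y y' _ _ /eq_in_map yy'; apply/ffunP => i; apply: yy'.
exact: mem_enum.
Qed.

End TorsionCount.

(** * Torsion points on short one-dimensional cosets *)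

Section ShortCosets.
Variable K : closedFieldType.

Definition has_order n (z : Gm K n) (N : nat) :=
  [/\ (0 < N)%N, (z ^+ N)%g = 1%g & forall m, (0 < m)%N -> (z ^+ m)%g = 1%g -> (N <= m)%N].

(** Frobenius is injective: were the order [q * p] divisible by the
    characteristic [p], the [q]-th power would already be trivial. *)
Lemma order_natf_neq0 n (z : Gm K n) N : has_order z N -> N%:R != 0 :> K.
Proof.
move=> [N0 zN minN]; apply/negP => N00.
have [p pK] := natf0_pchar N0 N00.
have p0 : (0 < p)%N by apply/prime_gt0/(pcharf_prime pK).
have /dvdnP[q NE] : (p %| N)%N by rewrite (dvdn_pcharf pK).
have q0 : (0 < q)%N by move: N0; rewrite NE muln_gt0 => /andP[].
suff zq : (z ^+ q)%g = 1%g.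
  have := minN q q0 zq; rewrite NE leqNgt -[X in (X < _)%N]muln1 ltn_pmul2l //.
  by rewrite prime_gt1 // (pcharf_prime pK).
apply/ffunP => i; rewrite ffun_expg [RHS]ffunE; apply: val_inj; rewrite val_expg /=.
have : val (z i) ^+ N = 1 by rewrite -val_expg -ffun_expg zN ffunE.
rewrite NE exprM -(pFrobenius_autE pK) -(pFrobenius_aut1 pK) => /eqP.
rewrite -subr_eq0 -pFrobenius_autB_comm; last exact: mulrC.
by rewrite pFrobenius_autE expf_eq0 p0 subr_eq0 pFrobenius_aut1 => /eqP.
Qed.

(** The order [N] is invertible in [K], so ['X^N - 1] is separable. *)
Lemma order_prim_root n (z : Gm K n) N : has_order z N ->
  exists x : K, N.-primitive_root x.
Proof.
move=> oz; have [N0 _ _] := oz; have N00 := order_natf_neq0 oz.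
have [r Dp] := closed_field_poly_normal ('X^N - 1 : {poly K}).
rewrite (monicP _) ?monicXnsubC // scale1r in Dp.
have rn1 : all N.-unity_root r by apply/allP => x; rewrite -root_prod_XsubC -Dp.
have sz_r : (N < (size r).+1)%N by rewrite -(size_prod_XsubC r id) -Dp size_XnsubC.
have [|x] := hasP (has_prim_root N0 rn1 _ sz_r); last by exists x.
by rewrite -separable_prod_XsubC -Dp separable_Xn_sub_1.
Qed.

Lemma prim_root_neq0 N (x : K) : N.-primitive_root x -> x != 0.
Proof.
move=> px; have N0 := prim_order_gt0 px; apply: contraTneq (oner_neq0 K) => x0.
by rewrite -(prim_expr_order px) x0 expr0n gtn_eqF // mulr0n eqxx.
Qed.

(** Dirichlet's box argument. Of the [N] vectors of residues of [k * a], two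
    fall into the same one of the [M ^ r < N] boxes of side [N / M]; their
    difference is short, with [M] about [N ^ (1 / r)]. *)
Lemma short_multiple r (a : 'I_r -> nat) N : (1 < N)%N -> (0 < r)%N ->
  exists k (b : 'I_r -> int), [/\ (0 < k < N)%N,
    forall i, exists l : int, b i = (k * a i)%N%:Z + l * N%:Z &
    forall i, (`|b i| ^ r <= 2 ^ r * N ^ r.-1)%N].
Proof.
move=> N1 r0.
have exM : exists M, (M ^ r < N)%N by exists 1; rewrite exp1n.
have bM M : (M ^ r < N)%N -> (M <= N)%N.
  move=> MN; apply: leq_trans (ltnW MN); case: (M) => // M'.
  by rewrite -[X in (X <= _)%N]expn1 leq_pexp2l.
(* The largest number of boxes per side for which the box principle applies. *)
case: (ex_maxnP exM bM) => M MN Mmax.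
have M0 : (0 < M)%N by apply: Mmax; rewrite exp1n.
have NM : (N <= M.+1 ^ r)%N.
  by rewrite leqNgt; apply/negP => /Mmax; rewrite ltnn.
have N0 : (0 < N)%N by apply: ltnW.
pose res (k : nat) i := ((k * a i) %% N)%N.
have resN k i : (res k i < N)%N by rewrite ltn_mod.
have box k i : (res k i * M %/ N < M)%N.
  by rewrite ltn_divLR // mulnC ltn_pmul2l.
pose f (k : 'I_N) : {ffun 'I_r -> 'I_M} := [ffun i => Ordinal (box k i)].
have /injectivePn[k1 [k2 k12 fk]] : ~~ injectiveb f.
  apply/negP => /injectiveP /leq_card; rewrite card_ffun !card_ord leqNgt.
  by rewrite MN.
wlog lt12 : k1 k2 k12 fk / (k1 < k2)%N.
  move=> hw; have [|lt21|/val_inj/eqP] := ltngtP k1 k2; first exact: hw.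
    by apply: (hw k2 k1) => //; rewrite eq_sym.
  by rewrite (negPf k12).
exists (k2 - k1)%N, (fun i => (res k2 i)%:Z - (res k1 i)%:Z); split.
- by rewrite subn_gt0 lt12 (leq_ltn_trans (leq_subr _ _)).
- move=> i; exists ((k1 * a i %/ N)%N%:Z - (k2 * a i %/ N)%N%:Z).
  have := divn_eq (k1 * a i) N; have := divn_eq (k2 * a i) N.
  rewrite -/(res k1 i) -/(res k2 i) mulnBl.
  have : (k1 * a i <= k2 * a i)%N by rewrite leq_mul2r ltnW ?orbT.
  move: (k1 * a i)%N (k2 * a i)%N => p q pq.
  move: (p %/ N)%N (q %/ N)%N (res k1 i) (res k2 i) => p' q' rp rq Eq Ep.
  by rewrite -subzn // Eq Ep !PoszD !PoszM; ring.
move=> i; set b := `|_|%N.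
have bMN : (b * M < N)%N.
  have /ffunP/(_ i) := fk; rewrite !ffunE => /(congr1 val) /= E.
  have := divn_eq (res k1 i * M) N; have := divn_eq (res k2 i * M) N.
  rewrite E; have := ltn_pmod (res k1 i * M) N0; have := ltn_pmod (res k2 i * M) N0.
  rewrite /b; move: (res k1 i) (res k2 i) => u v; nia.
have step : ((b * M.+1) ^ r <= (2 * N) ^ r)%N.
  by rewrite leq_exp2r //; move: bMN M0; nia.
have : (N * b ^ r <= N * (2 ^ r * N ^ r.-1))%N.
  rewrite mulnCA -expnS prednK // -expnMn; apply: leq_trans step.
  by rewrite expnMn mulnC leq_mul2l NM orbT.
by rewrite leq_pmul2l.
Qed.

(** The short vector of [short_multiple] is congruent to [k * a]. Its
    entries are divisible by [g = gcd (k, N)], and Bezout's identity inverts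
    [k / g]: so [z ^ g] is on the one-parameter subgroup in the direction
    [b], the short vector divided by [g], and [z] is on its translate by a
    [g]-torsion point. *)
Lemma short_coset r (z : Gm K r) N : (0 < r)%N -> has_order z N ->
  exists g (b : 'rV[int]_r) (t : Gm K 1) (w : Gm K r),
    [/\ (0 < g)%N, b != 0, forall i, ((g * `|b 0%R i|) ^ r <= 2 ^ r * N ^ r.-1)%N,
        (w ^+ g)%g = 1%g /\ z = (w * mon b^T t)%g &
        exists x : K, g.-primitive_root x].
Proof.
move=> r0 oz; have [N0 zN minN] := oz.
have [N1|N1] := leqP N 1.
  have z1 : z = 1%g by move: zN; have -> : N = 1 by [lia]; rewrite expg1.
  exists 1, (const_mx 1), 1%g, 1%g; split=> //.
  - apply/eqP => /rowP/(_ (Ordinal r0)); rewrite !mxE => /eqP.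
    by rewrite oner_eq0.
  - move=> i; rewrite mxE absz1 mul1n exp1n muln_gt0 !expn_gt0 N0 //.
  - by rewrite expg1 mon1 z1 mulg1.
  - by have := order_prim_root oz; have -> : N = 1 by [lia].
have [x px] := order_prim_root oz; have x0 := prim_root_neq0 px.
have /choice[a aE] i : exists k : nat, val (z i) = x ^+ k.
  have [|k ->] := prim_rootP px (x := val (z i)).
    by rewrite -val_expg -ffun_expg zN ffunE.
  by exists k.
have [k [b [/andP[k0 kN] bE bN]]] := short_multiple a N1 r0.
pose g := gcdn k N.
have g0 : (0 < g)%N by rewrite gcdn_gt0 k0.
have gk : (g %| k)%N := dvdn_gcdl k N. have gN : (g %| N)%N := dvdn_gcdr k N.
have xb i : x ^ b i = val (z i) ^+ k.
  have [l ->] := bE i.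
  rewrite expfzDr // [l * _]mulrC -exprz_exp -(exprnP x N) (prim_expr_order px) exp1rz.
  by rewrite mulr1 -exprnP aE -exprM mulnC.
have gb i : b i = g%:Z * (b i %/ g%:Z)%Z.
  rewrite mulrC divzK //; have [l ->] := bE i.
  by apply: rpredD; [rewrite PoszM dvdz_mulr|rewrite dvdz_mull].
pose c : 'rV[int]_r := \row_i (b i %/ g%:Z)%Z.
(* Bezout: [l * k] is congruent to [g] modulo [N]. *)
case: (egcdnP N k0) => l l' lE _; rewrite -/g in lE.
have xl0 : x ^+ l != 0 by rewrite expf_neq0.
pose t : Gm K 1 := [ffun=> MulGroup xl0].
have tE i : val (mon c^T t i) = (x ^+ l) ^ c 0 i.
  by rewrite ffunE /= /mono big_ord1 ffunE !mxE.
have xg i : val (mon c^T t i) ^+ g = val (z i) ^+ g.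
  have zN' : val (z i) ^+ N = 1 by rewrite -val_expg -ffun_expg zN ffunE.
  have -> : val (z i) ^+ g = val (z i) ^+ (l * k).
    by rewrite lE exprD mulnC exprM zN' expr1n mul1r.
  rewrite mulnC exprM -xb gb tE mxE !exprnP !exprz_exp; congr (x ^ _).
  by ring.
exists g, c, t, (z * (mon c^T t)^-1)%g; split=> //.
- apply/eqP => /rowP c0; suff zk : (z ^+ k)%g = 1%g.
    by have := minN k k0 zk; rewrite leqNgt kN.
  apply/ffunP => i; rewrite ffun_expg [RHS]ffunE; apply: val_inj.
  by rewrite val_expg -xb gb; have := c0 i; rewrite !mxE => ->; rewrite mulr0.
- by move=> i; rewrite mxE -[X in (X * _)%N]absz_nat -abszM -gb.
- split; last by rewrite -mulgA mulVg mulg1.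
  apply/ffunP => i; rewrite ffun_expg [RHS]ffunE; apply: val_inj.
  rewrite val_expg 2!ffunE /= exprMn exprVn xg mulfV //.
  by rewrite expf_neq0 // (valP (z i)).
- by exists (x ^+ (N %/ g)); apply: dvdn_prim_root.
Qed.

End ShortCosets.

(** * Zeros of a polynomial at torsion points of bounded order *)

Section ZerosOnCosets.
Variable K : closedFieldType.

Lemma card_le_coords (T : eqType) n (Y : set {ffun 'I_n -> T}) c (L : seq 'I_n) :
  (forall i, card_le [set u | exists2 y, Y y & u = y i] c) ->
  card_le [set v | exists2 y, Y y & v = [seq y i | i <- L]] (c ^ size L).
Proof.
move=> cY; elim: L => [|i L IHL].
  by move=> [|u [|v s]] //= /andP[uv _] H; have [y _ uE] := H u (mem_head _ _);
    have [y' _ vE] := H v (mem_behead (s := u :: v :: s) (mem_head _ _));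
    rewrite uE vE mem_head in uv.
rewrite /= expnS mulnC; apply: (card_le_fibres (f := behead) IHL).
  by move=> v [y Yy ->]; exists y.
move=> u s us sA.
have ex v : v \in s -> exists2 y, Y y & v = y i :: u.
  by move=> /sA[[y Yy ->] /= <-]; exists y.
case: s us sA ex => // v0 s us sA ex; have [y0 _ _] := ex v0 (mem_head _ _).
apply: (card_le_inj (f := fun v => head (y0 i) v) (cY i) _ _ us sA).
  by move=> v [[y Yy ->] _]; exists y.
by move=> v w [[y _ ->] /= <-] [[y' _ ->] /= ->] ->.
Qed.

Lemma card_le_ffun (T : eqType) n (Y : set {ffun 'I_n -> T}) c :
  (forall i, card_le [set u | exists2 y, Y y & u = y i] c) -> card_le Y (c ^ n).
Proof.
move=> cY; rewrite -{2}(size_enum_ord n).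
have cL := @card_le_coords T n Y c (enum 'I_n) cY.
apply: (card_le_inj (f := fun y : {ffun 'I_n -> T} => [seq y i | i <- enum 'I_n]) cL).
  by move=> y Yy; exists y.
move=> y y' _ _ /eq_in_map yy'; apply/ffunP => i; apply: yy'.
exact: mem_enum.
Qed.

Lemma card_le_torsion n g : (0 < g)%N ->
  card_le [set w : Gm K n | (w ^+ g)%g = 1%g] (g ^ n).
Proof.
move=> g0; apply: card_le_ffun => i.
apply: (@card_leS _ _ [set u : mulgroup K | (u ^+ g)%g = 1%g]); last exact: card_le_unity.
by move=> u [y yg ->] /=; rewrite -ffun_expg yg ffunE.
Qed.

Lemma Gm_expMn n (x y : Gm K n) m : ((x * y) ^+ m)%g = (x ^+ m * y ^+ m)%g.
Proof.
apply/ffunP => i; rewrite ffun_expg [RHS]ffunE !ffun_expg; apply: val_inj.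
by rewrite /= !val_expg ffunE /= exprMn.
Qed.

Variable r : nat.
Implicit Types (s : seq (K * 'rV[int]_r)) (b : 'rV[int]_r) (z w : Gm K r).

(** At such a zero the relation does not vanish identically along a
    one-parameter coset, unless all of its exponents pair equally with the
    direction. *)
Definition pure_zero s z := lsum s z = 0 /\
  forall P : pred 'rV[int]_r, has (fun p => P p.2) s -> has (fun p => ~~ P p.2) s ->
    lsum [seq p <- s | P p.2] z != 0.

Definition pairing (k b : 'rV[int]_r) : int := (k *m b^T) 0 0.

Lemma mono_line (k b : 'rV[int]_r) (t : Gm K 1) : mono k (mon b^T t) = val (t 0) ^ pairing k b.
Proof. by rewrite mono_mon /mono big_ord1 -[ord0]/(0 : 'I_1). Qed.

Lemma pairing_bound (k b : 'rV[int]_r) M B : (forall i, (`|k 0%R i| <= M)%N) ->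
  (forall i, (`|b 0%R i| <= B)%N) -> (`|pairing k b| <= r * (M * B))%N.
Proof.
move=> kM bB; rewrite /pairing mxE.
apply: leq_trans (_ : \sum_(j < r) M * B <= _)%N; last first.
  by rewrite sum_nat_const card_ord.
elim/big_rec2: _ => [|j p q _ pq]; first by rewrite absz0.
apply: absz_leD => //; rewrite abszM mxE.
exact: leq_mul.
Qed.

(** On a coset in the direction [b] the zeros are the roots of a polynomial of
    degree proportional to [b]; each point of the union of the cosets by
    [g]-torsion points has [g] parametrizations. *)
Lemma card_zeros_coset s b M B g : (0 < r)%N ->
  (forall p, p \in s -> forall i, (`|p.2 0%R i| <= M)%N) ->
  (forall i, (`|b 0%R i| <= B)%N) ->
  (exists p q, [/\ p \in s, q \in s & pairing p.2 b != pairing q.2 b]) ->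
  (0 < g)%N -> (exists x : K, g.-primitive_root x) ->
  card_le [set z | pure_zero s z /\ exists (t : Gm K 1) w,
    (w ^+ g)%g = 1%g /\ z = (w * mon b^T t)%g] (g ^ r.-1 * (2 * r * M * B)).
Proof.
move=> r0 sM bB [p0 [q0 [p0s q0s pq0]]] g0 [x px].
pose e := (r * (M * B))%N.
have se p : p \in s -> (`|pairing p.2 b| <= e)%N.
  by move=> ps; apply: pairing_bound => //; apply: sM.
pose pairs := [set wt : Gm K r * Gm K 1 | (wt.1 ^+ g)%g = 1%g /\
  pure_zero s (wt.1 * mon b^T wt.2)%g].
have cpairs : card_le pairs (g ^ r * (2 * e)).
  apply: (@card_le_fibres _ _ (fun wt : Gm K r * Gm K 1 => wt.1) _ _ _ _
    (@card_le_torsion r g g0)).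
    by move=> wt [].
  move=> w; pose P : {poly K} := \sum_(p <- s)
    (p.1 * mono p.2 w) *: 'X^(absz (pairing p.2 b + e%:Z)).
  have PE (t : Gm K 1) : P.[val (t 0)] = val (t 0) ^+ e * lsum s (w * mon b^T t)%g.
    rewrite /P horner_sum /lsum mulr_sumr big_seq [RHS]big_seq; apply: eq_bigr => p ps.
    rewrite hornerZ hornerXn monoM mono_line.
    have -> : val (t 0) ^+ absz (pairing p.2 b + e%:Z) =
        val (t 0) ^+ e * val (t 0) ^ pairing p.2 b.
      rewrite !exprnP -expfzDr; last exact: (valP (t 0)).
      by congr (_ ^ _); have := se p ps; move: (pairing p.2 b) => k; lia.
    by ring.
  have [[t [_ [_ good]]]|none] := pselect (exists t, pairs (w, t)); last first.
    apply: (card_leW (leq0n _)); apply: card_le0 => -[w' t] [wt /= w'w].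
    by apply: none; exists t; rewrite -w'w.
  have P0 : P != 0.
    pose k := pairing p0.2 b.
    have : lsum [seq p <- s | pairing p.2 b == k] (w * mon b^T t)%g != 0.
      apply: (good (fun a => pairing a b == k)); apply/hasP.
        by exists p0.
      by exists q0; rewrite // eq_sym.
    apply: contraNneq => /polyP/(_ (absz (k + e%:Z))); rewrite coef0 coef_sum => P0.
    apply/eqP; transitivity (val (t 0) ^ k *
        \sum_(p <- s | pairing p.2 b == k) p.1 * mono p.2 w).
      rewrite /lsum big_filter mulr_sumr; apply: eq_bigr => p /eqP pk.
      by rewrite monoM mono_line pk; ring.
    suff -> : \sum_(p <- s | pairing p.2 b == k) p.1 * mono p.2 w = 0.
      by rewrite mulr0.
    rewrite -[RHS]P0 big_mkcond /= big_seq [RHS]big_seq; apply: eq_bigr => p ps.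
    rewrite coefZ coefXn; have := se p ps; have := se p0 p0s; rewrite -/k.
    have [->|neq] := eqVneq (pairing p.2 b) k; first by rewrite eqxx mulr1.
    move=> kle ple; rewrite (_ : (_ == _) = false) ?mulr0 //.
    by apply/negbTE; move: neq kle ple; move: (pairing p.2 b) => a; lia.
  have sP : (size P <= (2 * e).+1)%N.
    apply: leq_trans (size_sum _ _ _) _; apply/bigmax_leqP_seq => p ps _.
    apply: leq_trans (size_scale_leq _ _) _; rewrite size_polyXn ltnS.
    by have := se p ps; move: (pairing p.2 b) => a; lia.
  apply: (card_le_inj (f := fun wt : Gm K r * Gm K 1 => wt.2 0) (card_le_roots P0 sP)).
    by move=> [w' t'] [[_ [z0 _]] /= w'w]; rewrite PE -w'w z0 mulr0.
  move=> [w1 t1] [w2 t2] [_ /= ->] [_ /= ->] t12; congr (_, _).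
  by apply/ffunP => i; rewrite (ord1 i).
pose u (i : 'I_g) : Gm K 1 := [ffun=> MulGroup (expf_neq0 i (prim_root_neq0 px))].
have uinj : injective u.
  move=> i j /ffunP/(_ 0); rewrite !ffunE => /(congr1 val) /= /eqP.
  by rewrite (eq_prim_root_expr px) !modn_small // => /eqP/val_inj.
have ug i : (u i ^+ g)%g = 1%g.
  apply/ffunP => j; rewrite ffun_expg [RHS]ffunE; apply: val_inj.
  by rewrite val_expg ffunE /= -exprM mulnC exprM (prim_expr_order px) expr1n.
move=> l ul lA.
have /choice[wt wtP] z : exists wt : Gm K r * Gm K 1, z \in l ->
    [/\ (wt.1 ^+ g)%g = 1%g, z = (wt.1 * mon b^T wt.2)%g & pure_zero s z].
  have [zl|nz] := boolP (z \in l); last by exists (1%g, 1%g).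
  by have [pz [t [w [wg zE]]]] := lA z zl; exists (w, t).
(* Moving a [g]-th root of unity between the two factors parametrizes the same
   point; this gives [g] distinct pairs for each zero. *)
pose h (zi : Gm K r * 'I_g) := (((wt zi.1).1 * mon b^T (u zi.2))%g,
  ((u zi.2)^-1 * (wt zi.1).2)%g).
have hE z i : z \in l -> ((h (z, i)).1 * mon b^T (h (z, i)).2)%g = z.
  move=> zl; have [_ zE _] := wtP z zl.
  by rewrite /h /= -mulgA -monM mulgA mulgV mul1g -zE.
have uq : uniq [seq (z, i) | z <- l, i <- enum 'I_g].
  by apply: allpairs_uniq => //; [exact: enum_uniq|move=> [? ?] [? ?] _ _ [-> ->]].
have gE : (g ^ r * (2 * e) = g * (g ^ r.-1 * (2 * r * M * B)))%N.
  by rewrite -{1}(prednK r0) expnS /e; ring.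
rewrite gE in cpairs.
have H : (size l * g <= g * (g ^ r.-1 * (2 * r * M * B)))%N.
  have := cpairs [seq h zi | zi <- [seq (z, i) | z <- l, i <- enum 'I_g]] _ _.
  rewrite size_map size_allpairs size_enum_ord => H.
  apply: H.
    rewrite map_inj_in_uniq //.
    move=> _ _ /allpairsP[[z1 i1] [/= z1l _ ->]] /allpairsP[[z2 i2] [/= z2l _ ->]] h12.
    have z12 : z1 = z2 by rewrite -(hE z1 i1 z1l) h12 hE.
    move: h12; rewrite z12 /h /= => -[_ /mulIg/invg_inj/uinj ->] //.
  move=> _ /mapP[_ /allpairsP[[z i] [/= zl _ ->]] ->].
  have [wg zE pz] := wtP z zl; split; last by rewrite hE.
  by rewrite /h /= Gm_expMn wg mul1g -monX ug mon1.
by move: H; rewrite mulnC leq_pmul2l.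
Qed.

(** Bounding the inverse squares by differences of consecutive inverses
    makes the sum telescope, to [2 - 1 / G]; the induction is on that
    sharper bound. *)
Lemma sum_inv_square (a : nat -> nat) X G :
  (forall g, (0 < g)%N -> (a g * g ^ 2 <= X)%N) ->
  (\sum_(1 <= g < G.+1) a g <= 2 * X)%N.
Proof.
move=> aX; case: G => [|G]; first by rewrite big_geq.
suff H : (G.+1 * \sum_(1 <= g < G.+2) a g <= (2 * G + 1) * X)%N.
  rewrite -(leq_pmul2l (ltn0Sn G)); apply: leq_trans H _.
  by rewrite mulnA leq_mul2r; apply/orP; right; lia.
elim: G => [|G IHG].
  by rewrite big_nat1; have := aX 1%N isT; rewrite exp1n; lia.
rewrite big_nat_recr //=; have := aX G.+2 isT; move: IHG.
set S := (\sum_(_ <= _ < _) _)%N; move: (a G.+2) => A H1 H2.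
rewrite -(leq_pmul2l (ltn0Sn G)).
have H3 : (G.+2 * (G.+1 * S) <= G.+2 * ((2 * G + 1) * X))%N by rewrite leq_mul2l H1 orbT.
have H4 : (G.+1 * (G.+2 * A) <= X)%N by apply: leq_trans H2; nia.
by nia.
Qed.

(** Sum over the directions [b] and the torsion orders [g] with
    [g * |b| <= Q]. The weight [g ^ (r - 1)] of the torsion points leaves the
    convergent series of inverse squares. *)
Lemma card_pure_zeros s : (0 < r)%N ->
  (forall b, b != 0 -> exists p q, [/\ p \in s, q \in s & pairing p.2 b != pairing q.2 b]) ->
  exists C, forall T Q, (forall q, (q ^ r <= 2 ^ r * T ^ r.-1)%N -> (q <= Q)%N) ->
    card_le [set z | pure_zero s z /\ exists2 N, has_order z N & (N <= T)%N]
      (C * Q ^ r.+1).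
Proof.
move=> r0 sep; have [M sM] := exponent_bound s.
exists (2 * (3 ^ r * (2 * r * M)))%N => T Q Qmax.
pose dirs g := [set b : 'rV[int]_r | b != 0 /\ forall i, (`|b 0%R i| <= Q %/ g)%N].
pose cosets g b := [set z | pure_zero s z /\ exists (t : Gm K 1) w,
    (w ^+ g)%g = 1%g /\ z = (w * mon b^T t)%g].
pose c g := ((2 * (Q %/ g) + 1) ^ r * (g ^ r.-1 * (2 * r * M * (Q %/ g))))%N.
have cg g : (0 < g)%N -> (exists x : K, g.-primitive_root x) ->
    card_le [set z | exists2 b, dirs g b & cosets g b z] (c g).
  move=> g0 prg; set q := (Q %/ g)%N.
  pose box (f : {ffun 'I_r -> 'I_(2 * q + 1)}) : 'rV[int]_r :=
    \row_i ((f i : nat)%:Z - q%:Z).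
  have -> : c g = (\sum_(f <- [seq f <- enum {ffun 'I_r -> 'I_(2 * q + 1)}|true])
      (g ^ r.-1 * (2 * r * M * q)))%N.
    rewrite filter_predT big_const_seq count_predT iter_addn_0 -cardT card_ffun !card_ord.
    by rewrite mulnC.
  apply: (@card_le_bigU _ _ _ _ (fun f => [set z | dirs g (box f) /\ cosets g (box f) z])).
    move=> f _; have [[b0 bq]|nb] := pselect (dirs g (box f)); last first.
      by apply: (card_leW (leq0n _)); apply: card_le0 => z [].
    apply: (@card_leS _ _ (cosets g (box f))); first by move=> z [].
    by apply: card_zeros_coset => //; apply: sep.
  move=> z [b [b0 bq] zb].
  have blt i : (`|(b 0 i + q%:Z)%R| < 2 * q + 1)%N.
    by have := bq i; rewrite -/q; move: (b 0 i) => k; lia.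
  exists [ffun i => Ordinal (blt i)]; first by rewrite filter_predT mem_enum.
  rewrite (_ : box _ = b) //; apply/rowP => i; rewrite mxE ffunE /=.
  by have := bq i; rewrite -/q; move: (b 0 i) => k; lia.
pose c' g := if `[< exists x : K, g.-primitive_root x >] then c g else 0%N.
apply: (@card_leW _ _ (\sum_(1 <= g < Q.+1) c' g)%N).
  rewrite -mulnA; apply: sum_inv_square => g g0.
  apply: (@leq_trans (c g * g ^ 2)%N).
    by rewrite leq_mul2r /c'; case: asboolP => _; rewrite ?leqnn ?orbT.
  rewrite /c; set q := (Q %/ g)%N.
  have [->|q0] := posnP q; first by rewrite !muln0.
  have qgQ : (q * g <= Q)%N by apply: leq_divM.
  apply: (@leq_trans ((3 * q) ^ r * (g ^ r.-1 * (2 * r * M * q)) * g ^ 2)%N).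
    by rewrite leq_mul2r leq_mul2r leq_wexp2r ?orbT //; lia.
  rewrite expnMn.
  rewrite (_ : (_ * _ = 3 ^ r * (2 * r * M) * (q ^ r.+1 * (g ^ r.-1 * g ^ 2)))%N); last first.
    by rewrite (expnS q r); ring.
  rewrite leq_mul2l -expnD addn2 prednK // -expnMn leq_wexp2r ?orbT //.
rewrite /index_iota subn1 /=.
apply: (@card_le_bigU _ _ _ _ (fun g => [set z |
   (exists x : K, g.-primitive_root x) /\ exists2 b, dirs g b & cosets g b z])).
  move=> g; rewrite mem_iota => /andP[g0 _]; rewrite /c'; case: asboolP => prg.
    by apply: (card_leS _ (cg g g0 prg)) => z [].
  by apply: card_le0 => z [].
move=> z [pz [N oz NT]]; have [g [b [t [w [g0 b0 gb [wg zE] prg]]]]] := short_coset r0 oz.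
have gbQ i : (g * `|b 0%R i| <= Q)%N.
  apply: Qmax; apply: leq_trans (gb i) _; rewrite leq_mul2l leq_wexp2r ?orbT //.
exists g; last first.
  split=> //; exists b; last by split=> //; exists t, w.
  by split=> // i; rewrite leq_divRL // mulnC.
rewrite mem_iota g0 add1n ltnS /=.
have [i bi] : exists i, b 0 i != 0.
  apply/existsP; apply: contraNT b0 => /existsPn H; apply/eqP/rowP => i.
  by rewrite mxE; apply/eqP/negPn/H.
by apply: leq_trans (gbQ i); rewrite leq_pmulr // absz_gt0.
Qed.

End ZerosOnCosets.

(** * Characters constant on an irreducible set *)

Section ConstantCharacters.
Variables (K : closedFieldType) (n : nat).
Implicit Types (X Y Z : set (Gm K n)) (x y h : Gm K n) (u : 'rV[int]_n).

Lemma prime_setT : prime_set [set: Gm K n].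
Proof.
move=> f g lf lg fg; apply: contrapT => /not_orP[].
move=> /existsNP[x /not_implyP[_ /eqP fx]] /existsNP[y /not_implyP[_ /eqP gy]].
have [M [p pp pE]] := lfun_clear lf; have [N [q pq qE]] := lfun_clear lg.
pose P (v : seq K) := \prod_(i < n) v`_i.
have pP : polyfun P by apply: polyfun_prod => i; apply: polyfun_var.
have PE z : P (evals (coords K n) z) = \prod_i coordf i z.
  by apply: eq_bigr => i _; rewrite nth_coords.
have sz z : size (evals (coords K n) z) = n by rewrite size_evals size_coords.
have px : p (evals (coords K n) x) * P (evals (coords K n) x) != 0.
  by rewrite pE PE !mulf_neq0 ?expf_neq0 ?prod_coord_neq0.
have qy : q (evals (coords K n) y) != 0.
  by rewrite qE !mulf_neq0 ?expf_neq0 ?prod_coord_neq0.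
have [w sw] := polyfun_domain (polyfunM pp pP) pq (sz x) (sz y) px qy.
rewrite mulf_eq0 negb_or => /andP[/andP[pw Pw] qw].
have [z zE] := coords_surj sw Pw.
move: pw qw; rewrite -zE pE qE !mulf_eq0 !negb_or => /andP[_ fz] /andP[_ gz].
by have /eqP := fg z I; rewrite mulf_eq0 (negPf fz) (negPf gz).
Qed.

(** Split [P] into linear factors: the product of the functions [f - z]
    vanishes on [X], so one of them does. *)
Lemma prime_const X f (P : {poly K}) : prime_set X -> X !=set0 -> lfun f ->
  P != 0 -> (forall x, X x -> P.[f x] = 0) -> exists c, forall x, X x -> f x = c.
Proof.
move=> pX [x0 Xx0] lf P0 PX; have [rs PE] := closed_field_poly_normal P.
have {PX} : forall x, X x -> \prod_(z <- rs) (f x - z) = 0.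
  move=> x /PX; rewrite PE hornerZ horner_prod => /eqP.
  rewrite mulf_eq0 lead_coef_eq0 (negPf P0) => /eqP fx.
  by rewrite -[RHS]fx; apply: eq_bigr => z _; rewrite !hornerE.
elim: rs {PE} => [|z rs IHrs] Pf.
  by have /eqP := Pf x0 Xx0; rewrite big_nil oner_eq0.
have [|||Xz|] := pX (fun x => f x - z) (fun x => \prod_(z <- rs) (f x - z)).
- exact: lfunB lf (lfun_cst _ _).
- elim: (rs) => [|z' rs' IH].
    by apply: lfun_ext (lfun_cst n 1) => x; rewrite big_nil.
  apply: lfun_ext (lfunM (lfunB lf (lfun_cst n z')) IH) => x.
  by rewrite big_cons.
- by move=> x Xx; have := Pf x Xx; rewrite big_cons.
- by exists z => x /Xz /eqP; rewrite subr_eq0 => /eqP.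
- exact: IHrs.
Qed.

Definition const_lattice X : set 'rV[int]_n :=
  [set u | exists c, forall x, X x -> mono u x = c].

Lemma const_latticeP X : lattice (const_lattice X).
Proof.
split=> [|u v [c uc] [e ve]|k u [c uc]].
- by exists 1 => x _; rewrite mono0.
- by exists (c * e) => x Xx; rewrite monoD uc ?ve.
- by exists (c ^ k) => x Xx; rewrite monoZ uc.
Qed.

(** If a power of a character is constant, the character takes values among
    the roots of a polynomial, and is constant by [prime_const]. *)
Lemma const_lattice_saturated X : irreducible X -> saturated (const_lattice X).
Proof.
move=> irrX; have [_ X0 _] := irrX; have pX := irreducible_prime irrX.
have nat_sat m u : (0 < m)%N -> const_lattice X (m%:Z *: u) -> const_lattice X u.
  move=> m0 [c uc]; apply: (@prime_const X (mono u) ('X^m - c%:P) pX X0).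
    exact: lfun_mono.
    by rewrite monic_neq0 // monicXnsubC.
  by move=> x Xx; rewrite !hornerE exprnP -monoZ uc // subrr.
move=> [m|m] u m0; first by apply: nat_sat; rewrite lt0n.
rewrite NegzE scaleNr -scalerN => /nat_sat -/(_ isT).
have [_ _ AZ] := const_latticeP X.
by move=> /(AZ (-1)); rewrite scaleN1r opprK.
Qed.

Definition kernel_coset (A : set 'rV[int]_n) (z : Gm K n) : set (Gm K n) :=
  [set x | forall u, A u -> mono u x = mono u z].

(** In coordinates adapted to the lattice the coset is cut out by fixing some
    coordinates, so it is the image of a torus. *)
Lemma kernel_coset_prime A z : lattice A -> saturated A -> prime_set (kernel_coset A z).
Proof.
move=> latA satA; have [R uR [a [an AR] freeR]] := adapted_basis latA satA.
(* The coordinates in the basis [R] are constrained for indices below [a] and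
   free beyond. *)
pose fix_ (y : Gm K n) : Gm K n := [ffun i : 'I_n => if (i < a)%N then mon R z i else y i].
have RK x : mon (invmx R) (mon R x) = x by rewrite mon_comp mulVmx // mon_id.
have KR x : mon R (mon (invmx R) x) = x by rewrite mon_comp mulmxV // mon_id.
have in_coset y : kernel_coset A z (mon (invmx R) (fix_ y)).
  move=> u Au; pose c := u *m invmx R.
  have uE : u = c *m R by rewrite mulmxKV.
  have c0 (i : 'I_n) : (a <= i)%N -> c 0 i = 0.
    move=> ai; pose c' : 'rV[int]_n := \row_i (if (i < a)%N then c 0 i else 0).
    have Ac' : A (c' *m R).
      have [A0 AD AZ] := latA.
      rewrite mulmx_sum_row; elim/big_ind: _ => // j _; rewrite mxE.
      by case: ifP => [ja|_]; [apply/AZ/AR|rewrite scale0r].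
    have cc' : c - c' = 0.
      apply: freeR => [j ja|]; first by rewrite !mxE ja subrr.
      by rewrite mulmxBl -uE; apply: latticeB.
    by move/rowP/(_ i): cc'; rewrite !mxE ltnNge ai /= subr0.
  rewrite uE -[LHS]mono_mon -[RHS]mono_mon KR; apply: eq_bigr => i _; rewrite ffunE.
  by case: ltnP => // /c0 ->; rewrite !expr0z.
have onto x : kernel_coset A z x -> mon (invmx R) (fix_ (mon R x)) = x.
  move=> xz; rewrite -[RHS]RK; congr mon; apply/ffunP => i; rewrite ffunE.
  case: ifP => // ia; apply: val_inj; rewrite -!/(coordf i _) !coord_mon.
  by rewrite xz //; apply: AR.
have lfix f : lfun f -> lfun (fun y => f (fix_ y)).
  move=> [s fE]; apply: (@lfun_ext _ _ _ (fun y => \sum_(p <- s) p.1 * mono p.2 (fix_ y))).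
    by move=> y; rewrite fE.
  apply: lfun_sum => p; apply: lfunM; first exact: lfun_cst.
  pose k : 'rV[int]_n := \row_i (if (i < a)%N then 0 else p.2 0 i).
  apply: (@lfun_ext _ _ _ (fun y =>
    (\prod_(i < n | (i < a)%N) coordf i (mon R z) ^ p.2 0 i) * mono k y)); last first.
    by apply: lfunM; [apply: lfun_cst|apply: lfun_mono].
  move=> y; rewrite /mono [X in X * _]big_mkcond -big_split; apply: eq_bigr => i _ /=.
  by rewrite ffunE mxE; case: ifP => _; rewrite ?expr0z ?mulr1 ?mul1r.
move=> f g lf lg fg.
have [|||f0|g0] := @prime_setT (fun y => f (mon (invmx R) (fix_ y)))
    (fun y => g (mon (invmx R) (fix_ y))).
- exact: (lfix (fun y => f (mon (invmx R) y))) (lfun_mon _ lf).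
- exact: (lfix (fun y => g (mon (invmx R) y))) (lfun_mon _ lg).
- by move=> y _; apply/fg/in_coset.
- by left=> x /onto <-; apply: f0.
- by right=> x /onto <-; apply: g0.
Qed.

Lemma sub_kernel_coset X z : X z -> X `<=` kernel_coset (const_lattice X) z.
Proof. by move=> Xz x Xx u [c uc]; rewrite !uc. Qed.

Lemma algebraic_translate X g : algebraic X -> algebraic (translate g X).
Proof.
move=> [s ->].
have lf (f : laurent K n) : lfun (fun x => leval f (g^-1 * x)%g).
  have [t tE] := lfun_leval f; exists [seq (p.1 * mono p.2 g^-1%g, p.2) | p <- t] => x.
  rewrite tE /lsum big_map; apply: eq_bigr => p _.
  by rewrite monoM mulrA.
have [|t tE] := @algebraic_zero K n [seq (fun x => leval f (g^-1 * x)%g) | f <- s].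
  by elim: (s) => //= f s' IHs' h [<-|/IHs'].
exists t; rewrite -tE; apply/seteqP; split=> [_ [x Xx <-] h|x Hx].
  elim: s Xx {t tE} => //= f s IHs Xx [<-|].
    by rewrite mulgA mulVg mul1g Xx // mem_head.
  by apply: IHs => k ks; apply: Xx; rewrite inE ks orbT.
exists (g^-1 * x)%g; last by rewrite mulgA mulgV mul1g.
elim: s Hx {t tE} => //= f s IHs Hx k; rewrite inE => /predU1P[->|].
  by apply: (Hx (fun x => leval f (g^-1 * x)%g)); left.
by apply: IHs => h hs; apply: Hx; right.
Qed.

Lemma translateK X g : translate g (translate g^-1%g X) = X.
Proof.
apply/seteqP; split=> [_ [_ [x Xx <-] <-]|x Xx]; first by rewrite mulgA mulgV mul1g.
by exists (g^-1 * x)%g; [exists x|rewrite mulgA mulgV mul1g].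
Qed.

Lemma irreducible_translate X g : irreducible X -> irreducible (translate g X).
Proof.
move=> [algX [x Xx] irrX]; split; first exact: algebraic_translate.
  by exists (g * x)%g, x.
have back A : translate g X `<=` A <-> X `<=` translate g^-1%g A.
  split=> H y.
    by move=> Xy; exists (g * y)%g; [apply: H; exists y|rewrite mulgA mulVg mul1g].
  by move=> [w /H [v Av <-] <-]; rewrite mulgA mulgV mul1g.
move=> A B algA algB XAB; rewrite !back; apply: irrX; try exact: algebraic_translate.
move=> y Xy; have [] : (A `|` B) (g * y)%g by apply: XAB; exists y.
  by left; exists (g * y)%g; rewrite // mulgA mulVg mul1g.
by right; exists (g * y)%g; rewrite // mulgA mulVg mul1g.
Qed.

(** The translate [z^-1 * X] is the common kernel of the constant
    characters, a group, and it inherits irreducibility from [X]. *)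
Lemma full_coset_torsion X z : irreducible X -> X z -> torsion z ->
  kernel_coset (const_lattice X) z `<=` X -> torsion_coset X.
Proof.
move=> irrX Xz tz fullX; pose G := translate z^-1%g X.
have XE : X = kernel_coset (const_lattice X) z.
  by apply/seteqP; split=> //; apply: sub_kernel_coset.
have GE x : G x <-> forall u, const_lattice X u -> mono u x = 1.
  split=> [[y Xy <-] u Lu|H].
    rewrite XE in Xy; apply: (mulfI (mono_neq0 u z)).
    by rewrite -monoM mulgA mulgV mul1g mulr1; apply: Xy.
  exists (z * x)%g; last by rewrite mulgA mulVg mul1g.
  by rewrite XE => u Lu; rewrite monoM H ?mulr1.
have irrG := irreducible_translate z^-1%g irrX.
exists z, G; split=> //; last by rewrite /G translateK.
split=> //; split; first by case: irrG.
- by apply/GE => u _; rewrite mono1.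
- by move=> x y /GE Gx /GE Gy; apply/GE => u Lu; rewrite monoM Gx ?Gy ?mulr1.
- move=> x /GE Gx; apply/GE => u Lu.
  by have := mono1 K u; rewrite -(mulVg x) monoM (Gx u Lu) mulr1.
Qed.

End ConstantCharacters.

(** * Dependent families of characters *)

Section DependentCharacters.
Variables (K : closedFieldType) (n : nat).
Implicit Types (X Y Z : set (Gm K n)) (x y h : Gm K n) (u : 'rV[int]_n).

Definition cdep r (W : 'M[int]_(r, n)) X := exists2 F : Gm K r -> K, lfun F &
  (exists y : Gm K r, F y != 0) /\ forall x, X x -> F (mon W x) = 0.

Definition charfs r (W : 'M[int]_(r, n)) : seq (Gm K n -> K) :=
  [seq (fun x => coordf i (mon W x)) | i <- enum 'I_r].

Lemma size_charfs r (W : 'M[int]_(r, n)) : size (charfs W) = r.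
Proof. by rewrite size_map size_enum_ord. Qed.

Lemma evals_charfs r (W : 'M[int]_(r, n)) x :
  evals (charfs W) x = evals (coords K r) (mon W x).
Proof. by rewrite /evals /charfs /coords -!map_comp. Qed.

Lemma lfun_charfs r (W : 'M[int]_(r, n)) f : List.In f (charfs W) -> lfun f.
Proof.
rewrite /charfs; elim: (enum 'I_r) => //= i s IHs [<-|/IHs //].
exact: (lfun_mon W (lfun_coord K i)).
Qed.

(** A nonzero polynomial function is nonzero at a point with nonzero
    coordinates. *)
Lemma not_indep_cdep r (W : 'M[int]_(r, n)) X : ~ indep (charfs W) X -> cdep W X.
Proof.
move=> /dependP[p pp [pX [e se pe]]]; rewrite size_charfs in se.
pose P (v : seq K) := \prod_(i < r) v`_i.
have pP : polyfun P by apply: polyfun_prod => i; apply: polyfun_var.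
have one : P (nseq r 1) != 0.
  by apply/prodf_neq0 => i _; rewrite nth_nseq ltn_ord oner_neq0.
have [w sw /andP[pw Pw]] := polyfun_domain pp pP se (size_nseq r 1) pe one.
have [y yE] := coords_surj sw Pw.
exists (fun y : Gm K r => p (evals (coords K r) y)).
  apply: lfun_polyfun => // f.
  rewrite /coords; elim: (enum 'I_r) => //= i s IHs [<-|/IHs //].
  exact: lfun_coord.
split; first by exists y; rewrite yE.
by move=> x Xx; rewrite -evals_charfs pX.
Qed.

Definition tors_lattice Y : set 'rV[int]_n :=
  [set u | exists2 m : nat, (0 < m)%N & forall h, Y h -> mono (m%:Z *: u) h = 1].

Lemma tors_latticeP Y : lattice (tors_lattice Y).
Proof.
split=> [|u v [a a0 ua] [b b0 vb]|k u [a a0 ua]].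
- by exists 1 => // h _; rewrite scaler0 mono0.
- exists (a * b)%N; rewrite ?muln_gt0 ?a0 // => h Yh.
  have -> : (a * b)%N%:Z *: (u + v) = b%:Z *: (a%:Z *: u) + a%:Z *: (b%:Z *: v).
    by rewrite !scalerA scalerDr PoszM [b%:Z * _]mulrC.
  by rewrite monoD (monoZ b%:Z) ua // (monoZ a%:Z) vb // !exp1rz mulr1.
- exists a => // h Yh.
  by rewrite scalerA mulrC -scalerA monoZ ua // exp1rz.
Qed.

(** Translating a relation by the stabilizer separates its parts of different
    degree in characters that are independent on the stabilizer. *)
Lemma cdep_stabilizer p q (U : 'M[int]_(p, n)) (V : 'M[int]_(q, n)) X : X !=set0 ->
  free_mod (tors_lattice (Stab X)) U ->
  (forall i, tors_lattice (Stab X) (row i V)) -> cdep (col_mx U V) X -> cdep V X.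
Proof.
move=> [x0 Xx0] freeU torsV [F [s FE] [[y0 Fy0] FX]].
set S := Stab X in freeU torsV.
have S1 : S 1%g by move=> _ [x Xx <-]; rewrite mul1g.
have SM g h : S g -> S h -> S (g * h)%g.
  move=> Sg Sh _ [x Xx <-]; rewrite -mulgA; apply: Sg.
  by exists (h * x)%g => //; apply: Sh; exists x.
have SX g m : S g -> S (g ^+ m)%g.
  move=> Sg; elim: m => [|m IHm]; first by rewrite expg0.
  by rewrite expgS; apply: SM.
have actS g x : S g -> X x -> X (g * x)%g by move=> Sg Xx; apply: Sg; exists x.
have [M M0 VM] : exists2 M : nat, (0 < M)%N &
    forall i h, S h -> mono (row i V) (h ^+ M)%g = 1.
  have /choice[m mP] i : exists m : nat, (0 < m)%N /\
      forall h, S h -> mono (m%:Z *: row i V) h = 1.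
    by have [m m0 H] := torsV i; exists m.
  exists (\prod_i m i)%N; first by apply: prodn_gt0 => i; case: (mP i).
  move=> i h Sh; rewrite (bigD1 i) //= monoX exprM [X in X ^+ _ = _](_ : _ = 1) ?expr1n //.
  by rewrite exprnP -monoZ; case: (mP i) => _; apply.
pose G k1 (y : Gm K q) :=
  \sum_(a <- s | lsubmx a.2 == k1) a.1 * mono (rsubmx a.2) y.
pose ks := undup [seq lsubmx a.2 | a <- s].
pose low (y : Gm K (p + q)) : Gm K p := [ffun i => y (lshift q i)].
pose high (y : Gm K (p + q)) : Gm K q := [ffun i => y (rshift p i)].
have monoE (k : 'rV_(p + q)) (y : Gm K (p + q)) :
    mono k y = mono (lsubmx k) (low y) * mono (rsubmx k) (high y).
  by rewrite /mono big_split_ord /=; congr (_ * _); apply: eq_bigr => i _;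
    rewrite ffunE mxE.
have lowE x : low (mon (col_mx U V) x) = mon U x.
  by apply/ffunP => i; apply: val_inj; rewrite !ffunE /= rowKu.
have highE x : high (mon (col_mx U V) x) = mon V x.
  by apply/ffunP => i; apply: val_inj; rewrite !ffunE /= rowKd.
have split_F (y : Gm K (p + q)) : F y = \sum_(k <- ks) mono k (low y) * G k (high y).
  rewrite FE /lsum; under [RHS]eq_bigr do rewrite mulr_sumr big_mkcond.
  rewrite exchange_big big_seq [RHS]big_seq; apply: eq_bigr => a as_ /=.
  have ak : lsubmx a.2 \in ks by rewrite mem_undup; apply: map_f.
  rewrite (bigD1_seq _ ak (undup_uniq _)) /= eqxx big1 => [|k].
    by rewrite addr0 monoE; ring.
  by rewrite eq_sym => /negPf ->.
have GX k : k \in ks -> forall x, X x -> G k (mon V x) = 0.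
  move=> kks x Xx.
  have : mono k (mon U x) * G k (mon V x) = 0.
    apply: (@mono_independent K n S _ ks (fun k => M%:Z *: (k *m U))
      (fun k => mono k (mon U x) * G k (mon V x))) => //.
    - exact: undup_uniq.
    - move=> i j _ _ ij; apply: contrapT => same.
      case/eqP: ij; apply/eqP; rewrite -subr_eq0; apply/eqP/freeU.
      exists M => // h Sh; rewrite mulmxBl scalerBr monoD -scaleN1r (monoZ (-1)).
      rewrite [X in X * _](_ : _ = mono (M%:Z *: (j *m U)) h).
        by rewrite exprN1 mulfV // mono_neq0.
      by apply/eqP/negPn/negP => neq; apply: same; exists h.
    - move=> h Sh; have := FX _ (actS _ _ (SX h M Sh) Xx).
      rewrite split_F lowE highE => FX0; rewrite -[RHS]FX0; apply: eq_bigr => k' _.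
      rewrite !monM.
      have -> : mon V (h ^+ M)%g = 1%g.
        by apply/ffunP => i; apply: val_inj; rewrite !ffunE /= VM.
      by rewrite mul1g monoM !mono_mon monoX monoZ -exprnP; ring.
  by move=> /eqP; rewrite mulf_eq0 (negPf (mono_neq0 _ _)) => /eqP.
have [k kks Gk] : exists2 k, k \in ks & G k (high y0) != 0.
  apply: contrapT => none; case/eqP: Fy0; rewrite split_F big_seq big1 // => k kks.
  have [->|nz] := eqVneq (G k (high y0)) 0; first by rewrite mulr0.
  by case: none; exists k.
exists (G k); last by split; [exists (high y0)|apply: GX].
exists [seq (a.1, rsubmx a.2) | a <- s & lsubmx a.2 == k] => y.
by rewrite /lsum big_map big_filter.
Qed.

Lemma free_mod_rowsub (A : set 'rV[int]_n) r r' (f : 'I_r' -> 'I_r) (W : 'M[int]_(r, n)) :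
  injective f -> free_mod A W -> free_mod A (rowsub f W).
Proof.
move=> injf freeW k AkW; pose k' : 'rV[int]_r := \row_j \sum_(i | f i == j) k 0 i.
have k'E i : k' 0 (f i) = k 0 i.
  rewrite mxE (bigD1 i) //= big1 ?addr0 // => j /andP[/eqP/injf ->].
  by rewrite eqxx.
have : k' = 0.
  apply: freeW; move: AkW; rewrite !mulmx_sum_row; congr A.
  under [RHS]eq_bigr do rewrite mxE scaler_suml.
  rewrite (exchange_big_dep xpredT) //=; apply: eq_bigr => i _.
  by rewrite (big_pred1 (f i)) ?row_rowsub // => j; rewrite eq_sym.
by move=> k'0; apply/rowP => i; rewrite -k'E k'0 !mxE.
Qed.

End DependentCharacters.

Arguments charfs {K n r} W.

Section MinimalRelation.
Variables (K : closedFieldType) (n : nat).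
Implicit Types (X Y Z : set (Gm K n)) (x y h : Gm K n) (u : 'rV[int]_n).

(** A relation for one character would be a nonzero polynomial in it, so the
    character would be constant. *)
Lemma cdep_free_gt1 X r (W : 'M[int]_(r, n)) : irreducible X ->
  free_mod (const_lattice X) W -> cdep W X -> (1 < r)%N.
Proof.
move=> irrX freeW [F lF [[y Fy] FX]]; have [_ [x0 Xx0] _] := irrX.
case: r => [|[|//]] in W freeW F lF y Fy FX *.
  have y0 : mon W x0 = y by apply/ffunP => -[].
  by rewrite -y0 FX ?eqxx // in Fy.
have [M [p pp pE]] := lfun_clear lF; have [D DP] := polyfun_degree pp.
have [P _ PE] := DP [::].
have evE (z : Gm K 1) : evals (coords K 1) z = [:: coordf 0 z].
  by rewrite /evals /coords enum_ordSl enum_ord0.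
have PF z : P.[coordf 0 z] = (\prod_i coordf i z) ^+ M * F z by rewrite PE -evE pE.
have P0 : P != 0.
  apply: contraNneq Fy => P0; have := PF y; rewrite P0 horner0 => /esym/eqP.
  by rewrite mulf_eq0 expf_eq0 (negPf (prod_coord_neq0 y)) andbF.
have [c cE] : exists c, forall x, X x -> coordf 0 (mon W x) = c.
  apply: (@prime_const _ _ X (fun x => coordf 0 (mon W x)) P) => //.
  - exact: irreducible_prime.
  - by exists x0.
  - exact: (lfun_mon W (lfun_coord K 0)).
  - by move=> x Xx; rewrite PF FX ?mulr0.
have : const_mx 1 = 0 :> 'rV[int]_1.
  apply: freeW; exists c => x Xx; rewrite -(cE x Xx) coord_mon; congr (mono _ x).
  by apply/rowP => j; rewrite !mxE big_ord1 mxE mul1r; congr (W _ j).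
by move/rowP/(_ 0); rewrite !mxE => /eqP; rewrite oner_eq0.
Qed.

(** In a basis of exponents adapted to the hyperplane orthogonal to [b], all
    exponents have the same last entry; dividing by that power of the last
    character leaves a relation between the others. *)
Lemma cdep_hyperplane X r (W : 'M[int]_(r.+1, n)) (s : seq (K * 'rV[int]_r.+1))
    (b : 'rV[int]_r.+1) c : b != 0 -> (forall p, p \in s -> pairing p.2 b = c) ->
  free_mod (const_lattice X) W -> (exists y : Gm K r.+1, lsum s y != 0) ->
  (forall x, X x -> lsum s (mon W x) = 0) ->
  exists2 V : 'M[int]_(r, n), free_mod (const_lattice X) V & cdep V X.
Proof.
move=> b0 sc freeW [y0 sy0] sX.
pose A : set 'rV[int]_r.+1 := [set k | pairing k b = 0].
have pD k l : pairing (k + l) b = pairing k b + pairing l b.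
  by rewrite /pairing mulmxDl mxE.
have pZ a k : pairing (a *: k) b = a * pairing k b.
  by rewrite /pairing -scalemxAl mxE.
have latA : lattice A.
  split=> [|k l Ak Al|a k Ak]; rewrite /A /=.
  - by rewrite /pairing mul0mx mxE.
  - by rewrite pD Ak Al addr0.
  - by rewrite pZ Ak mulr0.
have satA : saturated A.
  by move=> a k a0; rewrite /A /= pZ => /eqP; rewrite mulf_eq0 (negPf a0) => /eqP.
have [R uR [a [ar AR] freeR]] := adapted_basis latA satA.
have pR (k : 'rV[int]_r.+1) : pairing (k *m R) b = \sum_i k 0 i * pairing (row i R) b.
  rewrite mulmx_sum_row /pairing mulmx_suml summxE; apply: eq_bigr => i _.
  by rewrite -scalemxAl mxE.
have AR' (i : 'I_r.+1) : (i < r)%N -> pairing (row i R) b = 0.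
  move=> ir; have [ia|ai] := ltnP i a; first exact: AR.
  pose v := pairing (row i R) b; pose w := pairing (row ord_max R) b.
  have neq : ord_max != i by rewrite -val_eqE /= gtn_eqF.
  have /rowP d0 : w *: delta_mx 0 i - v *: delta_mx 0 ord_max = 0 :> 'rV[int]_r.+1.
    apply: freeR => [j ja|].
      rewrite !mxE !eqxx /=.
      have /negPf -> : j != i by apply: contraTneq ja => ->; rewrite -leqNgt.
      have /negPf -> : j != ord_max.
        by apply: contraTneq ja => ->; rewrite -leqNgt /= (leq_trans ai (ltnW ir)).
      by rewrite !mulr0 subr0.
    rewrite mulmxBl -!scalemxAl -!rowE /A /= -scaleNr pD !pZ -/v -/w.
    by rewrite mulNr mulrC subrr.
  have := d0 ord_max; rewrite !mxE !eqxx (negPf neq) mulr0 mulr1 sub0r => /eqP.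
  by rewrite oppr_eq0 => /eqP.
pose v := pairing (row ord_max R) b.
have pE k : pairing k b = (k *m invmx R) 0 ord_max * v.
  rewrite -{1}(mulmxKV uR k) pR big_ord_recr /= big1 ?add0r // => i _.
  by rewrite AR' ?mulr0 /=.
have v0 : v != 0.
  apply: contraNneq b0 => v0; apply/eqP/rowP => i; rewrite [RHS]mxE.
  have := pE (delta_mx 0 i); rewrite v0 mulr0 /pairing -rowE !mxE.
  by [].
have [p0 p0s] : exists p0, p0 \in s.
  case: (s) sy0 => [|p0 s' _]; first by rewrite /lsum big_nil eqxx.
  by exists p0; rewrite mem_head.
pose e := (p0.2 *m invmx R) 0 ord_max.
have eE p : p \in s -> (p.2 *m invmx R) 0 ord_max = e.
  by move=> ps; apply: (mulIf v0); rewrite -!pE !sc.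
pose w := widen_ord (leqnSn r).
have winj : injective w by move=> i j /(congr1 val) /= ij; apply: val_inj.
pose low (y : Gm K r.+1) : Gm K r := [ffun i => y (w i)].
pose F (z : Gm K r) := \sum_(p <- s) p.1 * mono (\row_i (p.2 *m invmx R) 0 (w i)) z.
have FE (y : Gm K r.+1) : lsum s y = coordf ord_max (mon R y) ^ e * F (low (mon R y)).
  rewrite /lsum /F mulr_sumr big_seq [RHS]big_seq; apply: eq_bigr => p ps.
  rewrite -{1}(mulmxKV uR p.2) -mono_mon {1}/mono big_ord_recr /= eE //.
  rewrite mulrA mulrC; congr (_ * (_ * _)).
  by apply: eq_bigr => i _; rewrite mxE /low [in RHS]ffunE.
exists (rowsub w (R *m W)).
  apply: free_mod_rowsub => // k; rewrite mulmxA => /freeW kR.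
  by rewrite -(mulmxK uR k) kR mul0mx.
exists F.
  exists [seq (p.1, \row_i (p.2 *m invmx R) 0 (w i)) | p <- s] => z.
  by rewrite /lsum big_map.
split.
  exists (low (mon R y0)); apply: contraNneq sy0 => F0.
  by rewrite FE F0 mulr0.
move=> x Xx; have := sX x Xx; rewrite FE => /eqP.
rewrite mulf_eq0 (negPf (expfz_neq0 _ (valP (mon R (mon W x) ord_max)))) /= => /eqP.
rewrite mon_comp => <-; congr F; apply/ffunP => i; apply: val_inj.
by rewrite !ffunE /= row_rowsub.
Qed.

(** Among the dependent families of characters that are independent modulo
    the constant ones, take a smallest one, and a relation with fewest
    terms. Fewest terms keep its proper parts from vanishing on [X]; by
    [cdep_hyperplane], exponents in a hyperplane would give a smaller
    family. *)
Lemma minimal_relation X r0 (W0 : 'M[int]_(r0, n)) : irreducible X ->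
  free_mod (const_lattice X) W0 -> cdep W0 X ->
  exists r (W : 'M[int]_(r.+1, n)) (s : seq (K * 'rV[int]_r.+1)),
    [/\ (0 < r)%N /\ (r < r0)%N,
        indep (charfs (rowsub (widen_ord (leqnSn r)) W)) X,
        forall b, b != 0 -> exists p q, [/\ p \in s, q \in s & pairing p.2 b != pairing q.2 b],
        forall x, X x -> lsum s (mon W x) = 0 &
        forall P : pred 'rV[int]_r.+1, has (fun p => P p.2) s ->
          has (fun p => ~~ P p.2) s ->
          exists2 x, X x & lsum [seq p <- s | P p.2] (mon W x) != 0].
Proof.
move=> irrX free0 dep0; have [_ [x0 Xx0] _] := irrX.
pose Q r := `[< exists2 W : 'M[int]_(r, n), free_mod (const_lattice X) W & cdep W X >].
have Q0 : exists r, Q r by exists r0; apply/asboolP; exists W0.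
case: (ex_minnP Q0) => r /asboolP[W freeW depW] rmin.
have r1 := cdep_free_gt1 irrX freeW depW.
have rr0 : (r <= r0)%N by apply: rmin; apply/asboolP; exists W0.
case: r r1 rr0 W freeW depW rmin => // r r1 rr0 W freeW depW rmin.
have nodep (V : 'M[int]_(r, n)) : free_mod (const_lattice X) V -> ~ cdep V X.
  move=> freeV depV; have /rmin : Q r by apply/asboolP; exists V.
  by rewrite ltnn.
pose good (s : seq (K * 'rV[int]_r.+1)) :=
  (exists y : Gm K r.+1, lsum s y != 0) /\ forall x, X x -> lsum s (mon W x) = 0.
pose N k := `[< exists2 s, good s & size s = k >].
have N0 : exists k, N k.
  have [F [s FE] [[y Fy] FX]] := depW; exists (size s); apply/asboolP; exists s => //.
  split; first by exists y; rewrite -FE.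
  by move=> x Xx; rewrite -FE FX.
case: (ex_minnP N0) => k /asboolP[s [[y sy] sX] sk] kmin.
have small t : (size t < size s)%N -> (forall x, X x -> lsum t (mon W x) = 0) ->
    forall y : Gm K r.+1, lsum t y = 0.
  move=> ts tX z; apply/eqP/negPn/negP => tz.
  have /kmin : N (size t) by apply/asboolP; exists t => //; split=> //; exists z.
  by rewrite -sk leqNgt ts.
exists r, W, s; split=> //.
- apply: contrapT => /not_indep_cdep; apply: nodep; apply: free_mod_rowsub => //.
  by move=> i j /(congr1 val) /= ij; apply: val_inj.
- move=> b b0; apply: contrapT => same.
  have [p0 p0s] : exists p0, p0 \in s.
    case: (s) sy => [|p0 s' _]; first by rewrite /lsum big_nil eqxx.
    by exists p0; rewrite mem_head.
  have [||V freeV] := @cdep_hyperplane X r W s b (pairing p0.2 b) b0 _ freeW _ sX.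
  - move=> p ps; apply/eqP/negPn/negP => neq; apply: same.
    by exists p, p0.
  - by exists y.
  - exact: nodep.
- move=> P sP sNP; apply: contrapT => vanish.
  have split_s (z : Gm K r.+1) :
      lsum s z = lsum [seq p <- s | P p.2] z + lsum [seq p <- s | ~~ P p.2] z.
    by rewrite /lsum (bigID (fun p => P p.2)) /= !big_filter.
  have count_s := count_predC (fun p : K * 'rV[int]_r.+1 => P p.2) s.
  have t0 : forall z : Gm K r.+1, lsum [seq p <- s | P p.2] z = 0.
    apply: small.
      rewrite size_filter -count_s -[X in (X < _)%N]addn0 ltn_add2l -has_count.
      exact: sNP.
    move=> x Xx; apply/eqP/negPn/negP => nz; apply: vanish.
    by exists x.
  case/eqP: sy; rewrite split_s t0 add0r.
  apply: small.
    rewrite size_filter -count_s -[X in (X < _)%N]add0n ltn_add2r -has_count.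
    exact: sP.
  by move=> x Xx; have := sX x Xx; rewrite split_s t0 add0r.
Qed.

End MinimalRelation.

Section SmallFamily.
Variables (K : closedFieldType) (n : nat).
Implicit Types (X Y Z : set (Gm K n)) (x y h : Gm K n) (u : 'rV[int]_n).

Lemma const_tors_lattice X : X !=set0 -> const_lattice X `<=` tors_lattice (Stab X).
Proof.
move=> [x Xx] u [c uc]; exists 1 => // h Sh; rewrite scale1r.
have := uc (h * x)%g (Sh _ (ex_intro2 _ _ x Xx erefl)).
rewrite monoM (uc x Xx) => E; apply: (mulIf (mono_neq0 u x)).
by rewrite (uc x Xx) E mul1r.
Qed.

(** The dimension [delta] of the stabilizer is at most the rank [s1] of the
    characters on it, and [X] lies properly in a coset of dimension at least
    [d + 1]; so [d + 1] independent characters can be chosen with [s1] of them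
    independent on the stabilizer and the others of finite order there. They
    are dependent on [X], hence so are the latter ones alone. *)
Lemma small_dependent_family X d delta z : irreducible X -> has_dim X d ->
  has_dim (Stab X) delta -> X z -> ~ kernel_coset (const_lattice X) z `<=` X ->
  exists r0 (W0 : 'M[int]_(r0, n)),
    [/\ free_mod (const_lattice X) W0, cdep W0 X & (r0 + delta <= d.+1)%N].
Proof.
move=> irrX dimX dimS Xz notfull.
have [algX X0 _] := irrX.
set A := const_lattice X; set B := tors_lattice (Stab X).
have latA : lattice A := const_latticeP X; have latB : lattice B := tors_latticeP (Stab X).
have AB : A `<=` B := const_tors_lattice X0.
have latT : lattice [set: 'rV[int]_n] by [].
have [s1 [U [_ freeU] spanU]] := max_free latB latT.
have [s2 [V [BV freeV] spanV]] := max_free latA latB.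
have delta_s1 : (delta <= s1)%N.
  have [F [lF <- iF]] := chain_indep dimS.1.
  apply: (indep_growth_span (W := U) _ lF iF) => u.
  have [m m0 [k [m' m'0 H]]] := spanU u I.
  exists (m' * m)%N; rewrite ?muln_gt0 ?m0 ?m'0 //.
  exists (m'%:Z *: k), 1 => y Sy; rewrite -(H y Sy); congr (mono _ y).
  by rewrite scalerBr scalerA PoszM -scalemxAl.
have dim_s : (d.+1 <= s1 + s2)%N.
  have [F [lF sF iF]] := chain_indep dimX.1.
  have [x [Zx nXx]] : exists x, kernel_coset A z x /\ ~ X x.
    by move/existsNP: notfull => [x /not_implyP[Zx nXx]]; exists x.
  have [g lg [gX gx]] := algebraic_separate algX nXx.
  have igF : indep (g :: F) (kernel_coset A z).
    apply: (indep_cons lF lg (sub_kernel_coset Xz) _ gX _ iF); last by exists x.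
    by apply: kernel_coset_prime => //; apply: const_lattice_saturated.
  rewrite -sF; apply: (indep_growth_span (W := col_mx U V) (F := g :: F) _ _ igF).
    move=> u; have [m m0 [k Bk]] := spanU u I.
    have [m' m'0 [k' Ak']] := spanV _ Bk.
    exists (m' * m)%N; rewrite ?muln_gt0 ?m0 ?m'0 //.
    exists (row_mx (m'%:Z *: k) k'), (mono (m'%:Z *: (m%:Z *: u - k *m U) - k' *m V) z).
    move=> y Zy; rewrite -(Zy _ Ak'); congr (mono _ y).
    by rewrite mul_row_col scalerBr scalerA PoszM -scalemxAl opprD addrA.
  by move=> f [<-|/lF].
(* The minimum only guards against [s1 > d], which the bound [1 < b] obtained
   at the end excludes. *)
pose a := minn s1 d.+1; pose b := (d.+1 - a)%N.
have as1 : (a <= s1)%N := geq_minl _ _.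
have bs2 : (b <= s2)%N by rewrite /b /a; lia.
pose U' := rowsub (widen_ord as1) U; pose V' := rowsub (widen_ord bs2) V.
have winj p q (pq : (p <= q)%N) : injective (widen_ord pq).
  by move=> i j /(congr1 val) /= ij; apply: val_inj.
have freeU' : free_mod B U' by apply: free_mod_rowsub.
have freeV' : free_mod A V' by apply: free_mod_rowsub.
have BV' i : B (row i V') by rewrite row_rowsub.
have depUV : cdep (col_mx U' V') X.
  apply: not_indep_cdep => iUV.
  have := indep_dim irrX dimX (lfun_charfs (W := col_mx U' V')) iUV.
  by rewrite size_charfs /b /a; lia.
have depV : cdep V' X := cdep_stabilizer X0 freeU' BV' depUV.
exists b, V'; split=> //.
by have := cdep_free_gt1 irrX freeV' depV; rewrite /b /a; lia.
Qed.

End SmallFamily.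

(** * Counting torsion points on an irreducible set *)

Section CountingTorsion.
Variables (K : closedFieldType) (n : nat).
Implicit Types (X Y Z : set (Gm K n)) (x y h : Gm K n) (u : 'rV[int]_n).

Definition torsion_upto X (T : nat) : set (Gm K n) :=
  [set z | X z /\ exists2 N, has_order z N & (N <= T)%N].

Lemma torsion_upto_proper X d g : irreducible X -> has_dim X d -> (0 < d)%N ->
  lfun g -> (exists2 x, X x & g x != 0) ->
  exists c, forall T, card_le [set z | torsion_upto X T z /\ g z = 0] (c * T ^ d).
Proof.
move=> irrX dimX d0 lg gX; have [c cP] := torsion_count_proper irrX dimX lg gX.
exists c => T.
apply: (@card_leW _ _ (\sum_(N <- iota 1 T) c * T ^ d.-1)%N).
  rewrite big_const_seq count_predT size_iota iter_addn_0 mulnAC -mulnA -expnS.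
  by rewrite prednK.
apply: (@card_le_bigU _ _ _ _ (fun N => [set z | [/\ X z, g z = 0 & (z ^+ N)%g = 1%g]])).
  move=> N; rewrite mem_iota add1n ltnS => /andP[N0 NT].
  have [B BN cB] := cP N N0; apply: card_leW cB.
  have : (N * B <= N * (c * N ^ d.-1))%N by rewrite mulnCA -expnS prednK.
  rewrite leq_pmul2l // => /leq_trans; apply.
  by rewrite leq_mul2l leq_wexp2r ?orbT.
move=> z [[Xz [N [N0 zN _] NT]] gz]; exists N => //.
by rewrite mem_iota N0 add1n ltnS.
Qed.

Lemma order_dvd r (W : 'M[int]_(r, n)) (z : Gm K n) N : has_order z N ->
  exists m N', [/\ (0 < m)%N, has_order (mon W z) N' & N = (m * N')%N].
Proof.
move=> [N0 zN _]; pose P m := (0 < m)%N && ((mon W z ^+ m)%g == 1%g).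
have P0 : exists m, P m by exists N; rewrite /P N0 -monX zN mon1 eqxx.
case: (ex_minnP P0) => N' /andP[N'0 /eqP zN'] N'min.
have N'N : (N' %| N)%N.
  rewrite /dvdn -leqn0 leqNgt; apply/negP => pos.
  have Pmod : P (N %% N')%N.
    rewrite /P pos; apply/eqP; have : (mon W z ^+ N)%g = 1%g by rewrite -monX zN mon1.
    by rewrite {1}(divn_eq N N') expgnDr mulnC expgnA zN' expg1n mul1g.
  by have := N'min _ Pmod; rewrite leqNgt ltn_mod N'0.
exists (N %/ N')%N, N'; split; last by rewrite divnK.
  by rewrite divn_gt0 // dvdn_leq.
by split=> // m m0 zm; apply: N'min; rewrite /P m0 zm eqxx.
Qed.

End CountingTorsion.

Section CountingOverRelation.
Variables (K : closedFieldType) (n : nat).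
Implicit Types (X Y Z : set (Gm K n)) (x y h : Gm K n) (u : 'rV[int]_n).

Lemma has_order_inj r (z : Gm K r) N N' : has_order z N -> has_order z N' -> N = N'.
Proof.
move=> [N0 zN minN] [N'0 zN' minN']; apply/eqP; rewrite eqn_leq.
by rewrite minN // minN'.
Qed.

(** The map given by the characters of a minimal relation sends all but few
    torsion points to zeros of the relation to which [card_pure_zeros] applies.
    A point of order [N] whose image has order [N / m] is determined, up to
    boundedly many choices, by the image and by [e <= d - r] coordinates in the
    [N]-th roots of unity. *)
Lemma torsion_upto_relation X d r (W : 'M[int]_(r.+1, n)) (s : seq (K * 'rV[int]_r.+1)) :
  irreducible X -> has_dim X d -> (0 < r)%N ->
  indep (charfs (rowsub (widen_ord (leqnSn r)) W)) X ->
  (forall b, b != 0 -> exists p q, [/\ p \in s, q \in s & pairing p.2 b != pairing q.2 b]) ->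
  (forall x, X x -> lsum s (mon W x) = 0) ->
  (forall P : pred 'rV[int]_r.+1, has (fun p => P p.2) s -> has (fun p => ~~ P p.2) s ->
     exists2 x, X x & lsum [seq p <- s | P p.2] (mon W x) != 0) ->
  exists C e, (e + r <= d)%N /\ forall T (Q : nat -> nat),
    (forall m q, (0 < m)%N -> (q ^ r.+1 <= 2 ^ r.+1 * (T %/ m) ^ r)%N -> (q <= Q m)%N) ->
    card_le (torsion_upto X T)
      (C * T ^ d + (\sum_(1 <= m < T.+1) C * Q m ^ r.+2) * T ^ e).
Proof.
move=> irrX dimX r0 indV sep sX proper.
set V := rowsub _ W in indV.
pose cS (S : seq 'I_n) := [seq @coordf K n i | i <- S].
have lcS S f : List.In f (cS S ++ charfs V) -> lfun f.
  elim: S => [|i S IHS] /=; first exact: lfun_charfs.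
  by move=> [<-|/IHS //]; apply: lfun_coord.
pose P k := `[< exists2 S, indep (cS S ++ charfs V) X & size S = k >].
have sizeG S : size (cS S ++ charfs V) = (size S + r)%N.
  by rewrite size_cat size_map size_charfs.
have P0 : exists k, P k by exists 0; apply/asboolP; exists [::].
have Pd k : P k -> (k <= d)%N.
  move=> /asboolP[S iS <-]; have := indep_dim irrX dimX (lcS S) iS.
  by rewrite sizeG; apply: leq_trans; apply: leq_addr.
(* Coordinates that complete the [r] independent characters to a maximal
   independent family. *)
case: (ex_maxnP P0 Pd) => e /asboolP[S iS Se] emax.
set G := cS S ++ charfs V in iS.
have erd : (e + r <= d)%N.
  by rewrite -Se -sizeG; apply: indep_dim irrX dimX (lcS S) iS.
have d0 : (0 < d)%N by apply: leq_trans r0 (leq_trans (leq_addl _ _) erd).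
have rel i : exists pz : (seq K -> K) * K, [/\ polyfun pz.1,
    (forall x, X x -> pz.1 (coordf i x :: evals G x) = 0) &
    exists2 x, X x & pz.1 (pz.2 :: evals G x) != 0].
  have : ~ indep (@coordf K n i :: G) X.
    move=> iG; have /emax : P e.+1 by apply/asboolP; exists (i :: S); rewrite /= ?Se.
    by rewrite ltnn.
  move=> /dependP[p pp [pX [[|z v] //= [sv] pv]]]; exists (p, z); split=> //.
  apply: contrapT => none; case/eqP: pv.
  apply: (iS (fun v => p (z :: v)) (polyfun_cons z pp) _ v sv) => x Xx.
  by apply/eqP/negPn/negP => nz; apply: none; exists x.
have [pz pzP] := choice rel.
have /choice[D DP] i : exists D, forall v, exists2 P : {poly K},
    (size P <= D)%N & forall z, P.[z] = (pz i).1 (z :: v).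
  by apply: polyfun_degree; case: (pzP i).
pose D0 := (\sum_i D i)%N.
have DD0 i : (D i <= D0)%N by rewrite /D0 (bigD1 i) //= leq_addr.
(* The exceptional closed subsets: where the algebraic relation of some
   coordinate over the maximal family degenerates, and where a proper part of
   [s] vanishes. *)
pose J : finType := ('I_n + (size s).-tuple bool)%type.
have /choice[g gP] (j : J) : exists g, [/\ lfun g, (exists2 x, X x & g x != 0) &
    match j with
    | inl i => forall z, g z = (pz i).1 ((pz i).2 :: evals G z)
    | inr m => (exists2 x, X x & lsum (mask m s) (mon W x) != 0) ->
               forall z, g z = lsum (mask m s) (mon W z)
    end].
  case: j => [i|m].
    have [pp _ nz] := pzP i.
    exists (fun z => (pz i).1 ((pz i).2 :: evals G z)); split=> //.
    exact: (lfun_polyfun (polyfun_cons (pz i).2 pp) (lcS S)).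
  have [ex|none] := pselect (exists2 x, X x & lsum (mask m s) (mon W x) != 0).
    exists (fun z => lsum (mask m s) (mon W z)); split=> //.
    by apply: (lfun_mon W); exists (mask m s).
  have [_ [x Xx] _] := irrX; exists (fun=> 1); split=> //; first exact: lfun_cst.
  by exists x; rewrite ?oner_eq0.
have /choice[c cP] (j : J) : exists c, forall T,
    card_le [set z | torsion_upto X T z /\ g j z = 0] (c * T ^ d).
  by have [lg gX _] := gP j; apply: torsion_upto_proper lg gX.
have [C0 C0P] := card_pure_zeros (ltn0Sn r) sep.
exists (\sum_j c j + C0 * D0 ^ n)%N, e; split=> // T Q QP.
pose good := [set z | torsion_upto X T z /\ forall j, g j z != 0].
apply: (@card_leS _ _ ([set z | exists2 j, j \in enum J & torsion_upto X T z /\ g j z = 0]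
    `|` good)).
  move=> z tz; have [[j gj]|none] := pselect (exists j, g j z = 0).
    by left; exists j; rewrite ?mem_enum.
  by right; split=> // j; apply/eqP => gj; apply: none; exists j.
apply: card_leU.
  apply: (@card_leW _ _ (\sum_(j <- enum J) c j * T ^ d)%N).
    by rewrite big_enum -big_distrl leq_mul2r leq_addr orbT.
  by apply: card_le_bigU => [j _|z [j]]; [apply: cP|exists j].
apply: (@card_leW _ _ (\sum_(m <- iota 1 T) (C0 * Q m ^ r.+2) * (T ^ e * D0 ^ n))%N).
  rewrite /index_iota subn1 /= big_distrl /=; apply: leq_sum => m _.
  have -> : (C0 * Q m ^ r.+2 * (T ^ e * D0 ^ n) = C0 * D0 ^ n * Q m ^ r.+2 * T ^ e)%N by ring.
  by rewrite leq_mul2r leq_mul2r leq_addl !orbT.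
apply: (@card_le_bigU _ _ _ _ (fun m => [set z | good z /\ exists N', [/\ (0 < N')%N,
    has_order (mon W z) N', (z ^+ (m * N'))%g = 1%g & (m * N' <= T)%N]])); last first.
  move=> z gz; have [[_ [N oz NT]] _] := gz.
  have [m [N' [m0 oN' NE]]] := order_dvd W oz; have [N0 zN _] := oz.
  have N'0 : (0 < N')%N by case: oN'.
  exists m; last by split=> //; exists N'; rewrite -NE.
  rewrite mem_iota m0 add1n ltnS; apply: leq_trans NT.
  by rewrite NE leq_pmulr.
move=> m; rewrite mem_iota => /andP[m0 _].
have cardm := C0P (T %/ m)%N (Q m) (fun q => QP m q m0).
apply: (@card_le_fibres _ _ (mon W) _ _ _ _ cardm).
  move=> z [[[Xz _] gz] [N' [N'0 oN' _ NT]]]; split; last first.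
    by exists N' => //; rewrite leq_divRL // mulnC.
  split=> [|Pr sP sNP]; first exact: sX.
  rewrite filter_mask.
  have szm : size [seq Pr p.2 | p <- s] == size s by rewrite size_map.
  have := gz (inr (Tuple szm)); have [_ _ gE] := gP (inr (Tuple szm)).
  by rewrite gE //= -filter_mask; apply: proper.
move=> u0; set E := (X in card_le X).
have [[z0 [[_ [N0' [N0'0 oN0' _ N0T]]] uE]]|none] := pselect (exists z, E z); last first.
  by apply: (card_leW (leq0n _)); apply: card_le0 => z Ez; apply: none; exists z.
pose N := (m * N0')%N.
have N0 : (0 < N)%N by rewrite muln_gt0 m0.
have EN z : E z -> (z ^+ N)%g = 1%g.
  move=> [[_ [N' [_ oN' zN' _]]] zu].
  suff -> : N = (m * N')%N by [].
  by rewrite /N; congr muln; rewrite uE in oN0'; rewrite zu in oN'; apply: has_order_inj oN'.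
apply: (@card_leW _ _ (N ^ size S * D0 ^ n)%N).
  by rewrite leq_mul2r Se leq_wexp2r ?orbT.
have cardS : card_le [set v | exists2 y, (y ^+ N)%g = 1%g :> Gm K n &
    v = [seq y i | i <- S]] (N ^ size S).
  apply: card_le_coords => i.
  apply: (@card_leS _ _ [set u : mulgroup K | (u ^+ N)%g = 1%g]); last exact: card_le_unity.
  by move=> u' [y yN ->] /=; rewrite -ffun_expg yN ffunE.
apply: (@card_le_fibres _ _ (fun z : Gm K n => [seq z i | i <- S]) _ _ _ _ cardS).
  by move=> z /EN zN; exists z.
move=> v; apply: card_le_ffun => i.
have [[z1 [E1 v1]]|none] := pselect (exists z, E z /\ [seq z i | i <- S] = v); last first.
  apply: (card_leW (leq0n _)); apply: card_le0 => _ [z [Ez zv] _].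
  by apply: none; exists z.
have same z : E z -> [seq z i | i <- S] = v -> evals G z = evals G z1.
  move=> Ez zv; rewrite /G /evals !map_cat; congr (_ ++ _).
    by rewrite -!/(evals _ _) (evals_eq (L := S) (y := z1)) // v1.
  rewrite -!/(evals _ _) !evals_charfs; congr (evals _ _).
  apply/ffunP => k; apply: val_inj; rewrite !ffunE /= !row_rowsub.
  have /ffunP/(_ (widen_ord (leqnSn r) k)) : mon W z = mon W z1.
    by case: Ez => _ ->; case: E1 => _ ->.
  by rewrite !ffunE => /(congr1 val).
have [Pi sPi PiE] := DP i (evals G z1).
have Pi0 : Pi != 0.
  have [_ gz1] : good z1 by case: E1 => -[].
  have := gz1 (inl i); have [_ _ ->] := gP (inl i).
  by apply: contraNneq => Pi0; rewrite -PiE Pi0 horner0.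
apply: (card_leS _ (card_le_roots Pi0 (leqW (leq_trans sPi (DD0 i))))).
move=> _ [z [Ez zv] ->] /=; rewrite PiE -(same z Ez zv).
have [_ pX _] := pzP i; apply: pX.
by case: Ez => -[[[]]].
Qed.

End CountingOverRelation.

(** * The exponent *)

Section RealBounds.
Variable R : realType.

(** The summand [m ^ (-3/2)] is at most twice the difference of the values
    of [m ^ (-1/2)] at [m - 1] and [m], so the sum up to [M] is at most [3 -
    2 * M ^ (-1/2)]. *)
Lemma sum_inv_three_halves M :
  \sum_(1 <= m < M.+1) (m%:R^-1 : R) * Num.sqrt m%:R^-1 <= 3.
Proof.
case: M => [|M]; first by rewrite big_geq.
suff: \sum_(1 <= m < M.+2) (m%:R^-1 : R) * Num.sqrt m%:R^-1 <=
    3 - 2 * Num.sqrt M.+1%:R^-1.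
  by move=> /le_trans; apply; rewrite gerBl mulr_ge0 // sqrtr_ge0.
elim: M => [|M IHM]; first by rewrite big_nat1 invr1 sqrtr1; lra.
rewrite big_nat_recr //=; move: IHM; set S := \sum_(_ <= _ < _) _.
set a := Num.sqrt M.+1%:R^-1; set b := Num.sqrt M.+2%:R^-1.
have a0 : 0 < a by rewrite sqrtr_gt0 invr_gt0 ltr0n.
have b0 : 0 < b by rewrite sqrtr_gt0 invr_gt0 ltr0n.
have a2 : a ^+ 2 = M.+1%:R^-1 by rewrite sqr_sqrtr // invr_ge0 ler0n.
have b2 : b ^+ 2 = M.+2%:R^-1 by rewrite sqr_sqrtr // invr_ge0 ler0n.
have ab : (a - b) * (a + b) = a ^+ 2 * b ^+ 2.
  rewrite -subr_sqr a2 b2 -(natr1 M.+1).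
  have m1 : 0 < M.+1%:R :> R by rewrite ltr0n.
  by field; rewrite ?gt_eqF // addr_gt0.
have ba : b <= a by rewrite ler_wsqrtr // lef_pV2 ?posrE ?ltr0n // ler_nat.
have step : a * b ^+ 2 <= 2 * (a - b).
  rewrite -(ler_pM2l a0); have -> : a * (a * b ^+ 2) = a ^+ 2 * b ^+ 2 by ring.
  by rewrite -ab mulrC; nra.
have step' : b ^+ 2 * b <= a * b ^+ 2 by rewrite mulrC ler_wpM2r ?sqr_ge0.
by rewrite -b2; lra.
Qed.

(** The terms [(x / m) ^ (r + 1 - 1 / (r + 1))] have an exponent of at least
    [3 / 2], so that their sum over [m] is of the order of the first one. *)
Lemma torsion_sum_bound (C e r d T : nat) (x : R) (Q : nat -> nat) :
  (0 < r)%N -> (e + r <= d)%N -> 1 <= x -> T%:R <= x ->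
  (forall m, (0 < m)%N -> (Q m)%:R <= 2 * (x / m%:R) `^ (r%:R / r.+1%:R)) ->
  (C * T ^ d + (\sum_(1 <= m < T.+1) C * Q m ^ r.+2) * T ^ e)%N%:R
    <= (C%:R * (1 + 3 * 2 ^+ r.+2)) * x `^ (d%:R + 1 - r.+1%:R^-1).
Proof.
move=> r0 erd x1 Tx QB; have x0 : 0 <= x by lra.
set E := d%:R + 1 - r.+1%:R^-1; pose b : R := r%:R * r.+2%:R / r.+1%:R.
have rp : 0 < r.+1%:R :> R by rewrite ltr0n.
have r1 : 1 <= r%:R :> R by rewrite ler1n.
have bE : b = r%:R + 1 - r.+1%:R^-1.
  rewrite /b -(natr1 r.+1) -(natr1 r); field.
  by rewrite gt_eqF // natr1.
have inv_le : (r.+1%:R^-1 : R) <= 2^-1.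
  by rewrite lef_pV2 ?posrE // -(natr1 r); lra.
have b32 : 1 + 2^-1 <= b.
  by rewrite bE; move: inv_le; move: (r.+1%:R^-1 : R) => v; lra.
have QE m : (0 < m)%N ->
    (Q m ^ r.+2)%N%:R <= 2 ^+ r.+2 * x `^ b * (m%:R^-1 * Num.sqrt m%:R^-1).
  move=> m0; have mp : 0 < m%:R :> R by rewrite ltr0n.
  have mi0 : 0 < (m%:R^-1 : R) by rewrite invr_gt0.
  have mi1 : (m%:R^-1 : R) <= 1 by rewrite invf_le1 // ler1n.
  rewrite natrX; apply: (@le_trans _ _ ((2 * (x / m%:R) `^ (r%:R / r.+1%:R)) ^+ r.+2)).
    by rewrite lerXn2r ?nnegrE ?ler0n ?mulr_ge0 ?powR_ge0 // QB.
  rewrite exprMn -mulrA ler_wpM2l ?exprn_ge0 //.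
  rewrite -powR_mulrn ?powR_ge0 // -powRrM.
  have -> : r%:R / r.+1%:R * r.+2%:R = b by rewrite /b mulrAC.
  rewrite powRM ?(ltW mi0) // ler_wpM2l ?powR_ge0 //.
  apply: (@le_trans _ _ (m%:R^-1 `^ (1 + 2^-1))).
    by apply: ger_powR => //; rewrite mi0 mi1.
  rewrite powRD ?(gt_eqF mi0) ?implybT // powRr1 ?(ltW mi0) //.
  by rewrite powR12_sqrt // ltW.
have TX k : (T ^ k)%N%:R <= x `^ k%:R.
  by rewrite natrX powR_mulrn // lerXn2r ?nnegrE ?ler0n.
rewrite natrD mulrDr mulr1 mulrDl; apply: lerD.
  rewrite natrM ler_wpM2l ?ler0n //; apply: le_trans (TX d) _.
  by apply: ler_powR => //; rewrite /E; move: inv_le; move: (r.+1%:R^-1 : R) => v; lra.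
rewrite natrM natr_sum.
apply: (@le_trans _ _ ((C%:R * (2 ^+ r.+2 * x `^ b) * 3) * x `^ e%:R)).
  apply: ler_pM (TX e); [|exact: ler0n|].
    by apply: sumr_ge0 => i _; apply: ler0n.
  apply: (@le_trans _ _ (\sum_(1 <= m < T.+1) (C%:R * (2 ^+ r.+2 * x `^ b)) *
      (m%:R^-1 * Num.sqrt m%:R^-1))).
    rewrite big_nat [leRHS]big_nat; apply: ler_sum => m /andP[m0 _].
    by rewrite natrM -!mulrA ler_wpM2l ?ler0n // !mulrA -[leRHS]mulrA QE.
  rewrite -mulr_sumr ler_wpM2l ?sum_inv_three_halves //.
  by apply: mulr_ge0 (ler0n _ _) (mulr_ge0 (exprn_ge0 _ _) (powR_ge0 _ _)).
have -> : C%:R * (2 ^+ r.+2 * x `^ b) * 3 * x `^ e%:R =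
    C%:R * (3 * 2 ^+ r.+2) * (x `^ b * x `^ e%:R) by ring.
rewrite ler_wpM2l // -powRD; last by rewrite (gt_eqF (lt_le_trans ltr01 x1)) implybT.
apply: ler_powR => //; rewrite bE /E.
have : (e + r)%:R <= d%:R :> R by rewrite ler_nat.
by rewrite natrD; move: (r.+1%:R^-1 : R) => v; lra.
Qed.

End RealBounds.

Lemma torsion_le_upto (R : realType) (K : closedFieldType) n (X : set (Gm K n)) (T : R) :
  0 <= T -> torsion_le X T `<=` torsion_upto X (Num.truncn T).
Proof.
move=> T0 z [Xz [tz otz]]; split=> //; exists (ord tz); last by rewrite truncn_ge_nat.
rewrite /ord; case: ex_minnP => N /andP[N0 /eqP zN] Nmin; split=> // m m0 zm.
by apply: Nmin; rewrite m0 zm eqxx.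
Qed.

Theorem theorem1p2 (R : realType) (K : closedFieldType) (n : nat)
  (X : set (Gm K n)) (d delta : nat) :
  (1 <= n)%N ->
  irreducible X ->
  admissible X ->
  has_dim X d ->
  has_dim (Stab X) delta ->
  exists2 c : R, 0 < c &
    forall T : R, 1 <= T ->
      finite_set (torsion_le X T) /\
      #|` fset_set (torsion_le X T)|%:R
        <= c * T `^ (d%:R + 1 - (d%:R - delta%:R + 1)^-1).
Proof.
move=> _ irrX admX dimX dimS.
have finish C c0 : 0 <= c0 ->
    (forall T : R, 1 <= T -> card_le (torsion_le X T) (C T) /\
       (C T)%:R <= c0 * T `^ (d%:R + 1 - (d%:R - delta%:R + 1)^-1)) ->
    exists2 c : R, 0 < c & forall T : R, 1 <= T ->
      finite_set (torsion_le X T) /\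
      #|` fset_set (torsion_le X T)|%:R
        <= c * T `^ (d%:R + 1 - (d%:R - delta%:R + 1)^-1).
  move=> c00 H; exists (c0 + 1) => [|T T1]; first lra.
  have [cardT CT] := H T T1; have [fin le] := card_le_finite cardT.
  split=> //; apply: (@le_trans _ _ (C T)%:R); first by rewrite ler_nat.
  by apply: le_trans CT _; rewrite ler_wpM2r ?powR_ge0 //; lra.
have [[z [Xz tz]]|none] := pselect (exists z, X z /\ torsion z); last first.
  apply: (finish (fun=> 0) 0) => // T T1; split; last by rewrite mul0r.
  by apply: card_le0 => z [Xz [tz _]]; apply: none; exists z.
(* Either [X] is a torsion coset, and then finite, or the box argument
   applies. *)
have [full|notfull] := pselect (kernel_coset (const_lattice X) z `<=` X).
  have tcX := full_coset_torsion irrX Xz tz full.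
  case: admX => [finX|[d' [dimX' _ /(_ X tcX dimX')]]]; last by case.
  apply: (finish (fun=> size (enum_fset (fset_set X))) (size (enum_fset (fset_set X)))%:R) => //.
  move=> T T1; split.
    apply: card_leS (card_le_seq (s := enum_fset (fset_set X))).
    by move=> y [Xy _] /=; rewrite -[_ \in _]/(y \in fset_set X) in_fset_set // inE.
  rewrite ler_peMr //; apply: (@le_trans _ _ (T `^ 0)); first by rewrite powRr0.
  rewrite ler_powR //.
  have [le|gt] := leqP delta d.
    have : (d%:R - delta%:R + 1)^-1 <= 1 :> R.
      have ge1 : 1 <= d%:R - delta%:R + 1 :> R.
        by have : delta%:R <= d%:R :> R by [rewrite ler_nat]; lra.
      by rewrite invf_le1 //; lra.
    by have : 0 <= d%:R :> R by [rewrite ler0n]; lra.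
  have : (d%:R - delta%:R + 1)^-1 <= 0 :> R.
    rewrite invr_le0; have : d.+1%:R <= delta%:R :> R by rewrite ler_nat.
    by rewrite -natr1; lra.
  by have : 0 <= d%:R :> R by [rewrite ler0n]; lra.
have [r0 [W0 [free0 dep0 r0d]]] := small_dependent_family irrX dimX dimS Xz notfull.
have [r [W [s [[rpos rr0] indW sep sX proper]]]] := minimal_relation irrX free0 dep0.
have [C [e [erd HC]]] := torsion_upto_relation irrX dimX rpos indW sep sX proper.
pose Q (T : R) m := Num.truncn (2 * (T / m%:R) `^ (r%:R / r.+1%:R)).
have Qge0 (T : R) m : 0 <= 2 * (T / m%:R) `^ (r%:R / r.+1%:R).
  by rewrite mulr_ge0 ?powR_ge0.
pose t (T : R) := Num.truncn T.
apply: (finish (fun T => C * t T ^ d + (\sum_(1 <= m < (t T).+1) C * Q T m ^ r.+2) * t T ^ e)%N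
  (C%:R * (1 + 3 * 2 ^+ r.+2))) => [|T T1].
  by rewrite mulr_ge0 ?ler0n // addr_ge0 // mulr_ge0 // exprn_ge0.
have T0 : 0 <= T by lra.
have tT : (t T)%:R <= T by rewrite truncn_le.
split.
  apply: card_leS (torsion_le_upto T0) _; apply: HC => m q m0 qle.
  rewrite /Q truncn_ge_nat //.
  have rp : r.+1%:R != 0 :> R by rewrite pnatr_eq0.
  have Tm : ((t T %/ m)%N%:R : R) <= T / m%:R.
    rewrite ler_pdivlMr ?ltr0n // -natrM; apply: le_trans tT.
    by rewrite ler_nat leq_divM.
  have Tm0 : 0 <= T / m%:R by rewrite divr_ge0.
  rewrite -(@ler_pXn2r _ r.+1) ?nnegrE ?ler0n // exprMn.
  rewrite -[X in _ * X]powR_mulrn ?powR_ge0 // -powRrM divfK // powR_mulrn //.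
  apply: (@le_trans _ _ (2 ^ r.+1 * (t T %/ m) ^ r)%N%:R).
    by rewrite -natrX ler_nat.
  by rewrite natrM !natrX ler_wpM2l ?exprn_ge0 // lerXn2r ?nnegrE ?ler0n.
have QB m : (0 < m)%N -> (Q T m)%:R <= 2 * (T / m%:R) `^ (r%:R / r.+1%:R).
  by move=> _; rewrite truncn_le.
apply: le_trans (torsion_sum_bound C rpos erd T1 tT QB) _.
rewrite ler_wpM2l ?ler_powR //.
have rd : r.+1%:R <= d%:R - delta%:R + 1 :> R.
  have : (r.+1 + delta)%:R <= d.+1%:R :> R by rewrite ler_nat; lia.
  by rewrite natrD -(natr1 d); lra.
have rp : 0 < r.+1%:R :> R by rewrite ltr0n.
have : (d%:R - delta%:R + 1)^-1 <= r.+1%:R^-1 :> R.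
  by rewrite lef_pV2 ?posrE //; apply: lt_le_trans rd.
by rewrite lerD2l lerN2.
Qed.
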